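(* Let $p\ge1$, $q\ge2$, $p+q>4$, $n=p+q-2$, and let $\mathfrak g=\mathfrak{so}(n+2,\mathbb C)\supset\mathfrak g'=\mathfrak{so}(n+1,\mathbb C)$, $\mathfrak p$, $\mathfrak p'=\mathfrak p\cap\mathfrak g'$ be as in the context. For $j\in\mathbb N$ put $\lambda_j=\frac12(-n+1+j)$. (1) Suppose $j=2k+1$ with $k\in\mathbb N_+$. Then there is a direct sum decomposition of $\mathfrak g'$-modules $$M^{\mathfrak g}_{\mathfrak p}(\lambda_{2k+1})|_{\mathfrak g'}\simeq\bigoplus_{b\in\mathbb N}M^{\mathfrak g'}_{\mathfrak p'}(\lambda_{2k+1}-b).$$ (2) Suppose $j=2k$ with $k\in\mathbb N_+$. Then for each $a=0,\dots,k-1$ there exists a $\mathfrak g'$-submodule $M_{a,2k-a}\subset M^{\mathfrak g}_{\mathfrak p}(\lambda_{2k})$ such that the following two properties hold: the restriction decomposes into a direct sum of $\mathfrak g'$-modules $$M^{\mathfrak g}_{\mathfrak p}(\lambda_{2k})|_{\mathfrak g'}\simeq\bigoplus_{a=0}^{k-1}M_{a,2k-a}\ \oplus\ M^{\mathfrak g'}_{\mathfrak p'}(\lambda_{2k}-k)\ \oplus\bigoplus_{b=2k+1}^\infty M^{\mathfrak g'}_{\mathfrak p'}(\lambda_{2k}-b),$$ and there exists a non-split exact sequence of $\mathfrak g'$-modules $$0\to M^{\mathfrak g'}_{\mathfrak p'}(\lambda_{2k}-a)\to M_{a,2k-a}\to M^{\mathfrak g'}_{\mathfrak p'}(\lambda_{2k}-(2k-a))\to0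 .$$
   Context: $\mathbb N=\{0,1,2,\dots\}$, $\mathbb N_+=\{1,2,\dots\}$. Put $\epsilon_i=1$ for $1\le i\le p-1$, $\epsilon_i=-1$ for $p\le i\le n$. $\mathfrak g\simeq\mathfrak{so}(n+2,\mathbb C)$ is the complexification of the Lie algebra $\mathfrak{so}(p,q)$ of the group preserving $2x_0x_{n+1}+\sum_{i=1}^n\epsilon_ix_i^2$ on $\mathbb R^{n+2}$ (basis $e_0,\dots,e_{n+1}$); $\mathfrak g'\simeq\mathfrak{so}(n+1,\mathbb C)$ is the complexification of the subalgebra $\mathfrak{so}(p,q-1)$ annihilating $e_n$. $\mathfrak p\subset\mathfrak g$ is the parabolic subalgebra stabilizing the line spanned by $e_0$; its Levi part is $\mathfrak{so}(n,\mathbb C)\oplus\mathbb C$ and its nilradical is abelian; $\mathfrak p'=\mathfrak p\cap\mathfrak g'$. $\mathbb C_\lambda$ ($\lambda\in\mathbb C$) is the one-dimensional $\mathfrak p$-module on which an element acts by $\lambda$ times its eigenvalue on $e_0$ (so $\mathbb C_\lambda$ has weight $\lambda e_1$ in standard coordinates); the same notation is used for its restriction to $\mathfrak p'$. $M^{\mathfrak g}_{\mathfrak p}(\lambda)=U(\mathfrak g)\otimes_{U(\mathfrak p)}\mathbb C_\lambda$ and $M^{\mathfrak g'}_{\mathfrak p'}(\lambda)=U(\mathfrak g')\otimes_{U(\mathfrak p')}\mathbb C_\lambda$. *)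

(* Defs.v *)
From HB Require Import structures.
From mathcomp Require Import all_boot all_order all_algebra.
From mathcomp Require Import finmap boolp classical_sets cardinality reals.
From mathcomp Require Import complex monalg ring.

Set Implicit Arguments.
Unset Strict Implicit.
Unset Printing Implicit Defensive.

Import GRing.Theory.
Local Open Scope ring_scope.
Local Open Scope quotient_scope.

(* Modules over a Lie algebra L are represented throughout as left modules over
   its universal enveloping algebra U L (defined below), i.e. as [lmodType (U L)];
   homomorphisms are then MathComp's linear maps, and [resmod] restricts
   scalars along a ring morphism. *)

Definition resmod (R S : nzRingType) (f : {rmorphism R -> S}) (V : lmodType S)
  : Type := V.

Section ResMod.
Context (R S : nzRingType) (f : {rmorphism R -> S}) (V : lmodType S).

HB.instance Definition _ := GRing.Zmodule.on (resmod f V).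

Let scale (a : R) (v : resmod f V) : resmod f V := f a *: (v : V).

Let scaleA a b v : scale a (scale b v) = scale (a * b) v.
Proof. by rewrite /scale scalerA rmorphM. Qed.
Let scale1 : left_id 1 scale.
Proof. by move=> v; rewrite /scale rmorph1 scale1r. Qed.
Let scaleDr : right_distributive scale +%R.
Proof. by move=> a u v; rewrite /scale scalerDr. Qed.
Let scaleDl v : {morph scale^~ v : a b / a + b}.
Proof. by move=> a b; rewrite /scale rmorphD scalerDl. Qed.

HB.instance Definition _ :=
  GRing.Zmodule_isLmodule.Build R (resmod f V) scaleA scale1 scaleDr scaleDl.

Lemma resmodZ (a : R) (v : resmod f V) : a *: v = f a *: (v : V).
Proof. by []. Qed.

End ResMod.

Definition submod (R : nzRingType) (V : lmodType R) (S : submodClosed V) : Type :=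
  {v : V | v \in S}.

Section SubMod.
Context (R : nzRingType) (V : lmodType R) (S : submodClosed V).
HB.instance Definition _ := [isSub of submod S for @sval V (fun v => v \in S)].
HB.instance Definition _ := [Choice of submod S by <:].
HB.instance Definition _ := [SubChoice_isSubLmodule of submod S by <:].
End SubMod.

Record dsum (R : nzRingType) (I : Type) (V : I -> lmodType R) : Type := DSum {
  dsum_val : forall i, V i;
  dsum_fin : finite_set [set i | dsum_val i != 0]%classic }.

Section DSum.
Context (R : nzRingType) (I : Type) (V : I -> lmodType R).
Local Notation D := (dsum V).

HB.instance Definition _ := gen_eqMixin D.
HB.instance Definition _ := gen_choiceMixin D.

Lemma dsumP (x y : D) : (forall i, dsum_val x i = dsum_val y i) <-> x = y.
Proof.
split=> [|->//]; case: x y => [x hx] [y hy] /= xy.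
have {}xy : x = y by apply: functional_extensionality_dep.
by subst y; congr DSum; apply: Prop_irrelevance.
Qed.

Let zero_fin : finite_set [set i | (0 : V i) != 0]%classic.
Proof.
by apply: (sub_finite_set _ (@finite_set0 I)) => i /=; rewrite eqxx.
Qed.
Let opp_fin (x : D) : finite_set [set i | - dsum_val x i != 0]%classic.
Proof. by apply: (sub_finite_set _ (dsum_fin x)) => i /=; rewrite oppr_eq0. Qed.
Let add_fin (x y : D) :
  finite_set [set i | dsum_val x i + dsum_val y i != 0]%classic.
Proof.
apply: (@sub_finite_set _ _ ([set i | dsum_val x i != 0]
  `|` [set i | dsum_val y i != 0])%classic); last first.
  by rewrite finite_setU; split; apply: dsum_fin.
move=> i /=; case: (eqVneq (dsum_val x i) 0) => [->|]; last by left.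
by rewrite add0r; right.
Qed.
Let scale_fin (a : R) (x : D) :
  finite_set [set i | a *: dsum_val x i != 0]%classic.
Proof.
apply: (sub_finite_set _ (dsum_fin x)) => i /=.
by apply: contra_neq => ->; rewrite scaler0.
Qed.

Let add x y : D := DSum (add_fin x y).
Let opp x : D := DSum (opp_fin x).
Let zero : D := DSum zero_fin.
Let scale a x : D := DSum (scale_fin a x).

Let addA : associative add.
Proof. by move=> x y z; apply/dsumP => i /=; rewrite addrA. Qed.
Let addC : commutative add.
Proof. by move=> x y; apply/dsumP => i /=; rewrite addrC. Qed.
Let add0 : left_id zero add.
Proof. by move=> x; apply/dsumP => i /=; rewrite add0r. Qed.
Let addN : left_inverse zero opp add.
Proof. by move=> x; apply/dsumP => i /=; rewrite addNr. Qed.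
HB.instance Definition _ := GRing.isZmodule.Build D addA addC add0 addN.

Let scaleA a b v : scale a (scale b v) = scale (a * b) v.
Proof. by apply/dsumP => i /=; rewrite scalerA. Qed.
Let scale1 : left_id 1 scale.
Proof. by move=> v; apply/dsumP => i /=; rewrite scale1r. Qed.
Let scaleDr : right_distributive scale +%R.
Proof. by move=> a u v; apply/dsumP => i /=; rewrite scalerDr. Qed.
Let scaleDl v : {morph scale^~ v : a b / a + b}.
Proof. by move=> a b; apply/dsumP => i /=; rewrite scalerDl. Qed.
HB.instance Definition _ :=
  GRing.Zmodule_isLmodule.Build R D scaleA scale1 scaleDr scaleDl.

Lemma dsum_valD (x y : D) i : dsum_val (x + y) i = dsum_val x i + dsum_val y i.
Proof. by []. Qed.
Lemma dsum_valZ a (x : D) i : dsum_val (a *: x) i = a *: dsum_val x i.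
Proof. by []. Qed.

End DSum.

Definition mod_iso (R : nzRingType) (V W : lmodType R) : Prop :=
  exists f : {linear V -> W}, bijective f.

Definition has_nonsplit_ses (R : nzRingType) (A E B : lmodType R) : Prop :=
  exists (f : {linear A -> E}) (g : {linear E -> B}),
    [/\ injective f,
        forall y, g y = 0 <-> exists x, y = f x,
        forall z, exists y, g y = z
      & ~ exists s : {linear B -> E}, forall z, g (s z) = z].

Section FreeAbelian.
Context (K : choiceType) (W : zmodType).

Definition zext (h : K -> W) (x : {malg int[K]}) : W :=
  \sum_(k <- msupp x) h k *~ x@_k.

Lemma zextEw (h : K -> W) (d : {fset K}) x : (msupp x `<=` d)%fset ->
  zext h x = \sum_(k <- d) h k *~ x@_k.
Proof.
move=> le; rewrite [LHS](big_fset_incl _ le) // => k _ /mcoeff_outdom ->.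
by rewrite mulr0z.
Qed.

Lemma zext_is_zmod_morphism h : zmod_morphism (zext h).
Proof.
move=> x y; pose d := (msupp x `|` msupp y `|` msupp (x - y))%fset.
rewrite !(@zextEw h d).
- by rewrite -sumrB; apply: eq_bigr => k _; rewrite mcoeffB mulrzBr.
- by rewrite /d -fsetUA fsetUCA fsubsetUl.
- by rewrite /d -fsetUA fsubsetUl.
- by rewrite /d fsubsetUr.
Qed.

HB.instance Definition _ h := GRing.isZmodMorphism.Build _ _ (zext h)
  (zext_is_zmod_morphism h).

Lemma zextU h k : zext h << k >> = h k.
Proof. by rewrite (zextEw _ msuppU_le) big_seq_fset1 mcoeffUU mulr1z. Qed.

Lemma malgU_int (k : K) (c : int) : << c *g k >> = << k >> *~ c :> {malg int[K]}.
Proof. by apply/malgP => k'; rewrite mcoeffU raddfMz /= mcoeffU -mulrzl intz mulrb; case: eqP => //=; rewrite ?mulr1 ?mulr0. Qed.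

Lemma malg_int_ind (P : {malg int[K]} -> Prop) :
  (forall k, P << k >>) -> P 0 -> (forall x y, P x -> P y -> P (x - y)) ->
  forall x, P x.
Proof.
move=> PU P0 PB.
have PN x : P x -> P (- x) by move=> Px; rewrite -sub0r; apply: PB.
have PD x y : P x -> P y -> P (x + y).
  by move=> Px Py; rewrite -[y]opprK; apply: PB => //; apply: PN.
have PMn x n : P x -> P (x *+ n).
  by move=> Px; elim: n => [|n IHn]; rewrite ?mulr0n // mulrS; apply: PD.
move=> x; rewrite [x]monalgE; elim/big_rec: _ => // k y _ Py; apply: PD => //.
rewrite malgU_int; case: (x@_k) => n; first by rewrite -pmulrn; apply: PMn.
by rewrite NegzE mulrNz -pmulrn; apply/PN/PMn.
Qed.

End FreeAbelian.

(* The tensor product of A and V over B, where A is a right B-module through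
   f : B -> A: the free abelian group on A * V modulo the usual relations. *)

Section Tensor.
Context (B A : nzRingType) (f : {rmorphism B -> A}) (V : lmodType B).

Local Notation F := {malg int[(A * V)%type]}.

Definition tgen (a : A) (v : V) : F := << (a, v) >>.

Inductive tensor_rel : F -> Prop :=
| tensor_rel_l a a' v : tensor_rel (tgen (a + a') v - (tgen a v + tgen a' v))
| tensor_rel_r a v v' : tensor_rel (tgen a (v + v') - (tgen a v + tgen a v'))
| tensor_rel_m a b v : tensor_rel (tgen (a * f b) v - tgen a (b *: v)).

Inductive tensor_sub : F -> Prop :=
| tensor_sub_rel x : tensor_rel x -> tensor_sub x
| tensor_sub0 : tensor_sub 0
| tensor_subB x y : tensor_sub x -> tensor_sub y -> tensor_sub (x - y).

Definition tensor_null : {pred F} := fun x => `[< tensor_sub x >].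

Let tensor_null_zmod : zmod_closed tensor_null.
Proof.
split; first by apply/asboolP; apply: tensor_sub0.
by move=> x y /asboolP hx /asboolP hy; apply/asboolP; apply: tensor_subB.
Qed.

HB.instance Definition _ := GRing.isZmodClosed.Build F tensor_null
  tensor_null_zmod.

Definition tensor : Type := Quotient.quot tensor_null.

HB.instance Definition _ := GRing.Zmodule.on tensor.
HB.instance Definition _ := EqQuotient.on tensor.

Definition tens (a : A) (v : V) : tensor := \pi_tensor (tgen a v).

Lemma tensor_indP (P : tensor -> Prop) :
  (forall a v, P (tens a v)) -> P 0 -> (forall x y, P x -> P y -> P (x - y)) ->
  forall x, P x.
Proof.
move=> Pt P0 PB x; rewrite -[x]reprK; elim/malg_int_ind: (repr x) => //.
- by case=> a v; apply: Pt.
- by rewrite raddf0.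
- by move=> y z Py Pz; rewrite raddfB; apply: PB.
Qed.

Lemma pi_tensorP x y : \pi_tensor x = \pi_tensor y <-> tensor_sub (x - y).
Proof.
split=> [/eqP|h]; last apply/eqP; rewrite -Quotient.idealrBE => /=.
  by move/asboolP.
exact/asboolP.
Qed.

Lemma pi_tensor0 x : tensor_sub x -> \pi_tensor x = 0.
Proof. by move=> hx; rewrite -(raddf0 (\pi_tensor)); apply/pi_tensorP; rewrite subr0. Qed.

Lemma tensDl a a' v : tens (a + a') v = tens a v + tens a' v.
Proof.
apply/eqP; rewrite -subr_eq0 /tens -raddfD -raddfB; apply/eqP/pi_tensor0.
exact/tensor_sub_rel/tensor_rel_l.
Qed.

Lemma tensDr a v v' : tens a (v + v') = tens a v + tens a v'.
Proof.
apply/eqP; rewrite -subr_eq0 /tens -raddfD -raddfB; apply/eqP/pi_tensor0.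
exact/tensor_sub_rel/tensor_rel_r.
Qed.

Lemma tensM a b v : tens (a * f b) v = tens a (b *: v).
Proof.
apply/eqP; rewrite -subr_eq0 /tens -raddfB; apply/eqP/pi_tensor0.
exact/tensor_sub_rel/tensor_rel_m.
Qed.

Let scale0 (c : A) : F -> tensor := zext (fun k => tens (c * k.1) k.2).

Let scale0_sub c x : tensor_sub x -> scale0 c x = 0.
Proof.
elim=> [_ []||y z _ hy _ hz].
- by move=> a a' v; rewrite /scale0 raddfB raddfD /= !zextU /= mulrDr tensDl subrr.
- by move=> a v v'; rewrite /scale0 raddfB raddfD /= !zextU /= tensDr subrr.
- by move=> a b v; rewrite /scale0 raddfB /= !zextU /= mulrA tensM subrr.
- exact: raddf0.
- by rewrite /scale0 raddfB /= -!/(scale0 _ _) hy hz subr0.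
Qed.

Definition tensor_scale (c : A) (x : tensor) : tensor :=
  zext (fun k => tens (c * k.1) k.2) (repr x).

Let scale_pi c x : tensor_scale c (\pi_tensor x) = scale0 c x.
Proof.
apply/eqP; rewrite -subr_eq0 /tensor_scale /scale0 -raddfB; apply/eqP.
by apply/scale0_sub/pi_tensorP; rewrite reprK.
Qed.

Lemma tensor_scaleE c a v : tensor_scale c (tens a v) = tens (c * a) v.
Proof. by rewrite scale_pi /scale0 zextU. Qed.

Lemma tensor_scale_is_zmod_morphism c : zmod_morphism (tensor_scale c).
Proof.
move=> x y; rewrite -[x]reprK -[y]reprK -raddfB !scale_pi.
exact: raddfB.
Qed.
HB.instance Definition _ c := GRing.isZmodMorphism.Build _ _ (tensor_scale c)
  (tensor_scale_is_zmod_morphism c).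

Let tensor_scaleB c x y : tensor_scale c (x - y) = tensor_scale c x - tensor_scale c y.
Proof. exact: raddfB. Qed.

Let scaleA a b x : tensor_scale a (tensor_scale b x) = tensor_scale (a * b) x.
Proof.
elim/tensor_indP: x => [c v||x y hx hy]; rewrite ?raddf0 //.
  by rewrite !tensor_scaleE mulrA.
by rewrite !tensor_scaleB hx hy.
Qed.
Let scale1 : left_id 1 tensor_scale.
Proof.
elim/tensor_indP => [c v||x y hx hy]; rewrite ?raddf0 //.
  by rewrite tensor_scaleE mul1r.
by rewrite tensor_scaleB hx hy.
Qed.
Let scaleDr : right_distributive tensor_scale +%R.
Proof. by move=> c x y; rewrite raddfD. Qed.
Let scaleDl x : {morph tensor_scale^~ x : a b / a + b}.
Proof.
move=> a b; elim/tensor_indP: x => [c v||x y hx hy]; rewrite ?raddf0 ?addr0 //.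
  by rewrite !tensor_scaleE mulrDl tensDl.
by rewrite !tensor_scaleB hx hy /= opprD addrACA.
Qed.
HB.instance Definition _ :=
  GRing.Zmodule_isLmodule.Build A tensor scaleA scale1 scaleDr scaleDl.

Lemma tensZ c a v : c *: tens a v = tens (c * a) v.
Proof. exact: tensor_scaleE. Qed.

End Tensor.

HB.mixin Record isLieAlgebra (K : fieldType) L of GRing.Lmodule K L := {
  lieb : L -> L -> L;
  lieb_linearl : forall c x y z, lieb (c *: x + y) z = c *: lieb x z + lieb y z;
  lieb_linearr : forall c x y z, lieb x (c *: y + z) = c *: lieb x y + lieb x z;
  liebxx : forall x, lieb x x = 0;
  lieb_jacobi : forall x y z,
    lieb x (lieb y z) + lieb y (lieb z x) + lieb z (lieb x y) = 0 }.

#[short(type="lieAlgType")]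
HB.structure Definition LieAlgebra (K : fieldType) :=
  { L of GRing.Lmodule K L & isLieAlgebra K L }.

Definition freealg (K : fieldType) (X : choiceType) : Type :=
  {malg K[{fmonom X}]}.

(* locked for performance: the multiplication of the monoid algebra *)
HB.lock Definition freealg_mul (K : fieldType) (X : choiceType)
  (x y : freealg K X) : freealg K X := (x : {malg K[{fmonom X}]}) * y.
Canonical freealg_mul_unlockable := Unlockable freealg_mul.unlock.

Section FreeAlgebra.
Context (K : fieldType) (X : choiceType).
Local Notation F := (freealg K X).
Local Notation F0 := {malg K[{fmonom X}]}.

HB.instance Definition _ := GRing.Lmodule.on F.

Let mul := @freealg_mul K X.
Let mulE x y : mul x y = (x : F0) * (y : F0).
Proof. by rewrite /mul unlock. Qed.
Let one : F := (1 : F0).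

Let mulA : associative mul.
Proof. by move=> x y z; rewrite !mulE (mulrA (x : F0)). Qed.
Let mul1 : left_id one mul.
Proof. by move=> x; rewrite mulE (mul1r (x : F0)). Qed.
Let mulr1 : right_id one mul.
Proof. by move=> x; rewrite mulE (mulr1 (x : F0)). Qed.
Let mulDl : left_distributive mul +%R.
Proof. by move=> x y z; rewrite !mulE (mulrDl (x : F0)). Qed.
Let mulDr : right_distributive mul +%R.
Proof. by move=> x y z; rewrite !mulE (mulrDr (x : F0)). Qed.
Let one_neq0 : one != 0.
Proof. exact: (oner_neq0 F0). Qed.
HB.instance Definition _ :=
  GRing.Zmodule_isNzRing.Build F mulA mul1 mulr1 mulDl mulDr one_neq0.

Let scaleAl (a : K) (x y : F) : a *: (mul x y) = mul (a *: x) y.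
Proof. by rewrite !mulE (scalerAl a (x : F0)). Qed.
HB.instance Definition _ := GRing.Lmodule_isLalgebra.Build K F scaleAl.

Let malg_scaleAr (a : K) (x y : F0) : a *: (x * y) = x * (a *: y).
Proof.
have cx : x * a%:MP = a%:MP * x.
  rewrite [x]monalgE mulr_sumr mulr_suml; apply: eq_bigr => k _.
  by rewrite !malgM_def !fgmulUU mul1m mulm1 mulrC.
by rewrite -(mul_malgC a y) (mulrA x) cx -(mulrA _ x) mul_malgC.
Qed.
Let scaleAr (a : K) (x y : F) : a *: (mul x y) = mul x (a *: y).
Proof. rewrite !mulE; exact: malg_scaleAr. Qed.
HB.instance Definition _ := GRing.Lalgebra_isAlgebra.Build K F scaleAr.

Lemma freealgM (x y : F) : x * y = (x : F0) * (y : F0).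
Proof. exact: mulE. Qed.

Lemma freealg1 : (1 : F) = (1 : F0).
Proof. by []. Qed.

Definition fgen (x : X) : F := (<< fmu x >> : F0).

(* The constant term. *)
Definition fconst (x : F) : K := mcoeff (fmone X) (x : F0).

Let fconst_is_zmod_morphism : zmod_morphism fconst.
Proof. by move=> x y; apply: mcoeffB. Qed.
HB.instance Definition _ := GRing.isZmodMorphism.Build F K fconst
  fconst_is_zmod_morphism.
Lemma fconstB x y : fconst (x - y) = fconst x - fconst y.
Proof. exact: raddfB. Qed.
Lemma fconstD x y : fconst (x + y) = fconst x + fconst y.
Proof. exact: raddfD. Qed.
Lemma fconstZ a x : fconst (a *: x) = a * fconst x.
Proof. exact: mcoeffZ. Qed.
Lemma fconstM x y : fconst (x * y) = fconst x * fconst y.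
Proof. by rewrite /fconst freealgM; apply: (mcoeff1g_is_multiplicative _ _).1. Qed.
Lemma fconst1 : fconst 1 = 1.
Proof. exact: (mcoeff1g_is_multiplicative _ _).2. Qed.
Lemma fconst_fgen x : fconst (fgen x) = 0.
Proof.
rewrite /fconst mcoeffU; case: eqP => // /(congr1 (@fdeg _)).
by rewrite fdegU fdeg1.
Qed.

End FreeAlgebra.

(* The tensor algebra of L is the free algebra on the set L modulo the linearity
   relations [U_rel_lin]; [U_rel_lie] then gives the enveloping algebra. *)

Section Enveloping.
Context (K : fieldType) (L : lieAlgType K).

Local Notation F := (freealg K L).
Local Notation fgen' := (@fgen K L).

Inductive U_rel : F -> Prop :=
| U_rel_lin c x y : U_rel (fgen' (c *: x + y) - (c *: fgen' x + fgen' y))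
| U_rel_lie x y : U_rel (fgen' (lieb x y)
    - (fgen' x * fgen' y - fgen' y * fgen' x)).

Inductive U_ideal : F -> Prop :=
| U_ideal_rel x : U_rel x -> U_ideal x
| U_ideal0 : U_ideal 0
| U_idealB x y : U_ideal x -> U_ideal y -> U_ideal (x - y)
| U_idealMl a x : U_ideal x -> U_ideal (a * x)
| U_idealMr a x : U_ideal x -> U_ideal (x * a).

Definition U_null : {pred F} := fun x => `[< U_ideal x >].

Let U_null_zmod : zmod_closed U_null.
Proof.
split; first by apply/asboolP; apply: U_ideal0.
by move=> x y /asboolP hx /asboolP hy; apply/asboolP; apply: U_idealB.
Qed.

HB.instance Definition _ := GRing.isZmodClosed.Build F U_null U_null_zmod.

Definition U : Type := Quotient.quot U_null.

HB.instance Definition _ := GRing.Zmodule.on U.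
HB.instance Definition _ := EqQuotient.on U.

Lemma pi_UP x y : \pi_U x = \pi_U y <-> U_ideal (x - y).
Proof.
split=> [/eqP|h]; last apply/eqP; rewrite -Quotient.idealrBE => /=.
  by move/asboolP.
exact/asboolP.
Qed.

Definition U_one : U := \pi_U 1.
Definition U_mul : U -> U -> U :=
  locked (fun u v => \pi_U (repr u * repr v)).
Definition U_scale : K -> U -> U := locked (fun c u => \pi_U (c *: repr u)).

Lemma pi_UM x y : \pi_U (x * y) = U_mul (\pi_U x) (\pi_U y).
Proof.
rewrite /U_mul -lock; apply/pi_UP; set x' := repr _; set y' := repr _.
have -> : x * y - x' * y' = (x - x') * y - x' * (y' - y).
  by rewrite mulrBl mulrBr opprB addrA subrK.
apply: U_idealB; [apply: U_idealMr | apply: U_idealMl];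
  by apply/pi_UP; rewrite reprK.
Qed.

Lemma pi_UZ c x : \pi_U (c *: x) = U_scale c (\pi_U x).
Proof.
rewrite /U_scale -lock; apply/pi_UP; rewrite -scalerBr -[_ - _]mul1r scalerAl; apply: U_idealMl.
by apply/pi_UP; rewrite reprK.
Qed.

Lemma pi_UD x y : \pi_U (x + y) = \pi_U x + \pi_U y.
Proof. exact: (raddfD (\pi_U)). Qed.
Lemma pi_UB x y : \pi_U (x - y) = \pi_U x - \pi_U y.
Proof. exact: (raddfB (\pi_U)). Qed.

Let mulA : associative U_mul.
Proof.
move=> u v w; rewrite -[u]reprK -[v]reprK -[w]reprK.
by rewrite -!pi_UM mulrA.
Qed.
Let mul1 : left_id U_one U_mul.
Proof. by move=> u; rewrite -[u]reprK -pi_UM mul1r. Qed.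
Let mulr1 : right_id U_one U_mul.
Proof. by move=> u; rewrite -[u]reprK -pi_UM mulr1. Qed.
Let mulDl : left_distributive U_mul +%R.
Proof.
move=> u v w; rewrite -[u]reprK -[v]reprK -[w]reprK.
by rewrite -!pi_UM -!pi_UD -!pi_UM mulrDl.
Qed.
Let mulDr : right_distributive U_mul +%R.
Proof.
move=> u v w; rewrite -[u]reprK -[v]reprK -[w]reprK.
by rewrite -!pi_UM -!pi_UD -!pi_UM mulrDr.
Qed.

Let U_ideal_fconst x : U_ideal x -> fconst x = 0.
Proof.
elim=> {x} [_ [c x y|x y]||x y _ hx _ hy|a x _ hx|a x _ hx].
- by rewrite fconstB fconstD fconstZ !fconst_fgen mulr0 addr0 subrr.
- by rewrite !fconstB !fconstM !fconst_fgen mulr0 !subr0.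
- by rewrite raddf0.
- by rewrite fconstB hx hy subrr.
- by rewrite fconstM hx mulr0.
- by rewrite fconstM hx mul0r.
Qed.

Let one_neq0 : U_one != 0.
Proof.
apply/eqP; rewrite /U_one -(raddf0 (\pi_U)) => /pi_UP; rewrite subr0.
by move/U_ideal_fconst/eqP; rewrite fconst1 oner_eq0.
Qed.

HB.instance Definition _ :=
  GRing.Zmodule_isNzRing.Build U mulA mul1 mulr1 mulDl mulDr one_neq0.

Let scaleA a b v : U_scale a (U_scale b v) = U_scale (a * b) v.
Proof. by rewrite -[v]reprK -!pi_UZ scalerA. Qed.
Let scale1 : left_id 1 U_scale.
Proof. by move=> v; rewrite -[v]reprK -!pi_UZ scale1r. Qed.
Let scaleDr : right_distributive U_scale +%R.
Proof.
move=> a u v; rewrite -[u]reprK -[v]reprK.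
by rewrite -pi_UD -!pi_UZ -pi_UD scalerDr. Qed.
Let scaleDl v : {morph U_scale^~ v : a b / a + b}.
Proof. by move=> a b; rewrite -[v]reprK -!pi_UZ -!pi_UD scalerDl. Qed.
HB.instance Definition _ :=
  GRing.Zmodule_isLmodule.Build K U scaleA scale1 scaleDr scaleDl.

Let scaleAl (a : K) (u v : U) : a *: (u * v) = (a *: u) * v.
Proof.
by rewrite -[u]reprK -[v]reprK -[LHS]/(U_scale _ (U_mul _ _)) -pi_UM -pi_UZ
  scalerAl pi_UM pi_UZ.
Qed.
HB.instance Definition _ := GRing.Lmodule_isLalgebra.Build K U scaleAl.

Let scaleAr (a : K) (u v : U) : a *: (u * v) = u * (a *: v).
Proof.
by rewrite -[u]reprK -[v]reprK -[LHS]/(U_scale _ (U_mul _ _)) -pi_UM -pi_UZ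
  scalerAr pi_UM pi_UZ.
Qed.
HB.instance Definition _ := GRing.Lalgebra_isAlgebra.Build K U scaleAr.

Definition ugen (x : L) : U := \pi_U (fgen' x).

Lemma ugen_linear : linear ugen.
Proof.
move=> c x y; apply: (_ : \pi_U _ = U_scale c _ + _).
by rewrite -pi_UZ -pi_UD; apply/pi_UP; apply/U_ideal_rel/U_rel_lin.
Qed.
HB.instance Definition _ := GRing.isLinear.Build K L U *:%R ugen ugen_linear.

Lemma ugen_lie x y : ugen (lieb x y) = ugen x * ugen y - ugen y * ugen x.
Proof.
apply: (_ : \pi_U _ = U_mul _ _ - U_mul _ _).
by rewrite -!pi_UM -pi_UB; apply/pi_UP; apply/U_ideal_rel/U_rel_lie.
Qed.

End Enveloping.

Record lieMorph (K : fieldType) (L : lieAlgType K) (A : algType K) := LieMorph {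
  lm_fun :> {linear L -> A};
  lm_lie : forall x y,
    lm_fun (lieb x y) = lm_fun x * lm_fun y - lm_fun y * lm_fun x }.

Section FreeLift.
Context (K : fieldType) (X : choiceType) (A : algType K) (f : X -> A).
Local Notation F := (freealg K X).
Local Notation F0 := {malg K[{fmonom X}]}.

Definition fmonom_lift (m : {fmonom X}) : A := \prod_(i <- (m : seq X)) f i.

Let fmonom_lift_mmorphism : mmorphism fmonom_lift.
Proof.
split; last by rewrite /fmonom_lift fm1 big_nil.
by move=> m1 m2; rewrite /fmonom_lift fmM big_cat.
Qed.
HB.instance Definition _ :=
  isMultiplicative.Build {fmonom X} A fmonom_lift fmonom_lift_mmorphism.

Definition freealg_lift (x : F) : A := mmap (in_alg A) fmonom_lift (x : F0).

Let freealg_lift_is_zmod_morphism : zmod_morphism freealg_lift.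
Proof. by move=> x y; apply: mmap_is_additive. Qed.
HB.instance Definition _ := GRing.isZmodMorphism.Build F A freealg_lift
  freealg_lift_is_zmod_morphism.

Let freealg_lift_is_monoid_morphism : monoid_morphism freealg_lift.
Proof.
split.
  by apply: mmap1.
move=> x y; rewrite freealgM.
apply: (@commr_mmap_is_multiplicative _ _ _ (in_alg A) fmonom_lift _).1.
by move=> g m m'; rewrite /GRing.comm /= mulr_algl mulr_algr.
Qed.
HB.instance Definition _ := GRing.isMonoidMorphism.Build F A freealg_lift
  freealg_lift_is_monoid_morphism.

Lemma freealg_liftZ c x : freealg_lift (c *: x) = c *: freealg_lift x.
Proof.
by apply: etrans (mmapZ _ _) _; rewrite /= mulr_algl.
Qed.

Lemma freealg_lift_gen x : freealg_lift (fgen K x) = f x.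
Proof.
by rewrite /freealg_lift mmapU /= scale1r mul1r /fmonom_lift fmU big_seq1.
Qed.

End FreeLift.

Section ULift.
Context (K : fieldType) (L : lieAlgType K) (A : algType K) (f : lieMorph L A).

Definition Ulift (u : U L) : A := freealg_lift f (repr u).

Let lift_ideal x : U_ideal x -> freealg_lift f x = 0.
Proof.
elim=> {x} [_ [c x y|x y]||x y _ hx _ hy|a x _ hx|a x _ hx].
- by rewrite rmorphB rmorphD /= freealg_liftZ !freealg_lift_gen linearP subrr.
- by rewrite !rmorphB !rmorphM /= !freealg_lift_gen lm_lie subrr.
- by rewrite rmorph0.
- by rewrite rmorphB /= hx hy subrr.
- by rewrite rmorphM /= hx mulr0.
- by rewrite rmorphM /= hx mul0r.
Qed.

Lemma Ulift_pi x : Ulift (\pi_(U L) x) = freealg_lift f x.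
Proof.
apply/eqP; rewrite -subr_eq0 -rmorphB /=; apply/eqP/lift_ideal/pi_UP.
by rewrite reprK.
Qed.

Let Ulift_is_zmod_morphism : zmod_morphism Ulift.
Proof.
move=> u v; rewrite -[u]reprK -[v]reprK -pi_UB !Ulift_pi.
exact: (rmorphB (freealg_lift f)).
Qed.
HB.instance Definition _ := GRing.isZmodMorphism.Build (U L) A Ulift
  Ulift_is_zmod_morphism.

Let Ulift_is_monoid_morphism : monoid_morphism Ulift.
Proof.
split; first by apply: etrans (Ulift_pi _) _; exact: (rmorph1 (freealg_lift f)).
move=> u v; rewrite -[u]reprK -[v]reprK.
have -> : \pi_(U L) (repr u) * \pi_(U L) (repr v) = \pi_(U L) (repr u * repr v).
  by rewrite pi_UM.
by rewrite !Ulift_pi; exact: (rmorphM (freealg_lift f)).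
Qed.
HB.instance Definition _ := GRing.isMonoidMorphism.Build (U L) A Ulift
  Ulift_is_monoid_morphism.

Lemma UliftZ c u : Ulift (c *: u) = c *: Ulift u.
Proof.
rewrite -[u]reprK.
have -> : c *: \pi_(U L) (repr u) = \pi_(U L) (c *: repr u) by rewrite pi_UZ.
by rewrite !Ulift_pi freealg_liftZ.
Qed.

Lemma Ulift_gen x : Ulift (ugen x) = f x.
Proof. by rewrite Ulift_pi freealg_lift_gen. Qed.

End ULift.

Record lieSub (K : fieldType) (N : nat) := LieSub {
  lsv :> {vspace 'M[K]_N};
  lsv_closed : forall X Y : 'M[K]_N,
    X \in lsv -> Y \in lsv -> X *m Y - Y *m X \in lsv }.

Definition lie_of (K : fieldType) (N : nat) (S : lieSub K N) : Type :=
  subvs_of S.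

Section LieOf.
Context (K : fieldType) (N : nat) (S : lieSub K N).
Local Notation L := (lie_of S).

HB.instance Definition _ := Vector.on L.

Definition lval (x : L) : 'M[K]_N := vsval x.

Lemma lval_inj : injective lval.
Proof. exact: val_inj. Qed.
Let lval_is_linear : linear lval.
Proof. by move=> c x y; apply: linearP. Qed.
HB.instance Definition _ := GRing.isLinear.Build K L 'M[K]_N *:%R lval
  lval_is_linear.
Lemma lvalDZ c x y : lval (c *: x + y) = c *: lval x + lval y.
Proof. exact: lval_is_linear. Qed.
Lemma lvalD x y : lval (x + y) = lval x + lval y.
Proof. by rewrite -[x]scale1r lvalDZ !scale1r. Qed.
Lemma lvalP x : lval x \in lsv S.
Proof. exact: subvsP. Qed.

Definition lmk X (hX : X \in lsv S) : L := Subvs hX.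

Let br (x y : L) : L := lmk (lsv_closed (lvalP x) (lvalP y)).
Let brE x y : lval (br x y) = lval x *m lval y - lval y *m lval x.
Proof. by []. Qed.

Let br_linearl c x y z : br (c *: x + y) z = c *: br x z + br y z.
Proof.
apply: lval_inj; rewrite lvalDZ !brE lvalDZ.
rewrite mulmxDl mulmxDr -scalemxAl -scalemxAr scalerBr opprD.
by rewrite addrACA.
Qed.
Let br_linearr c x y z : br x (c *: y + z) = c *: br x y + br x z.
Proof.
apply: lval_inj; rewrite lvalDZ !brE lvalDZ.
rewrite mulmxDl mulmxDr -scalemxAl -scalemxAr scalerBr opprD.
by rewrite addrACA.
Qed.
Let brxx x : br x x = 0.
Proof. by apply: lval_inj; rewrite brE subrr raddf0. Qed.
Let br_jacobi x y z : br x (br y z) + br y (br z x) + br z (br x y) = 0.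
Proof.
apply: lval_inj; rewrite !lvalD raddf0 !brE.
set X := lval x; set Y := lval y; set Z := lval z.
rewrite !mulmxBl !mulmxBr !mulmxA !opprB.
move: (X *m Y *m Z) (X *m Z *m Y) (Y *m Z *m X) => a b c.
move: (Z *m Y *m X) (Y *m X *m Z) (Z *m X *m Y) => d e g.
by apply/matrixP => i j; rewrite !mxE; ring.
Qed.
HB.instance Definition _ := isLieAlgebra.Build K L
  br_linearl br_linearr brxx br_jacobi.

Lemma lval_lieb (x y : L) : lval (lieb x y) = lval x *m lval y - lval y *m lval x.
Proof. by []. Qed.

End LieOf.

Section Inclusion.
Context (K : fieldType) (N : nat) (S T : lieSub K N).
Hypothesis sST : (S <= T)%VS.

Definition lincl (x : lie_of S) : lie_of T :=
  lmk (subvP sST (lval x) (lvalP x)).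

Lemma lval_lincl x : lval (lincl x) = lval x.
Proof. by []. Qed.

Let Ulincl (x : lie_of S) : U (lie_of T) := ugen (lincl x).
Let Ulincl_is_linear : linear Ulincl.
Proof.
move=> c x y; rewrite -[RHS]ugen_linear; congr ugen.
by apply: lval_inj; rewrite lval_lincl [RHS]lvalDZ lvalDZ.
Qed.
HB.instance Definition _ := GRing.isLinear.Build K (lie_of S) (U (lie_of T))
  *:%R Ulincl Ulincl_is_linear.
Let Ulincl_lie x y :
  Ulincl (lieb x y) = Ulincl x * Ulincl y - Ulincl y * Ulincl x.
Proof. by rewrite -ugen_lie; congr ugen; apply: lval_inj. Qed.

Definition Uincl : U (lie_of S) -> U (lie_of T) :=
  Ulift (LieMorph Ulincl_lie).

HB.instance Definition _ := GRing.RMorphism.on Uincl.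

Lemma Uincl_gen x : Uincl (ugen x) = ugen (lincl x).
Proof. exact: Ulift_gen. Qed.

End Inclusion.

Section LieSubs.
Context (K : fieldType) (N : nat).

Let lieI_closed (S T : lieSub K N) (X Y : 'M[K]_N) :
  X \in (S :&: T)%VS -> Y \in (S :&: T)%VS ->
  X *m Y - Y *m X \in (S :&: T)%VS.
Proof.
rewrite !memv_cap => /andP[XS XT] /andP[YS YT].
by rewrite !lsv_closed.
Qed.
Definition lieI S T : lieSub K N := LieSub (@lieI_closed S T).

Lemma mem_lieI S T X :
  (X \in lsv (lieI S T)) = (X \in lsv S) && (X \in lsv T).
Proof. exact: memv_cap. Qed.

Lemma lieI_subl S T : (lieI S T <= S)%VS.
Proof. exact: capvSl. Qed.
Lemma lieI_subr S T : (lieI S T <= T)%VS.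
Proof. exact: capvSr. Qed.

Definition form_map (J X : 'M[K]_N) : 'M[K]_N := X^T *m J + J *m X.

Let form_map_is_linear J : linear (form_map J).
Proof.
move=> c X Y; rewrite /form_map linearP /= mulmxDl mulmxDr.
by rewrite -scalemxAl -scalemxAr scalerDr addrACA.
Qed.
HB.instance Definition _ J := GRing.isLinear.Build K 'M[K]_N 'M[K]_N *:%R
  (form_map J) (form_map_is_linear J).

Let mem_form0 J X :
  (X \in lker (linfun (form_map J))) = (X^T *m J + J *m X == 0).
Proof. by rewrite memv_ker lfunE. Qed.

Let form_closed J X Y :
  X \in lker (linfun (form_map J)) -> Y \in lker (linfun (form_map J)) ->
  X *m Y - Y *m X \in lker (linfun (form_map J)).
Proof.
rewrite !mem_form0 !addr_eq0 => /eqP hX /eqP hY; apply/eqP.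
rewrite linearB /= !trmx_mul mulmxBl mulmxBr -!mulmxA hX hY.
by rewrite !mulmxN !mulmxA hX hY !mulNmx !opprK opprB.
Qed.
Definition lie_form J : lieSub K N := LieSub (@form_closed J).

Lemma mem_form J X : (X \in lsv (lie_form J)) = (X^T *m J + J *m X == 0).
Proof. exact: mem_form0. Qed.

Definition evalv (v : 'cV[K]_N) (X : 'M[K]_N) : 'cV[K]_N := X *m v.

Let evalv_is_linear v : linear (evalv v).
Proof. by move=> c X Y; rewrite /evalv mulmxDl scalemxAl. Qed.
HB.instance Definition _ v := GRing.isLinear.Build K 'M[K]_N 'cV[K]_N *:%R
  (evalv v) (evalv_is_linear v).

Let mem_stab0 v X :
  (X \in (linfun (evalv v) @^-1: <[v]>)%VS) = (X *m v \in <[v]>%VS).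
Proof. by rewrite -memv_preim lfunE. Qed.

Let stab_closed v X Y :
  X \in (linfun (evalv v) @^-1: <[v]>)%VS ->
  Y \in (linfun (evalv v) @^-1: <[v]>)%VS ->
  X *m Y - Y *m X \in (linfun (evalv v) @^-1: <[v]>)%VS.
Proof.
rewrite !mem_stab0 => /vlineP[a hX] /vlineP[b hY].
rewrite mulmxBl -!mulmxA hX hY -!scalemxAr hX hY !scalerA mulrC subrr.
exact: mem0v.
Qed.
Definition lie_stab v : lieSub K N := LieSub (@stab_closed v).

Lemma mem_stab v X : (X \in lsv (lie_stab v)) = (X *m v \in <[v]>%VS).
Proof. exact: mem_stab0. Qed.

Let mem_ann0 v X : (X \in lker (linfun (evalv v))) = (X *m v == 0).
Proof. by rewrite memv_ker lfunE. Qed.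

Let ann_closed v X Y :
  X \in lker (linfun (evalv v)) -> Y \in lker (linfun (evalv v)) ->
  X *m Y - Y *m X \in lker (linfun (evalv v)).
Proof.
rewrite !mem_ann0 => /eqP hX /eqP hY.
by rewrite mulmxBl -!mulmxA hX hY !mulmx0 subrr.
Qed.
Definition lie_ann v : lieSub K N := LieSub (@ann_closed v).

Lemma mem_ann v X : (X \in lsv (lie_ann v)) = (X *m v == 0).
Proof. exact: mem_ann0. Qed.

End LieSubs.

Section SO.
Context (K : fieldType) (p n : nat).
Local Notation N := n.+2.

Definition basis_vec (i : nat) : 'cV[K]_N := delta_mx (inord i) 0.

(* Only used for 1 <= i <= n; i < p means i <= p - 1. *)
Definition eps (i : nat) : K := if (i < p)%N then 1 else -1.

(* The Gram matrix of 2 x_0 x_(n+1) + \sum_(1 <= i <= n) eps_i x_i ^ 2. *)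
Definition gram : 'M[K]_N := \matrix_(i, j)
  if (i == 0%N :> nat) || (i == n.+1 :> nat) then ((i + j)%N == n.+1)%:R
  else eps i *+ (i == j).

Definition g_lie : lieSub K N := lie_form gram.
Definition g'_lie : lieSub K N := lieI g_lie (lie_ann (basis_vec n)).
Definition p_lie : lieSub K N := lieI g_lie (lie_stab (basis_vec 0)).
Definition p'_lie : lieSub K N := lieI p_lie g'_lie.

Lemma mem_g X : (X \in lsv g_lie) = (X^T *m gram + gram *m X == 0).
Proof. exact: mem_form. Qed.
Lemma mem_g' X :
  (X \in lsv g'_lie) = (X \in lsv g_lie) && (X *m basis_vec n == 0).
Proof. by apply: etrans (mem_lieI _ _ _) _; congr (_ && _); apply: mem_ann. Qed.
Lemma mem_p X : (X \in lsv p_lie) =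
  (X \in lsv g_lie) && (X *m basis_vec 0 \in <[basis_vec 0]>%VS).
Proof. by apply: etrans (mem_lieI _ _ _) _; congr (_ && _); apply: mem_stab. Qed.
Lemma mem_p' X : (X \in lsv p'_lie) = (X \in lsv p_lie) && (X \in lsv g'_lie).
Proof. exact: mem_lieI. Qed.

Definition Ug : nzRingType := U (lie_of g_lie).
Definition Ug' : nzRingType := U (lie_of g'_lie).
Definition Up : nzRingType := U (lie_of p_lie).
Definition Up' : nzRingType := U (lie_of p'_lie).

Definition Ug'_g : {rmorphism Ug' -> Ug} := Uincl (lieI_subl g_lie _).
Definition Up_g : {rmorphism Up -> Ug} := Uincl (lieI_subl g_lie _).
Definition Up'_p : {rmorphism Up' -> Up} := Uincl (lieI_subl p_lie _).
Definition Up'_g' : {rmorphism Up' -> Ug'} := Uincl (lieI_subr p_lie _).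

(* The coefficient of e_0 in X e_0, i.e. the eigenvalue of X on e_0 when X
   stabilizes the line of e_0 (lemma [eig0P]). *)
Definition eig0 (X : 'M[K]_N) : K := (X *m basis_vec 0) (inord 0) 0.

Lemma eig0P (X : lie_of p_lie) :
  lval X *m basis_vec 0 = eig0 (lval X) *: basis_vec 0.
Proof.
have := lvalP X; rewrite mem_p => /andP[_ /vlineP[c h]].
by rewrite /eig0 h !mxE !eqxx mulr1.
Qed.

Section Character.
Variable la : K.

Let chi (X : lie_of p_lie) : K^o := la * eig0 (lval X).

Let chi_is_linear : linear chi.
Proof.
move=> c X Y; rewrite /chi /eig0 lvalDZ mulmxDl -scalemxAl !mxE mulrDr.
by rewrite [RHS]/GRing.add /= /GRing.scale /= mulrCA.
Qed.
HB.instance Definition _ := GRing.isLinear.Build K (lie_of p_lie) K^o *:%R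
  chi chi_is_linear.
Let chi_lie X Y : chi (lieb X Y) = chi X * chi Y - chi Y * chi X.
Proof.
rewrite [chi X * _]mulrC subrr /chi /eig0 lval_lieb mulmxBl -!mulmxA !eig0P.
rewrite -!scalemxAr !eig0P !scalerA [eig0 (lval X) * _]mulrC subrr mxE.
exact: mulr0.
Qed.

Definition Cla_char : {rmorphism Up -> K^o} := Ulift (LieMorph chi_lie).

End Character.

Definition Cla (la : K) : lmodType Up := resmod (Cla_char la) (K^o)^o.
Definition Cla' (la : K) : lmodType Up' := resmod Up'_p (Cla la).

Definition verma_g (la : K) : lmodType Ug := tensor Up_g (Cla la).
Definition verma_g' (la : K) : lmodType Ug' := tensor Up'_g' (Cla' la).

Definition verma_res (la : K) : lmodType Ug' := resmod Ug'_g (verma_g la).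

End SO.

(* Over R[i], [g_lie] and [g'_lie] are the complexifications of the real Lie
   algebras so(p, q) and so(p, q - 1), i.e. of [g_lie] and [g'_lie] over R. *)

Section Complexification.
Context (R : rcfType).
Local Notation C := R[i].
Local Notation rc := (@real_complex R).
Local Notation reM := (map_mx (@complex.Re R)).
Local Notation imM := (map_mx (@complex.Im R)).

Let mx_eq0 m n (A : 'M[C]_(m, n)) : (A == 0) = (reM A == 0) && (imM A == 0).
Proof.
apply/eqP/andP => [->|[/eqP/matrixP hr /eqP/matrixP hi]].
  by split; apply/eqP/matrixP => i j; rewrite !mxE.
apply/matrixP => i j; have := hr i j; have := hi i j; rewrite !mxE.
by case: (A i j) => a b /= -> ->.
Qed.

Let reMr m n l (A : 'M[C]_(m, n)) (B : 'M[R]_(n, l)) :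
  reM (A *m map_mx rc B) = reM A *m B.
Proof.
apply/matrixP => i j; rewrite !mxE raddf_sum; apply: eq_bigr => k _.
by rewrite !mxE; case: (A i k) => a b /=; rewrite mulr0 subr0.
Qed.
Let imMr m n l (A : 'M[C]_(m, n)) (B : 'M[R]_(n, l)) :
  imM (A *m map_mx rc B) = imM A *m B.
Proof.
apply/matrixP => i j; rewrite !mxE raddf_sum; apply: eq_bigr => k _.
by rewrite !mxE; case: (A i k) => a b /=; rewrite mulr0 add0r.
Qed.
Let reMl m n l (A : 'M[C]_(n, l)) (B : 'M[R]_(m, n)) :
  reM (map_mx rc B *m A) = B *m reM A.
Proof. by apply: trmx_inj; rewrite map_trmx !trmx_mul !map_trmx reMr. Qed.
Let imMl m n l (A : 'M[C]_(n, l)) (B : 'M[R]_(m, n)) :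
  imM (map_mx rc B *m A) = B *m imM A.
Proof. by apply: trmx_inj; rewrite map_trmx !trmx_mul !map_trmx imMr. Qed.

Context (p n : nat).

Let gramC : gram C p n = map_mx rc (gram R p n).
Proof.
apply/matrixP => i j; rewrite !mxE; case: ifP => _; first by rewrite rmorph_nat.
rewrite rmorphMn /eps; congr (_ *+ _).
by case: ifP => _; rewrite ?rmorphN1 ?rmorph1.
Qed.

Lemma g_lie_complexification (X : 'M[C]_n.+2) :
  (X \in lsv (g_lie C p n)) =
    (reM X \in lsv (g_lie R p n)) && (imM X \in lsv (g_lie R p n)).
Proof.
by rewrite !mem_g mx_eq0 gramC !map_mxD /= !reMr !imMr !reMl !imMl !map_trmx.
Qed.

Lemma g'_lie_complexification (X : 'M[C]_n.+2) :
  (X \in lsv (g'_lie C p n)) =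
    (reM X \in lsv (g'_lie R p n)) && (imM X \in lsv (g'_lie R p n)).
Proof.
have eC : basis_vec C n n = map_mx rc (basis_vec R n n).
  by rewrite /basis_vec map_delta_mx.
rewrite !mem_g' g_lie_complexification mx_eq0 eC reMr imMr.
by rewrite andbACA.
Qed.

End Complexification.

Definition lambda (K : fieldType) (n j : nat) : K := (- n%:R + 1 + j%:R) / 2%:R.

(* Main.v *)
Require Import Defs.
From HB Require Import structures.
From mathcomp Require Import all_boot all_order all_algebra.
From mathcomp Require Import finmap boolp classical_sets functions cardinality.
From mathcomp Require monalg.
From mathcomp Require Import mpoly ring zify.
From mathcomp Require Import reals complex.

Set Implicit Arguments.
Unset Strict Implicit.
Unset Printing Implicit Defensive.

Import GRing.Theory.
Local Open Scope ring_scope.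
Local Open Scope quotient_scope.

(** By the Poincare-Birkhoff-Witt theorem a scalar generalized Verma module is
    a polynomial ring in its commuting lowering operators: K[y_1, ..., y_n] for
    so(n + 2) and K[y_1, ..., y_(n-1)] for so(n + 1). A matrix X then acts by
    the explicit operator [rho la X], which involves multiplications by the
    variables, first-order operators and the second-order raising operators
        K_j = (la - Euler) d_j + (eps_j / 2) y_j Laplacian.
    The commutators [rho X, y_i] = rho [X, Y_i] only involve operators of order
    one ([rho_x]), and the Lie relation follows from them by induction on
    monomials and the Jacobi identity ([rho_lie]). The map from the Verma module
    to this polynomial module given by Frobenius reciprocity is inverse to the
    evaluation of polynomials at the lowering operators.

    Let t = y_n, let r be the quadratic form in the other variables y', and let
    u be a homogeneous polynomial of degree d in t and r, with t and r of
    degrees 1 and 2. For X in so(n + 1) and f in K[y'], the product rule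
    [rhoM] reads
        X (f u) = (rho (la - d) X f) u + f (sum_j X_0j K_j u),
    so that K[y'] u is a copy of the module of weight la - d as soon as all
    K_j u vanish. For u_b = t^b + c_1 r t^(b-2) + c_2 r^2 t^(b-4) + ... this
    condition is a two-term recurrence for the c_l in which c_l is multiplied
    by l (j - 2b + 2l), where la = lambda_j.
    - If j is odd this never vanishes. The u_b exist for all b, are monic of
      degree b in t, hence form a basis of K[y'][t] over K[y'], and the
      restriction is the direct sum of the K[y'] u_b.
    - If j = 2k it vanishes exactly for b = 2k - a and l = k - a with a < k.
      In these degrees there is still a monic w_b with
          K_j w_b = kappa eps_j y_j r^(k-a-1) u_a,   kappa <> 0,
      so that u_a and w_(2k-a) together generate the module M_a, an extension
      of the module of weight la - (2k - a) by that of weight la - a.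
    A splitting would be given by some h in K[y'], homogeneous of degree
    2 (k - a), such that w_(2k-a) + h u_a is singular. This is a system of
    differential equations for h. Taking its divergence eliminates the
    Laplacian of h precisely at the weight at hand and leaves
    kappa (n - 1 + 2 (k - a - 1)) r^(k-a-1) = 0, which is absurd
    ([splitting_obstruction]). *)

(** * Modules over enveloping algebras *)

Section EnvelopingModules.
Import monalg.
Context (K : fieldType) (L : lieAlgType K).

Lemma U_gen_ind (Q : U L -> Prop) :
    (forall c : K, Q c%:A) -> (forall x, Q (ugen x)) ->
    (forall u v, Q u -> Q v -> Q (u + v)) ->
    (forall u v, Q u -> Q v -> Q (u * v)) ->
  forall u, Q u.
Proof.
move=> QC Qg QD QM u; rewrite -[u]reprK.
move: (repr u) => x.
pose mon k : freealg K L := mkmalgU k 1.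
have -> : x = \sum_(k <- msupp x) mcoeff k x *: mon k.
  rewrite {1}[x]monalgE; apply: eq_bigr => k _.
  apply/malgP => k'; rewrite mcoeffZ !mcoeffU.
  by case: eqP; rewrite ?mulr1 ?mulr0.
have QZ c v : Q v -> Q (c *: v).
  by move=> Qv; rewrite -mulr_algl; apply: QM.
rewrite raddf_sum /=; elim/big_ind: _ => //.
  by rewrite -(scale0r (1 : U L)).
move=> k _; rewrite pi_UZ; apply: QZ.
case: k => s.
elim: s => [|y s IHs].
  have -> : mon (FMonom [::]) = 1.
    rewrite freealg1 /mon. by congr mkmalgU; apply: val_inj; rewrite /= fm1.
  by rewrite -[\pi_(U L) 1](scale1r (1 : U L)).
have -> : mon (FMonom (y :: s)) = fgen K y * mon (FMonom s).
  rewrite freealgM malgM_def fgmulUU mulr1; congr (mkmalgU _ _).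
  by apply: val_inj => /=; rewrite fmM fmU.
by rewrite pi_UM; apply: (QM (ugen y)).
Qed.

(** An additive map that commutes with the scalars and with the generators of
    the enveloping algebra is a module homomorphism. *)
Lemma U_linear (V1 V2 : lmodType (U L)) (f : V1 -> V2) :
    zmod_morphism f -> (forall (c : K) v, f (c%:A *: v) = c%:A *: f v) ->
    (forall x v, f (ugen x *: v) = ugen x *: f v) ->
  linear f.
Proof.
move=> fB fZ fg u v w.
have f0 : f 0 = 0 by rewrite -(subrr 0) fB subrr.
have fN x : f (- x) = - f x by rewrite -sub0r fB f0 sub0r.
have fD x y : f (x + y) = f x + f y by rewrite -{1}[y]opprK fB fN opprK.
rewrite fD; congr (_ + _); elim/U_gen_ind: u v => // u1 u2 h1 h2 v.
  by rewrite !scalerDl fD h1 h2.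
by rewrite -!scalerA h1 h2.
Qed.

End EnvelopingModules.

(** The algebra of K-linear endomorphisms of a nonzero K-module; the nonzero
    vector makes it a nonzero ring. *)
Definition lend (K : fieldType) (V : lmodType K) (v0 : {v : V | v != 0}) : Type :=
  {f : V -> V | `[< linear f >]}.

Section LinearEndomorphisms.
Context (K : fieldType) (V : lmodType K) (v0 : {v : V | v != 0}).
Local Notation E := (lend v0).
Implicit Types f g h : E.

HB.instance Definition _ := gen_eqMixin E.
HB.instance Definition _ := gen_choiceMixin E.

Lemma lendP f g : sval f =1 sval g -> f = g.
Proof. by move=> fg; apply: val_inj; apply: funext. Qed.

Lemma lend_lin f : linear (sval f).
Proof. exact/asboolP/(svalP f). Qed.

HB.instance Definition _ f :=
  GRing.isLinear.Build K V V *:%R (sval f) (lend_lin f).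

Definition mklend (f : V -> V) (hf : linear f) : E := exist _ f (asboolT hf).

Let add_lin f g : linear (fun v => sval f v + sval g v).
Proof. by move=> c u v; rewrite !linearP scalerDr addrACA. Qed.
Let opp_lin f : linear (fun v => - sval f v).
Proof. by move=> c u v; rewrite linearP opprD scalerN. Qed.
Let zero_lin : linear (fun _ : V => 0 : V).
Proof. by move=> c u v; rewrite scaler0 addr0. Qed.
Let one_lin : linear (fun v : V => v).
Proof. by []. Qed.
Let comp_lin f g : linear (fun v => sval f (sval g v)).
Proof. by move=> c u v; rewrite !linearP. Qed.
Let scale_lin (a : K) f : linear (fun v => a *: sval f v).
Proof. by move=> c u v; rewrite linearP scalerDr !scalerA mulrC. Qed.

Let add f g := mklend (add_lin f g).
Let opp f := mklend (opp_lin f).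
Let zero := mklend zero_lin.
Let one := mklend one_lin.
Let mul f g := mklend (comp_lin f g).
Let scale a f := mklend (scale_lin a f).

Let addA : associative add.
Proof. by move=> f g h; apply: lendP => v /=; rewrite addrA. Qed.
Let addC : commutative add.
Proof. by move=> f g; apply: lendP => v /=; rewrite addrC. Qed.
Let add0 : left_id zero add.
Proof. by move=> f; apply: lendP => v /=; rewrite add0r. Qed.
Let addN : left_inverse zero opp add.
Proof. by move=> f; apply: lendP => v /=; rewrite addNr. Qed.
HB.instance Definition _ := GRing.isZmodule.Build E addA addC add0 addN.

Let mulA : associative mul.
Proof. by move=> f g h; apply: lendP. Qed.
Let mul1 : left_id one mul.
Proof. by move=> f; apply: lendP. Qed.
Let mulr1 : right_id one mul.
Proof. by move=> f; apply: lendP. Qed.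
Let mulDl : left_distributive mul +%R.
Proof. by move=> f g h; apply: lendP. Qed.
Let mulDr : right_distributive mul +%R.
Proof. by move=> f g h; apply: lendP => v /=; rewrite linearD. Qed.
Let one_neq0 : one != 0.
Proof.
apply/eqP => /(congr1 (fun f : E => sval f (sval v0))) /= h.
by move: (svalP v0); rewrite h eqxx.
Qed.
HB.instance Definition _ :=
  GRing.Zmodule_isNzRing.Build E mulA mul1 mulr1 mulDl mulDr one_neq0.

Let scaleA a b f : scale a (scale b f) = scale (a * b) f.
Proof. by apply: lendP => v /=; rewrite scalerA. Qed.
Let scale1 : left_id 1 scale.
Proof. by move=> f; apply: lendP => v /=; rewrite scale1r. Qed.
Let scaleDr : right_distributive scale +%R.
Proof. by move=> a f g; apply: lendP => v /=; rewrite scalerDr. Qed.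
Let scaleDl f : {morph scale^~ f : a b / a + b}.
Proof. by move=> a b; apply: lendP => v /=; rewrite scalerDl. Qed.
HB.instance Definition _ :=
  GRing.Zmodule_isLmodule.Build K E scaleA scale1 scaleDr scaleDl.
Let scaleAl (a : K) f g : a *: (f * g) = (a *: f) * g.
Proof. by apply: lendP. Qed.
HB.instance Definition _ := GRing.Lmodule_isLalgebra.Build K E scaleAl.
Let scaleAr (a : K) f g : a *: (f * g) = f * (a *: g).
Proof. by apply: lendP => v /=; rewrite linearZ. Qed.
HB.instance Definition _ := GRing.Lalgebra_isAlgebra.Build K E scaleAr.

End LinearEndomorphisms.

(** The module attached to a representation. The proofs are parameters so that
    the action of the enveloping algebra is determined by the type. *)
Definition rep_of (K : fieldType) (L : lieAlgType K) (V : lmodType K)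
    (v0 : {v : V | v != 0}) (rho : L -> lend v0) (rho_linear : linear rho)
    (rho_lie : forall x y, rho (lieb x y) = rho x * rho y - rho y * rho x) : Type :=
  V.

Section Representation.
Context (K : fieldType) (L : lieAlgType K) (V : lmodType K).
Context (v0 : {v : V | v != 0}) (rho : L -> lend v0).
Hypothesis rho_linear : linear rho.
Hypothesis rho_lie : forall x y,
  rho (lieb x y) = rho x * rho y - rho y * rho x.

HB.instance Definition _ :=
  GRing.isLinear.Build K L (lend v0) *:%R rho rho_linear.

Definition rep_morph : {rmorphism U L -> lend v0} := Ulift (LieMorph rho_lie).

Local Notation rep_of := (rep_of rho_linear rho_lie).
HB.instance Definition _ := GRing.Zmodule.on rep_of.

Let scale (u : U L) (v : rep_of) : rep_of := sval (rep_morph u) v.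
Let scaleA a b v : scale a (scale b v) = scale (a * b) v.
Proof. by rewrite /scale rmorphM. Qed.
Let scale1 : left_id 1 scale.
Proof. by move=> v; rewrite /scale rmorph1. Qed.
Let scaleDr : right_distributive scale +%R.
Proof. by move=> a u v; rewrite /scale linearD. Qed.
Let scaleDl v : {morph scale^~ v : a b / a + b}.
Proof. by move=> a b; rewrite /scale rmorphD. Qed.
HB.instance Definition _ :=
  GRing.Zmodule_isLmodule.Build (U L) rep_of scaleA scale1 scaleDr scaleDl.

Lemma rep_genE x (v : rep_of) : ugen x *: v = sval (rho x) v.
Proof. by rewrite [LHS]/(scale _ _) /scale /= Ulift_gen. Qed.

Lemma rep_algE (c : K) (v : rep_of) : (c%:A : U L) *: v = (c *: (v : V) : V).
Proof.
by rewrite [LHS]/(scale _ _) /scale /= UliftZ (rmorph1 rep_morph).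
Qed.

End Representation.

(** Frobenius reciprocity: a map from V to the restriction of Q extends to the
    module induced from V. *)
Section TensorLift.
Import monalg.
Context (B A : nzRingType) (f : {rmorphism B -> A}) (V : lmodType B).
Context (Q : lmodType A) (h : V -> Q).
Hypothesis hB : zmod_morphism h.
Hypothesis hZ : forall b v, h (b *: v) = f b *: h v.

Let eval : {malg int[(A * V)%type]} -> Q :=
  zext (fun k : A * V => k.1 *: h k.2).

Let hD v w : h (v + w) = h v + h w.
Proof.
have h0 : h 0 = 0 by rewrite -(subrr 0) hB subrr.
by rewrite -{1}[w]opprK hB -(sub0r w) hB h0 sub0r opprK.
Qed.

Let eval_sub x : tensor_sub f x -> eval x = 0.
Proof.
elim=> {x} [_ []||y z _ hy _ hz].
- by move=> a a' v; rewrite /eval raddfB raddfD /= !zextU /= scalerDl subrr.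
- by move=> a v v'; rewrite /eval raddfB raddfD /= !zextU /= hD scalerDr subrr.
- by move=> a b v; rewrite /eval raddfB /= !zextU /= hZ scalerA subrr.
- exact: raddf0.
- by rewrite /eval raddfB /= -!/(eval _) hy hz subr0.
Qed.

Definition tensor_lift (x : tensor f V) : Q := eval (repr x).

Let lift_pi x : tensor_lift (\pi_(tensor f V) x) = eval x.
Proof.
apply/eqP; rewrite -subr_eq0 /tensor_lift /eval -raddfB; apply/eqP.
by apply/eval_sub/pi_tensorP; rewrite reprK.
Qed.

Lemma tensor_lift_tens a v : tensor_lift (tens f a v) = a *: h v.
Proof. by rewrite lift_pi /eval zextU. Qed.

Lemma tensor_lift_is_linear : linear tensor_lift.
Proof.
have liftB x y : tensor_lift (x - y) = tensor_lift x - tensor_lift y.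
  by rewrite -[x]reprK -[y]reprK -raddfB !lift_pi; apply: raddfB.
have lift0 : tensor_lift 0 = 0 by rewrite -(subrr 0) liftB subrr.
have liftD x y : tensor_lift (x + y) = tensor_lift x + tensor_lift y.
  by rewrite -{1}[y]opprK liftB -(sub0r y) liftB lift0 sub0r opprK.
move=> c x y; rewrite liftD; congr (_ + _).
elim/tensor_indP: x => [a v||x1 x2 h1 h2].
- by rewrite tensZ !tensor_lift_tens scalerA.
- by rewrite scaler0 lift0 scaler0.
- by rewrite scalerBr !liftB scalerBr h1 h2.
Qed.

End TensorLift.

(** * Polynomial algebras *)

(** Polynomials in n variables seen through their partial derivatives. The
    computations with differential operators use only these rules, not the way
    in which polynomials are represented. *)
Record polyAlg (K : fieldType) (n : nat) := PolyAlg {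
  pa_ring :> comNzRingType;
  pconst : {rmorphism K -> pa_ring};
  pvar : 'I_n -> pa_ring;
  pder : 'I_n -> pa_ring -> pa_ring;
  pderD : forall i f g, pder i (f + g) = pder i f + pder i g;
  pderM : forall i f g, pder i (f * g) = pder i f * g + f * pder i g;
  pder_const : forall i c, pder i (pconst c) = 0;
  pder_var : forall i j, pder i (pvar j) = (i == j)%:R;
  pvar_ind : forall Q : pa_ring -> Prop,
    Q 1 -> (forall f g, Q f -> Q g -> Q (f + g)) ->
    (forall c f, Q f -> Q (pconst c * f)) ->
    (forall i f, Q f -> Q (pvar i * f)) ->
    forall f, Q f }.

(** * Polynomials in n variables, the last one singled out *)

Section Polynomials.
Context (K : fieldType) (m : nat).
Local Notation W := {mpoly K[m]}.
Local Notation V := {poly {mpoly K[m]}}.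

Definition iter_const (c : K) : V := c%:MP%:P.
Lemma iter_const_is_zmod_morphism : zmod_morphism iter_const.
Proof. by move=> a b; rewrite /iter_const mpolyCB polyCB. Qed.
Lemma iter_const_is_monoid_morphism : monoid_morphism iter_const.
Proof. by split=> [|a b]; rewrite /iter_const ?mpolyC1 // mpolyCM polyCM. Qed.
HB.instance Definition _ :=
  GRing.isZmodMorphism.Build K V iter_const iter_const_is_zmod_morphism.
HB.instance Definition _ :=
  GRing.isMonoidMorphism.Build K V iter_const iter_const_is_monoid_morphism.

(** The last variable, which the subalgebra so(n + 1) does not see, is kept
    apart: modules over K[y_1, ..., y_(n-1)] are then read off from the
    coefficients. *)
Definition iter_var (i : 'I_m.+1) : V :=
  if unlift ord_max i is Some j then ('X_j)%:P else 'X.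

Definition iter_der (i : 'I_m.+1) (f : V) : V :=
  if unlift ord_max i is Some j then map_poly (mderiv j) f else f^`().

Lemma iter_der_is_zmod_morphism i : zmod_morphism (iter_der i).
Proof. by rewrite /iter_der; case: unliftP => [j|] _ f g; apply: raddfB. Qed.
HB.instance Definition _ i :=
  GRing.isZmodMorphism.Build V V (iter_der i) (iter_der_is_zmod_morphism i).

Lemma iter_derD i f g : iter_der i (f + g) = iter_der i f + iter_der i g.
Proof. exact: raddfD. Qed.

Lemma iter_derM i f g : iter_der i (f * g) = iter_der i f * g + f * iter_der i g.
Proof.
rewrite /iter_der; case: unliftP => [j|] _; last exact: derivM.
apply/polyP => k; rewrite coefD !coefM coef_map /= coefM raddf_sum -big_split /=.
by apply: eq_bigr => l _; rewrite mderivM !coef_map.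
Qed.

Lemma iter_der_const i c : iter_der i (iter_const c) = 0.
Proof.
rewrite /iter_der; case: unliftP => [j|] _; last exact: derivC.
by rewrite map_polyC /= mderivC polyC0.
Qed.

Lemma iter_der_var i j : iter_der i (iter_var j) = (i == j)%:R.
Proof.
rewrite /iter_der /iter_var; case: (unliftP ord_max i) => [i'|] ->;
  case: (unliftP ord_max j) => [j'|] ->.
- rewrite map_polyC /= mderivX mnmE (inj_eq lift_inj) eq_sym.
  case: eqP => [->|_]; last by rewrite scale0r polyC0.
  rewrite scale1r (_ : (U_(j') - U_(j'))%MM = 0%MM) ?mpolyX0 //.
  by apply/mnmP => l; rewrite mnmBE subnn mnm0E.
- rewrite eq_sym (negbTE (neq_lift _ _)); apply/polyP => k.
  by rewrite coef_map coefX coef0; case: eqP; rewrite ?raddf0 //= mderivC.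
- by rewrite derivC (negbTE (neq_lift _ _)).
- by rewrite derivX eqxx.
Qed.

Lemma iter_der_max_polyC (f : W) : iter_der ord_max f%:P = 0.
Proof. by rewrite /iter_der unlift_none derivC. Qed.

Lemma iter_var_max : iter_var ord_max = 'X.
Proof. by rewrite /iter_var unlift_none. Qed.

Lemma iter_var_lift j : iter_var (lift ord_max j) = ('X_j)%:P.
Proof. by rewrite /iter_var liftK. Qed.

Lemma mpoly_var_ind (Q : W -> Prop) :
    Q 1 -> (forall f g, Q f -> Q g -> Q (f + g)) ->
    (forall c f, Q f -> Q (c%:MP * f)) ->
    (forall i f, Q f -> Q ('X_i * f)) ->
  forall f, Q f.
Proof.
move=> Q1 QD QZ QX.
have Q0 : Q 0 by rewrite -(mul0r 1) -mpolyC0; apply: QZ.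
elim/mpolyind => // c d f _ _ Qf; apply: QD => //; rewrite -mul_mpolyC; apply: QZ.
rewrite mpolyXE_id; elim/big_rec: _ => // i g _ Qg.
by elim: (d i) => [|k IHk]; rewrite ?mul1r // exprS -mulrA; apply: QX.
Qed.

Lemma poly_var_ind (Q : V -> Prop) :
    Q 1 -> (forall f g, Q f -> Q g -> Q (f + g)) ->
    (forall c f, Q f -> Q (iter_const c * f)) ->
    (forall i f, Q f -> Q (iter_var i * f)) ->
  forall f, Q f.
Proof.
move=> Q1 QD QZ QX.
have QC (f : W) : Q f%:P.
  elim/mpoly_var_ind: f => // [f g Qf Qg|c f Qf|i f Qf].
  - by rewrite polyCD; apply: QD.
  - by rewrite polyCM; apply: QZ.
  - by rewrite polyCM -iter_var_lift; apply: QX.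
elim/poly_ind => [|f c Qf]; first by rewrite -polyC0; apply: QC.
by apply: QD => //; rewrite mulrC -iter_var_max; apply: QX.
Qed.

Definition iterated_polyAlg : polyAlg K m.+1 :=
  @PolyAlg K m.+1 V iter_const iter_var iter_der iter_derD iter_derM
    iter_der_const iter_der_var poly_var_ind.

End Polynomials.
#[global] Arguments iter_const {K m} c : simpl never.

(** * The orthogonal Lie algebra in coordinates *)

Section Matrices.
Context (K : fieldType) (p n : nat).
Local Notation N := n.+2.
Hypothesis two_neq0 : 2%:R != 0 :> K.

(** The rows and columns of the middle coordinates 1, ..., n. *)
Definition ix (i : 'I_n) : 'I_N := lift ord0 (widen_ord (leqnSn n) i).

Lemma ix_inj : injective ix.
Proof. by move=> i j /(congr1 val) [] /val_inj. Qed.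

Lemma sum_ix (Z : nmodType) (F : 'I_N -> Z) :
  \sum_k F k = F ord0 + \sum_(i < n) F (ix i) + F ord_max.
Proof.
rewrite big_ord_recl big_ord_recr /= addrA; congr (_ + F _); exact: val_inj.
Qed.

Definition ep (i : 'I_n) : K := eps K p i.+1.

Lemma ep_sqr i : ep i * ep i = 1.
Proof. by rewrite /ep /eps; case: ifP => _; rewrite ?mulr1 // mulrNN mulr1. Qed.

Lemma ep_neq0 i : ep i != 0.
Proof.
by apply/eqP => h; have := ep_sqr i; rewrite h mul0r => /esym/eqP; rewrite oner_eq0.
Qed.

Lemma gram_ix i k : gram K p n (ix i) k = ep i *+ (k == ix i).
Proof.
by rewrite mxE /= eqSS (ltn_eqF (ltn_ord i)) /= eq_sym.
Qed.
Lemma gram_0 k : gram K p n ord0 k = (k == ord_max)%:R.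
Proof. by rewrite mxE. Qed.
Lemma gram_max k : gram K p n ord_max k = (k == ord0)%:R.
Proof. by rewrite mxE /= eqxx /= -[X in _ == X]addn0 eqn_add2l. Qed.

Let gram_sym i j : gram K p n i j = gram K p n j i.
Proof.
rewrite !mxE addnC [j == i]eq_sym.
case: (eqVneq i j) => [->//|ij]; rewrite !mulr0n.
case: ifP => hi; case: ifP => hj //; case: eqP => // h; exfalso.
  move: hj; case/orP: hi => /eqP hi; move: h; rewrite hi ?addn0 => h.
    by rewrite h eqxx orbT.
  suff -> : j = 0%N :> nat by [].
  by apply: (can_inj (addnK n.+1)); rewrite h.
move: hi; case/orP: hj => /eqP hj; move: h; rewrite hj ?add0n => h.
  by rewrite h eqxx orbT.
suff -> : i = 0%N :> nat by [].
by apply: (can_inj (addKn n.+1)); rewrite h addn0.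
Qed.

Lemma mem_g_entryP (X : 'M[K]_N) :
  (X \in lsv (g_lie K p n)) <->
  (forall i j,
    \sum_k gram K p n j k * X k i + \sum_k gram K p n i k * X k j = 0).
Proof.
have E i j : (X^T *m gram K p n + gram K p n *m X) i j =
    \sum_k gram K p n j k * X k i + \sum_k gram K p n i k * X k j.
  rewrite [LHS]mxE [X in X + _]mxE [X in _ + X]mxE.
  by congr (_ + _); apply: eq_bigr => k _; rewrite mxE mulrC gram_sym.
rewrite mem_g; split=> [/eqP/matrixP h i j|h].
  by rewrite -E h mxE.
by apply/eqP/matrixP => i j; rewrite E h mxE.
Qed.

Let sum_gram0 (X : 'M[K]_N) j : \sum_k gram K p n ord0 k * X k j = X ord_max j.
Proof.
rewrite (bigD1 ord_max) //= big1 => [|k /negbTE hk]; rewrite gram_0.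
  by rewrite eqxx mul1r addr0.
by rewrite hk mul0r.
Qed.
Let sum_grammax (X : 'M[K]_N) j : \sum_k gram K p n ord_max k * X k j = X ord0 j.
Proof.
rewrite (bigD1 ord0) //= big1 => [|k /negbTE hk]; rewrite gram_max.
  by rewrite eqxx mul1r addr0.
by rewrite hk mul0r.
Qed.
Let sum_gramix i (X : 'M[K]_N) j :
  \sum_k gram K p n (ix i) k * X k j = ep i * X (ix i) j.
Proof.
rewrite (bigD1 (ix i)) //= big1 => [|k /negbTE hk]; rewrite gram_ix.
  by rewrite eqxx addr0.
by rewrite hk mulr0n mul0r.
Qed.

Lemma g_max0 X : X \in lsv (g_lie K p n) -> X ord_max ord0 = 0.
Proof.
move=> /mem_g_entryP/(_ ord0 ord0); rewrite !sum_gram0 => /eqP.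
by rewrite -mulr2n -mulr_natl mulf_eq0 (negbTE two_neq0) => /eqP.
Qed.
Lemma g_0max X : X \in lsv (g_lie K p n) -> X ord0 ord_max = 0.
Proof.
move=> /mem_g_entryP/(_ ord_max ord_max); rewrite !sum_grammax => /eqP.
by rewrite -mulr2n -mulr_natl mulf_eq0 (negbTE two_neq0) => /eqP.
Qed.
Lemma g_maxix X i : X \in lsv (g_lie K p n) ->
  X ord_max (ix i) = - (ep i * X (ix i) ord0).
Proof.
move=> /mem_g_entryP/(_ ord0 (ix i)); rewrite !sum_gram0 sum_gramix.
by move/eqP; rewrite addrC addr_eq0 => /eqP.
Qed.
Lemma g_ixmax X i : X \in lsv (g_lie K p n) ->
  X (ix i) ord_max = - (ep i * X ord0 (ix i)).
Proof.
move=> /mem_g_entryP/(_ ord_max (ix i)); rewrite !sum_grammax sum_gramix.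
move/eqP; rewrite addrC addr_eq0 => /eqP ->.
by rewrite mulrN opprK mulrA ep_sqr mul1r.
Qed.
Lemma g_rot X i j : X \in lsv (g_lie K p n) ->
  ep j * X (ix j) (ix i) = - (ep i * X (ix i) (ix j)).
Proof.
move=> /mem_g_entryP/(_ (ix i) (ix j)); rewrite !sum_gramix.
by move/eqP; rewrite addr_eq0 => /eqP.
Qed.

(** The lowering operator that sends e_0 to e_i. *)
Definition Ymx (i : 'I_n) : 'M[K]_N :=
  delta_mx (ix i) ord0 - ep i *: delta_mx ord_max (ix i).

Lemma ixE i : (ix i == ord0 = false) * (ix i == ord_max = false)
  * (ord0 == ix i = false) * (ord_max == ix i = false).
Proof.
have h : ix i == ord_max = false by rewrite -val_eqE /= eqSS ltn_eqF.
by rewrite h [ord_max == _]eq_sym h.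
Qed.

Variant ix_spec : 'I_N -> Type :=
  | IxFirst : ix_spec ord0 | IxMid i : ix_spec (ix i) | IxLast : ix_spec ord_max.

Lemma ixP k : ix_spec k.
Proof.
case: (unliftP ord0 k) => [j|] ->; last exact: IxFirst.
case: (unliftP ord_max j) => [i|] ->.
  have -> : lift ord_max i = widen_ord (leqnSn n) i.
    by apply: val_inj; rewrite /= /bump leqNgt ltn_ord.
  exact: IxMid.
have -> : lift ord0 (ord_max : 'I_n.+1) = ord_max by apply: val_inj.
exact: IxLast.
Qed.

Lemma YmxE i k j : Ymx i k j =
  ((k == ix i) && (j == ord0))%:R - ep i * ((k == ord_max) && (j == ix i))%:R.
Proof. by rewrite !mxE. Qed.

Lemma Ymx_g i : Ymx i \in lsv (g_lie K p n).
Proof.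
apply/mem_g_entryP => a b.
case: (ixP a) => [|a'|]; case: (ixP b) => [|b'|];
  rewrite ?sum_gram0 ?sum_gramix ?sum_grammax !YmxE ?eqxx ?ixE ?andbF ?andbT /=
  ?(inj_eq ix_inj) ?mulr0 ?subr0 ?mulr1 ?subrr ?addr0 ?sub0r //.

- by case: eqVneq => [->|_]; rewrite ?mulr0 ?subr0 ?subrr.
- by case: eqVneq => [->|_]; rewrite ?mulr0 ?subr0 ?addNr ?oppr0 ?addr0.
all: by rewrite !mulr0 ?addr0.
Qed.

(** The element that grades the polynomial module by degree. *)
Definition Emx : 'M[K]_N := delta_mx ord0 ord0 - delta_mx ord_max ord_max.

Lemma EmxE k j : Emx k j =
  ((k == ord0) && (j == ord0))%:R - ((k == ord_max) && (j == ord_max))%:R.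
Proof. by rewrite !mxE. Qed.

Lemma Emx_g : Emx \in lsv (g_lie K p n).
Proof.
apply/mem_g_entryP => a b.
by case: (ixP a) => [|a'|]; case: (ixP b) => [|b'|];
  rewrite ?sum_gram0 ?sum_gramix ?sum_grammax !EmxE ?eqxx ?ixE ?andbF ?andbT /=
  ?mulr0 ?subr0 ?subrr ?mulr0 ?addr0 ?sub0r ?addNr ?subrr.
Qed.

(** The raising operator that sends e_i to e_0. *)
Definition Kmx i : 'M[K]_N := delta_mx ord0 (ix i) - ep i *: delta_mx (ix i) ord_max.

Lemma KmxE i k j : Kmx i k j =
  ((k == ord0) && (j == ix i))%:R - ep i * ((k == ix i) && (j == ord_max))%:R.
Proof. by rewrite !mxE. Qed.

Lemma Kmx_g i : Kmx i \in lsv (g_lie K p n).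
Proof.
apply/mem_g_entryP => a b.
case: (ixP a) => [|a'|]; case: (ixP b) => [|b'|];
  rewrite ?sum_gram0 ?sum_gramix ?sum_grammax !KmxE ?eqxx ?ixE ?andbF ?andbT /=
  ?(inj_eq ix_inj) ?mulr0 ?subr0 ?mulr1 ?subrr ?mulr0 ?addr0 ?sub0r //.
- by case: eqVneq => [->|_]; rewrite ?mulr0 ?mulr1 ?oppr0 ?mulr0 ?addr0 // mulrN ep_sqr subrr.
- by case: eqVneq => [->|_]; rewrite ?mulr0 ?mulr1 ?oppr0 ?mulr0 ?addr0 // mulrN ep_sqr addNr.
Qed.

(** An element of so(n + 2) is determined by its first row and column and its
    middle block; these are the entries of [X, Y_i] that the commutator of X
    with a variable involves. *)
Section Bracket.
Variables (X : 'M[K]_N) (i : 'I_n).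
Hypothesis gX : X \in lsv (g_lie K p n).
Local Notation Z := (X *m Ymx i - Ymx i *m X).

Let mulYr k j : (X *m Ymx i) k j =
  (j == ord0)%:R * X k (ix i) - ep i * (j == ix i)%:R * X k ord_max.
Proof.
rewrite mxE; under eq_bigr do rewrite YmxE mulrBr.
rewrite sumrB (bigD1 (ix i)) //= big1 => [|l /negbTE ->]; last by rewrite mulr0.
rewrite [X in _ - X](bigD1 ord_max) //= big1 => [|l /negbTE ->]; last first.
  by rewrite !mulr0.
by rewrite !eqxx !addr0 /=; ring.
Qed.

Let mulYl k j : (Ymx i *m X) k j =
  (k == ix i)%:R * X ord0 j - ep i * (k == ord_max)%:R * X (ix i) j.
Proof.
rewrite mxE; under eq_bigr do rewrite YmxE mulrBl.
rewrite sumrB (bigD1 ord0) //= big1 => [|l /negbTE ->]; last first.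
  by rewrite andbF mul0r.
rewrite [X in _ - X](bigD1 (ix i)) //= big1 => [|l /negbTE ->]; last first.
  by rewrite andbF mulr0 mul0r.
by rewrite !eqxx !addr0 !andbT.
Qed.

Let ZE k j : Z k j = (X *m Ymx i) k j - (Ymx i *m X) k j.
Proof. by rewrite [LHS]mxE [X in _ + X]mxE. Qed.

Lemma brY_00 : Z ord0 ord0 = X ord0 (ix i).
Proof. by rewrite ZE mulYr mulYl !eqxx !ixE /=; ring. Qed.
Lemma brY_ix0 l : Z (ix l) ord0 = X (ix l) (ix i) - (l == i)%:R * X ord0 ord0.
Proof. by rewrite ZE mulYr mulYl !eqxx !ixE (inj_eq ix_inj) /=; ring. Qed.
Lemma brY_ixix l j : Z (ix l) (ix j) =
  (j == i)%:R * (ep i * ep l * X ord0 (ix l)) - (l == i)%:R * X ord0 (ix j).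
Proof.
by rewrite ZE mulYr mulYl !ixE !(inj_eq ix_inj) (g_ixmax _ gX) /=; ring.
Qed.
Lemma brY_0ix j : Z ord0 (ix j) = 0.
Proof. by rewrite ZE mulYr mulYl !ixE (g_0max gX) /=; ring. Qed.
End Bracket.

Definition Yg (i : 'I_n) : lie_of (g_lie K p n) := lmk (Ymx_g i).

End Matrices.

(** * The action of the orthogonal Lie algebra on polynomials *)

Definition eul (K : fieldType) n (V : polyAlg K n) (f : V) : V :=
  \sum_i pvar V i * pder i f.

Definition lap (K : fieldType) p n (V : polyAlg K n) (f : V) : V :=
  \sum_i pconst V (ep K p i) * pder i (pder i f).

Definition kop (K : fieldType) p n (V : polyAlg K n) (la : K) j (f : V) : V :=
  pconst V la * pder j f - eul (pder j f)
  + pconst V (ep K p j / 2%:R) * pvar V j * lap p f.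

(** The action of so(n + 2) on the scalar generalized Verma module of highest
    weight la, transported to polynomials in the lowering operators. *)
HB.lock Definition rho (K : fieldType) p n (V : polyAlg K n) (la : K)
    (X : 'M[K]_n.+2) (f : V) : V :=
  pconst V (X ord0 ord0) * (pconst V la * f - eul f)
  + \sum_i pconst V (X (ix i) ord0) * (pvar V i * f)
  + \sum_i \sum_j pconst V (X (ix i) (ix j)) * (pvar V i * pder j f)
  + \sum_j pconst V (X ord0 (ix j)) * kop p la j f.

Section Operators.
Context (K : fieldType) (p n : nat) (V : polyAlg K n).
Local Notation N := n.+2.
Hypothesis two_neq0 : 2%:R != 0 :> K.
Local Notation kc := (pconst V).
Local Notation ep := (ep K p (n := n)).
Local Notation xv := (@pvar K n V).
Local Notation dv := (@pder K n V).
Local Notation g := (lsv (g_lie K p n)).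
Implicit Types (la c : K) (X : 'M[K]_N) (f : V) (i j l : 'I_n).

Local Notation eul := (@eul K n V).
Local Notation lap := (@lap K p n V).
Local Notation kop := (@kop K p n V).
Local Notation rho := (@rho K p n V).

Lemma dvZ i c f : dv i (kc c * f) = kc c * dv i f.
Proof. by rewrite pderM pder_const mul0r add0r. Qed.
Lemma dv0 i : dv i 0 = 0.
Proof. by rewrite -{1}(rmorph0 kc) pder_const. Qed.

Lemma eulP c f h : eul (kc c * f + h) = kc c * eul f + eul h.
Proof.
rewrite /eul mulr_sumr -big_split /=; apply: eq_bigr => i _.
by rewrite pderD dvZ; ring.
Qed.
Lemma lapP c f h : lap (kc c * f + h) = kc c * lap f + lap h.
Proof.
rewrite /lap mulr_sumr -big_split /=; apply: eq_bigr => i _.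
by rewrite pderD dvZ pderD dvZ; ring.
Qed.
Lemma kopP la j c f h : kop la j (kc c * f + h) = kc c * kop la j f + kop la j h.
Proof. by rewrite /kop pderD dvZ eulP lapP; ring. Qed.
Lemma rhoP la X c f h : rho la X (kc c * f + h) = kc c * rho la X f + rho la X h.
Proof.
rewrite rho.unlock eulP.
have -> : \sum_i kc (X (ix i) ord0) * (xv i * (kc c * f + h)) =
    kc c * (\sum_i kc (X (ix i) ord0) * (xv i * f))
    + \sum_i kc (X (ix i) ord0) * (xv i * h).
  by rewrite mulr_sumr -big_split /=; apply: eq_bigr => i _; ring.
have -> : \sum_i \sum_j kc (X (ix i) (ix j)) * (xv i * dv j (kc c * f + h)) =
    kc c * (\sum_i \sum_j kc (X (ix i) (ix j)) * (xv i * dv j f))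
    + \sum_i \sum_j kc (X (ix i) (ix j)) * (xv i * dv j h).
  rewrite mulr_sumr -big_split /=; apply: eq_bigr => i _.
  rewrite mulr_sumr -big_split /=; apply: eq_bigr => j _.
  by rewrite pderD dvZ; ring.
have -> : \sum_j kc (X ord0 (ix j)) * kop la j (kc c * f + h) =
    kc c * (\sum_j kc (X ord0 (ix j)) * kop la j f)
    + \sum_j kc (X ord0 (ix j)) * kop la j h.
  by rewrite mulr_sumr -big_split /=; apply: eq_bigr => j _; rewrite kopP; ring.
by ring.
Qed.

Lemma rho_mxP la c X Y f : rho la (c *: X + Y) f = kc c * rho la X f + rho la Y f.
Proof.
have ring4 (a a1 a2 a3 a4 b1 b2 b3 b4 : V) :
    a * (a1 + a2 + a3 + a4) + (b1 + b2 + b3 + b4) =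
    (a * a1 + b1) + (a * a2 + b2) + (a * a3 + b3) + (a * a4 + b4) by ring.
rewrite rho.unlock ring4; congr (_ + _ + _ + _).
- by rewrite !mxE; ring.
- by rewrite mulr_sumr -big_split /=; apply: eq_bigr => i _; rewrite !mxE; ring.
- rewrite mulr_sumr -big_split /=; apply: eq_bigr => i _.
  rewrite mulr_sumr -big_split /=; apply: eq_bigr => j _.
  by rewrite !mxE; ring.
- by rewrite mulr_sumr -big_split /=; apply: eq_bigr => j _; rewrite !mxE; ring.
Qed.

Lemma eul0 : eul 0 = 0.
Proof. by rewrite /eul big1 // => i _; rewrite dv0 mulr0. Qed.

Lemma dv1 i : dv i 1 = 0.
Proof. by rewrite -(rmorph1 kc) pder_const. Qed.

Lemma eul1 : eul 1 = 0.
Proof. by rewrite /eul big1 // => i _; rewrite dv1 mulr0. Qed.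
Lemma lap1 : lap 1 = 0.
Proof. by rewrite /lap big1 // => i _; rewrite dv1 dv0 mulr0. Qed.
Lemma kop1 la j : kop la j 1 = 0.
Proof. by rewrite /kop dv1 eul0 lap1; ring. Qed.

Lemma rho1 la X :
  rho la X 1 = kc (X ord0 ord0 * la) + \sum_i kc (X (ix i) ord0) * xv i.
Proof.
rewrite rho.unlock eul1 subr0 mulr1 -rmorphM /=.
under eq_bigr do rewrite mulr1.
rewrite [X in _ + _ + X + _]big1 ?addr0 => [|i _].
  by rewrite [X in _ + X]big1 ?addr0 // => j _; rewrite kop1 mulr0.
by rewrite big1 // => j _; rewrite dv1 !mulr0.
Qed.

Lemma sum_delta i (F : 'I_n -> V) : \sum_j (j == i)%:R * F j = F i.
Proof.
rewrite (bigD1 i) //= big1 ?eqxx ?mul1r ?addr0 // => j /negbTE ->.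
by rewrite mul0r.
Qed.

Lemma dv_x i j f : dv j (xv i * f) = (j == i)%:R * f + xv i * dv j f.
Proof. by rewrite pderM pder_var. Qed.

Lemma eul_x i f : eul (xv i * f) = xv i * f + xv i * eul f.
Proof.
rewrite /eul mulr_sumr -{2}(sum_delta i (fun j => xv j * f)) -big_split /=.
by apply: eq_bigr => j _; rewrite dv_x; ring.
Qed.

Lemma lap_x i f : lap (xv i * f) = xv i * lap f + kc (2%:R * ep i) * dv i f.
Proof.
rewrite /lap mulr_sumr -(sum_delta i (fun j => kc (2%:R * ep j) * dv j f)).
rewrite -big_split /=; apply: eq_bigr => j _; rewrite dv_x pderD dv_x.
have -> : dv j ((j == i)%:R * f) = (j == i)%:R * dv j f.
  by rewrite -(rmorph_nat kc) dvZ.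
by ring.
Qed.

(** Multiplying by a variable costs the second-order operator one order. *)
Lemma kop_x la i j f : kop la j (xv i * f) = xv i * kop la j f
  + (j == i)%:R * (kc la * f - eul f) - xv i * dv j f
  + kc (ep i * ep j) * (xv j * dv i f).
Proof.
rewrite /kop lap_x dv_x -(rmorph_nat kc) eulP eul_x.
have -> : kc (ep i * ep j) = kc (ep j / 2%:R) * kc (2%:R * ep i).
  by rewrite -rmorphM /=; congr (kc _); field.
by ring.
Qed.

(** The raising operators act by first-order commutators, which is what makes
    the second-order operators [kop] disappear from the verification of the
    Lie relation. *)
Lemma rho_x la X i f : X \in g ->
  rho la X (xv i * f) =
    xv i * rho la X f + rho la (X *m Ymx K p i - Ymx K p i *m X) f.
Proof.
move=> gX; rewrite rho.unlock brY_00 eul_x.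
have assemble (x a b c d s0 s1 s2 s3 t0 t1 t2 t3 z0 z1 z2 z3 : V) :
    t0 = x * s0 - d -> t1 = x * s1 -> t2 = a + x * s2 ->
    t3 = x * s3 + z0 - x * b + c ->
    z1 = a - d -> z2 = c - x * b -> z3 = 0 ->
    t0 + t1 + t2 + t3 = x * (s0 + s1 + s2 + s3) + (z0 + z1 + z2 + z3).
  by move=> -> -> -> -> -> -> ->; ring.
apply: (assemble (xv i)
  (\sum_l kc (X (ix l) (ix i)) * (xv l * f))
  (\sum_j kc (X ord0 (ix j)) * dv j f)
  (\sum_l kc (X ord0 (ix l)) * kc (ep i * ep l) * (xv l * dv i f))
  (kc (X ord0 ord0) * (xv i * f))).
- by ring.
- by rewrite mulr_sumr; apply: eq_bigr => l _; ring.
- rewrite mulr_sumr -big_split /=; apply: eq_bigr => l _.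
  rewrite mulr_sumr -(sum_delta i (fun j => kc (X (ix l) (ix j)) * (xv l * f))).
  by rewrite -big_split /=; apply: eq_bigr => j _; rewrite dv_x; ring.
- rewrite -(sum_delta i (fun j => kc (X ord0 (ix j)) * (kc la * f - eul f))).
  rewrite 2!mulr_sumr -big_split /= -sumrB -big_split /=; apply: eq_bigr => j _.
  by rewrite kop_x; ring.
- rewrite -(sum_delta i (fun l => kc (X ord0 ord0) * (xv l * f))) -sumrB.
  by apply: eq_bigr => l _; rewrite brY_ix0 -(rmorph_nat kc); ring.
- rewrite mulr_sumr.
  rewrite -(sum_delta i (fun l => \sum_j xv l * (kc (X ord0 (ix j)) * dv j f))).
  rewrite -sumrB; apply: eq_bigr => l _.
  rewrite -(sum_delta i (fun j => 
    kc (X ord0 (ix l)) * kc (ep i * ep l) * (xv l * dv j f))).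
  rewrite mulr_sumr -sumrB; apply: eq_bigr => j _.
  by rewrite brY_ixix // -!(rmorph_nat kc); ring.
- by rewrite big1 // => j _; rewrite brY_0ix // rmorph0 mul0r.
Qed.

End Operators.

Section LieRelation.
Context (K : fieldType) (p n : nat) (V : polyAlg K n).
Local Notation N := n.+2.
Hypothesis two_neq0 : 2%:R != 0 :> K.
Local Notation kc := (pconst V).
Local Notation g := (lsv (g_lie K p n)).
Local Notation xv := (@pvar K n V).
Local Notation rho := (@rho K p n V).
Implicit Types (la c : K) (X Y : 'M[K]_N) (f h : V).

Lemma rhoD la X f h : rho la X (f + h) = rho la X f + rho la X h.
Proof. by have := rhoP p la X 1 f h; rewrite rmorph1 !mul1r. Qed.
Lemma rho0 la X : rho la X 0 = 0.
Proof. by apply: (addrI (rho la X 0)); rewrite -rhoD !addr0. Qed.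
Lemma rhoZ la X c f : rho la X (kc c * f) = kc c * rho la X f.
Proof. by have := rhoP p la X c f 0; rewrite rho0 !addr0. Qed.
Lemma rho_sum la X (I : finType) (F : I -> V) :
  rho la X (\sum_i F i) = \sum_i rho la X (F i).
Proof. exact: (big_morph _ (rhoD la X) (rho0 la X)). Qed.
Lemma rho_mxD la X Y f : rho la (X + Y) f = rho la X f + rho la Y f.
Proof. by have := rho_mxP p la 1 X Y f; rewrite scale1r rmorph1 mul1r. Qed.

Let dot X : V := \sum_i kc (X (ix i) ord0) * xv i.
Let tr X Y : K := \sum_i X ord0 (ix i) * Y (ix i) ord0.
Let app X Y : V := \sum_l kc (\sum_i X (ix l) (ix i) * Y (ix i) ord0) * xv l.

Let rho_rho1 la X Y : X \in g -> rho la X (rho la Y 1) =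
  rho la Y 1 * rho la X 1 + kc (la * tr X Y) + app X Y - kc (X ord0 ord0) * dot Y.
Proof.
move=> gX; rewrite {1}rho1 rhoD -[kc (_ * la)]mulr1 rhoZ rho_sum.
have -> : \sum_i rho la X (kc (Y (ix i) ord0) * xv i) =
   dot Y * rho la X 1
   + \sum_i (kc (la * (X ord0 (ix i) * Y (ix i) ord0))
       + (\sum_l kc (X (ix l) (ix i) * Y (ix i) ord0) * xv l
         - kc (X ord0 ord0) * (kc (Y (ix i) ord0) * xv i))).
  rewrite mulr_suml -big_split /=; apply: eq_bigr => i _.
  rewrite rhoZ; have -> : rho la X (xv i) = xv i * rho la X 1
      + rho la (X *m Ymx K p i - Ymx K p i *m X) 1.
    by rewrite -rho_x // mulr1.
  rewrite mulrDr; congr (_ + _); first by rewrite mulrA.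
  rewrite rho1 brY_00 mulrDr -rmorphM /=; congr (_ + _).
    by congr (kc _); ring.
  rewrite -(sum_delta i (fun l => kc (X ord0 ord0) * (kc (Y (ix i) ord0) * xv l))).
  rewrite mulr_sumr -sumrB; apply: eq_bigr => l _.
  by rewrite brY_ix0 -(rmorph_nat kc); ring.
rewrite big_split sumrB /= -mulr_sumr -[\sum_i kc _]rmorph_sum /= -mulr_sumr.
rewrite [X in _ + (_ + (_ + (X - _)))]exchange_big /= [rho la Y 1]rho1 -/(tr X Y) -/(dot Y).
have -> : app X Y =
    \sum_l \sum_i kc (X (ix l) (ix i) * Y (ix i) ord0) * xv l.
  by apply: eq_bigr => l _; rewrite rmorph_sum mulr_suml.
by rewrite -?/(dot Y); ring.
Qed.

(** If D(X, Y) is the defect of the Lie relation, then [rho_x] and the Jacobi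
    identity give D(X, Y) x_i = x_i D(X, Y) + D([X, Y_i], Y) + D(X, [Y, Y_i]).
    An induction on monomials, for all X and Y at once, thus reduces the claim
    to the polynomial 1. *)
Lemma rho_lie la X Y f : X \in g -> Y \in g ->
  rho la X (rho la Y f) - rho la Y (rho la X f) = rho la (X *m Y - Y *m X) f.
Proof.
move=> gX gY; elim/pvar_ind: f X Y gX gY => [|f h IHf IHh|c f IHf|i f IHf] X Y gX gY.
- rewrite !rho_rho1 // [RHS]rho1.
  have brE k l : (X *m Y - Y *m X) k l = (X *m Y) k l - (Y *m X) k l.
    by rewrite [LHS]mxE [X in _ + X]mxE.
  have e0 : (X *m Y - Y *m X) ord0 ord0 = tr X Y - tr Y X.
    rewrite brE !mxE !sum_ix (g_0max two_neq0 gX) (g_0max two_neq0 gY).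
    by rewrite -/(tr X Y) -/(tr Y X); ring.
  have el l : (X *m Y - Y *m X) (ix l) ord0 =
      X (ix l) ord0 * Y ord0 ord0 + (\sum_i X (ix l) (ix i) * Y (ix i) ord0)
    - (Y (ix l) ord0 * X ord0 ord0 + (\sum_i Y (ix l) (ix i) * X (ix i) ord0)).
    rewrite brE !mxE !sum_ix (g_max0 two_neq0 gX) (g_max0 two_neq0 gY).
    by ring.
  rewrite e0.
  have -> : \sum_i kc ((X *m Y - Y *m X) (ix i) ord0) * xv i =
      kc (Y ord0 ord0) * dot X + app X Y - (kc (X ord0 ord0) * dot Y + app Y X).
    rewrite !mulr_sumr -!big_split -sumrB /=.
    by apply: eq_bigr => l _; rewrite el; ring.
  by ring.
- by rewrite !rhoD -IHf // -IHh //; ring.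
- by rewrite !rhoZ -IHf //; ring.
- have gi := Ymx_g K p i.
  have brg Z T : Z \in g -> T \in g -> Z *m T - T *m Z \in g.
    exact: lsv_closed.
  rewrite !rho_x ?brg // !rhoD !rho_x ?brg //.
  have jac (Yi : 'M[K]_N) : (X *m Y - Y *m X) *m Yi - Yi *m (X *m Y - Y *m X) =
     ((X *m Yi - Yi *m X) *m Y - Y *m (X *m Yi - Yi *m X))
     + (X *m (Y *m Yi - Yi *m Y) - (Y *m Yi - Yi *m Y) *m X).
    rewrite !mulmxBl !mulmxBr !mulmxA.
    move: (X *m Y *m Yi) (Y *m X *m Yi) (Yi *m X *m Y) (Yi *m Y *m X).
    move: (X *m Yi *m Y) (Y *m Yi *m X) => a b c d e k.
    by apply/matrixP => u v; rewrite !mxE; ring.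
  rewrite jac [rho la (_ - _ + (_ - _)) f]rho_mxD -(IHf X Y) // -(IHf _ Y (brg _ _ gX gi) gY).
  rewrite -(IHf X _ gX (brg _ _ gY gi)).
  by ring.
Qed.

End LieRelation.

(** * Vectors invariant under rotations of the first variables *)

Section ProductFormula.
Context (K : fieldType) (p m : nat).
Local Notation n := m.+1.
Local Notation N := n.+2.
Context (V : polyAlg K n).
Hypothesis two_neq0 : 2%:R != 0 :> K.
Local Notation kc := (pconst V).
Local Notation xv := (@pvar K n V).
Local Notation dv := (@pder K n V).
Local Notation eul := (@eul K n V).
Local Notation lap := (@lap K p n V).
Local Notation kop := (@kop K p n V).
Local Notation rho := (@rho K p n V).
Local Notation ep := (ep K p (n := n)).
Local Notation top := (ord_max : 'I_n).
Implicit Types (la c d : K) (X : 'M[K]_N) (f u : V) (i j : 'I_n).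

Lemma g'_entries X : X \in lsv (g'_lie K p n) ->
  [/\ X \in lsv (g_lie K p n), X (ix top) ord0 = 0, X ord0 (ix top) = 0,
      forall i, X (ix i) (ix top) = 0 & forall i, X (ix top) (ix i) = 0].
Proof.
rewrite mem_g' => /andP[gX /eqP/matrixP X0].
have col k : X k (ix top) = 0.
  have := X0 k 0; rewrite mxE [RHS]mxE => <-.
  rewrite (bigD1 (ix top)) //= big1 => [|l /negbTE hl].
    rewrite mxE eqxx andbT addr0 (_ : _ == _) ?mulr1 //.
    by rewrite -val_eqE /= inordK.
  rewrite mxE eqxx andbT (_ : (l == _) = false) ?mulr0 //.
  by rewrite -hl -!val_eqE /= inordK.
split=> // [|i].
  have := g_maxix top gX; rewrite col => /eqP.
  by rewrite eq_sym oppr_eq0 mulf_eq0 (negbTE (ep_neq0 _ _ _)) => /eqP.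
have := g_rot i top gX; rewrite col mulr0 oppr0 => /eqP.
by rewrite mulf_eq0 (negbTE (ep_neq0 _ _ _)) => /eqP.
Qed.

Definition rotation_invariant u := forall i j, i != top -> j != top ->
  kc (ep i) * (xv i * dv j u) = kc (ep j) * (xv j * dv i u).

Lemma eulM f u : eul (f * u) = eul f * u + f * eul u.
Proof.
rewrite /eul mulr_suml mulr_sumr -big_split /=; apply: eq_bigr => i _.
by rewrite pderM; ring.
Qed.

Lemma lapM f u : lap (f * u) =
  lap f * u + kc 2%:R * (\sum_i kc (ep i) * (dv i f * dv i u)) + f * lap u.
Proof.
rewrite /lap mulr_suml !mulr_sumr -!big_split /=; apply: eq_bigr => i _.
by rewrite !(pderM, pderD); ring.
Qed.

Lemma kc_ep_sqr i : kc (ep i) * kc (ep i) = 1.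
Proof. by rewrite -rmorphM /= ep_sqr rmorph1. Qed.

(** Multiplying by f moves the Euler degree d of u into the weight: this is
    why u generates a scalar Verma module of weight la - d as soon as the
    raising operators kill it. *)
Lemma kopM la d j f u : dv top f = 0 -> rotation_invariant u ->
  eul u = kc d * u -> j != top ->
  kop la j (f * u) = kop (la - d) j f * u + f * kop la j u.
Proof.
move=> f0 ru du jt; rewrite /kop pderM [eul (_ + _)](_ : _ =
  eul (dv j f) * u + dv j f * (kc d * u) + (eul f * dv j u + f * eul (dv j u))).
  rewrite lapM.
  have cross : eul f * dv j u =
      kc (ep j / 2%:R) * xv j * (kc 2%:R * \sum_i kc (ep i) * (dv i f * dv i u)).
    rewrite !mulr_sumr mulr_suml; apply: eq_bigr => i _.
    have [->|it] := eqVneq i top; first by rewrite f0; ring.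
    have half : kc (ep j / 2%:R) * kc 2%:R = kc (ep j).
      by rewrite -rmorphM /=; congr (kc _); field.
    have -> : xv i * dv i f * dv j u =
        dv i f * (kc (ep i) * (kc (ep i) * (xv i * dv j u))).
      by rewrite -[LHS]mul1r -(kc_ep_sqr i); ring.
    by rewrite ru // -half; ring.
  by rewrite cross; ring.
have := eulP 1 (dv j f * u) (f * dv j u); rewrite rmorph1 !mul1r => ->.
by rewrite !eulM du.
Qed.

Lemma rhoM la d X f u : X \in lsv (g'_lie K p n) -> dv top f = 0 ->
  rotation_invariant u -> eul u = kc d * u ->
  rho la X (f * u) = rho (la - d) X f * u
    + f * \sum_j kc (X ord0 (ix j)) * kop la j u.
Proof.
move=> /g'_entries[gX v0 b0 c0 r0] f0 ru du; rewrite !rho.unlock.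
(* The middle block of X is antisymmetric for the form, and u is invariant. *)
have rot0 : \sum_i \sum_j kc (X (ix i) (ix j)) * (xv i * dv j u) = 0.
  set S := LHS; have SN : S = - S.
    rewrite {1}/S exchange_big /= /S -sumrN; apply: eq_bigr => i _.
    rewrite -sumrN; apply: eq_bigr => j _.
    have [->|it] := eqVneq i top; first by rewrite r0 c0; ring.
    have [->|jt] := eqVneq j top; first by rewrite r0 c0; ring.
    have -> : X (ix j) (ix i) = - (ep i * ep j * X (ix i) (ix j)).
      by rewrite -[LHS]mul1r -(ep_sqr _ p j) -mulrA g_rot // mulrN; ring.
    have := ru j i jt it => e.
    have e' : xv i * dv j u = kc (ep i) * (kc (ep j) * (xv j * dv i u)).
      by rewrite -[LHS]mul1r -(kc_ep_sqr i) -mulrA e.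
    by rewrite e'; ring.
  have : kc 2%:R * S = 0 by rewrite rmorph_nat mulr_natl mulr2n {1}SN addNr.
  move/(congr1 (fun x => kc (2%:R)^-1 * x)).
  by rewrite mulrA -rmorphM /= mulVf // rmorph1 mul1r mulr0.
have assemble (a b c e s1 s2 s3 t1 t2 t3 : V) : 
    a = b * u -> t1 = s1 * u -> t2 = s2 * u -> t3 = s3 * u + e ->
    a + t1 + t2 + t3 = (b + s1 + s2 + s3) * u + e.
  by move=> -> -> -> ->; ring.
apply: (assemble) => //.
- by rewrite eulM du; ring.
- by rewrite mulr_suml; apply: eq_bigr => i _; ring.
- transitivity ((\sum_i \sum_j kc (X (ix i) (ix j)) * (xv i * dv j f)) * u
    + f * \sum_i \sum_j kc (X (ix i) (ix j)) * (xv i * dv j u)); last first.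
    by rewrite rot0; ring.
  rewrite mulr_suml mulr_sumr -big_split /=; apply: eq_bigr => i _.
  rewrite mulr_suml mulr_sumr -big_split /=; apply: eq_bigr => j _.
  by rewrite pderM; ring.
- rewrite mulr_suml mulr_sumr -big_split /=; apply: eq_bigr => j _.
  have [->|jt] := eqVneq j top; first by rewrite b0; ring.
  by rewrite (kopM la f0 ru du jt); ring.
Qed.

End ProductFormula.

Section RadialPolynomials.
Context (K : fieldType) (p m : nat).
Local Notation n := m.+1.
Local Notation N := n.+2.
Context (V : polyAlg K n).
Hypothesis char0 : forall k, k.+1%:R != 0 :> K.
Local Notation kc := (pconst V).
Local Notation xv := (@pvar K n V).
Local Notation dv := (@pder K n V).
Local Notation eul := (@eul K n V).
Local Notation lap := (@lap K p n V).
Local Notation kop := (@kop K p n V).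
Local Notation ep := (ep K p (n := n)).
Local Notation top := (ord_max : 'I_n).
Implicit Types (la : K) (f u : V) (i j : 'I_n) (l b k : nat).

Let two_neq0 : 2%:R != 0 :> K := char0 1.

(** The quadratic form in the first variables. *)
Definition rsq : V := \sum_(i | i != top) kc (ep i) * (xv i * xv i).

Lemma dv_rsq j : dv j rsq = if j == top then 0 else kc (2%:R * ep j) * xv j.
Proof.
rewrite /rsq (big_morph _ (pderD j) (dv0 V j)).
have E i : dv j (kc (ep i) * (xv i * xv i)) =
    (i == j)%:R * (kc (2%:R * ep i) * xv i).
  by rewrite dvZ pderM !pder_var eq_sym -(rmorph_nat kc); ring.
under eq_bigr do rewrite E.
rewrite big_mkcond /= (bigD1 j) //= big1 ?addr0 => [|i /negbTE ->].
  by rewrite eqxx mul1r; case: eqP.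
by rewrite mul0r; case: ifP.
Qed.

Lemma dvX j f k : dv j (f ^+ k) = k%:R * (f ^+ k.-1 * dv j f).
Proof.
elim: k => [|k IHk]; first by rewrite dv1 mul0r.
rewrite exprS pderM IHk; case: k {IHk} => [|k] /=; first by rewrite expr0; ring.
by rewrite -!(rmorph_nat kc) exprS; ring.
Qed.

Lemma eul_var i : eul (xv i) = xv i.
Proof. by have := eul_x i (1 : V); rewrite eul1 mulr0 addr0 mulr1. Qed.

Lemma eulX f c k : eul f = kc c * f -> eul (f ^+ k) = kc (k%:R * c) * f ^+ k.
Proof.
move=> fc; elim: k => [|k IHk]; first by rewrite eul1 mul0r rmorph0 mul0r.
by rewrite exprS eulM fc IHk -natr1; ring.
Qed.

Lemma eul_scale c f : eul (kc c * f) = kc c * eul f.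
Proof. by have := eulP c f 0; rewrite eul0 !addr0. Qed.

Lemma eul_rsq : eul rsq = kc 2%:R * rsq.
Proof.
rewrite /eul /rsq mulr_sumr [RHS]big_mkcond; apply: eq_bigr => i _ /=.
by rewrite dv_rsq; case: eqP => _ /=; rewrite ?mulr0 //; ring.
Qed.

Definition radial l c : V := rsq ^+ l * xv top ^+ c.

Lemma dv_radial j l c : j != top ->
  dv j (radial l c) = kc (2%:R * l%:R * ep j) * (xv j * radial l.-1 c).
Proof.
move=> /negbTE jt; rewrite /radial pderM !dvX dv_rsq jt pder_var jt.
by rewrite /= !mulr0 addr0 -(rmorph_nat kc); ring.
Qed.

Lemma radial_rotation_invariant l c : rotation_invariant p (radial l c).
Proof. by move=> i j it jt; rewrite !dv_radial //; ring. Qed.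

Lemma eul_radial l c : eul (radial l c) = kc (2%:R * l%:R + c%:R) * radial l c.
Proof.
have et : eul (xv top) = kc 1 * xv top by rewrite eul_var rmorph1 mul1r.
by rewrite /radial eulM (eulX _ eul_rsq) (eulX _ et); ring.
Qed.

Lemma lap_rsq_exp l : lap (rsq ^+ l) =
  kc (2%:R * l%:R * (m%:R + 2%:R * (l%:R - 1))) * rsq ^+ l.-1.
Proof.
have cross f : \sum_i kc (ep i) * (dv i rsq * dv i f) =
    kc 2%:R * (eul f - xv top * dv top f).
  rewrite /eul (bigD1 top) //= dv_rsq eqxx mul0r mulr0 add0r.
  rewrite [X in _ * (X - _)](bigD1 top) //= addrAC subrr add0r mulr_sumr.
  apply: eq_bigr => i /negbTE it; rewrite dv_rsq it.
  by rewrite -[RHS]mul1r -(kc_ep_sqr p V i); ring.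
have lr : lap rsq = kc (2%:R * m%:R).
  rewrite /lap (bigD1 top) //= dv_rsq eqxx dv0 mulr0 add0r.
  rewrite (eq_bigr (fun _ => kc 2%:R)) => [|i /negbTE it].
    by rewrite sumr_const cardC1 card_ord /= -mulr_natl; ring.
  rewrite dv_rsq it dvZ pder_var eqxx mulr1 -rmorphM /=; congr (kc _).
  by rewrite mulrCA ep_sqr mulr1.
elim: l => [|l IHl]; first by rewrite lap1 !mulr0 mul0r rmorph0 mul0r.
rewrite exprS lapM cross lr IHl (eulX _ eul_rsq) dvX dv_rsq eqxx /=.
case: l {IHl} => [|l] /=; first by rewrite !expr0; ring.
by rewrite !exprS -!natr1; ring.
Qed.

Lemma lap_top_exp c : lap (xv top ^+ c) =
  kc (ep top * (c%:R * c.-1%:R)) * xv top ^+ c.-2.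
Proof.
rewrite /lap (bigD1 top) //= big1 => [|i /negbTE it]; last first.
  by rewrite dvX pder_var it !mulr0 dv0 mulr0.
rewrite addr0 !dvX pder_var eqxx mulr1 -(rmorph_nat kc) dvZ dvX pder_var eqxx.
by rewrite mulr1 -(rmorph_nat kc); ring.
Qed.

(** Among the l with given degree 2l + c, the first coefficient vanishes at
    l = 0 and at most once more, which is where linked weights come from. *)
Lemma kop_radial la j l c : j != top -> kop la j (radial l c) =
  kc (ep j) * xv j *
   (kc (l%:R * (2%:R * la + m%:R - 2%:R * l%:R - 2%:R * c%:R)) * radial l.-1 c
    + kc (ep top / 2%:R * (c%:R * c.-1%:R)) * radial l c.-2).
Proof.
move=> jt; have jt' := negbTE jt; rewrite /kop dv_radial // eul_scale eulM.
rewrite eul_var eul_radial [lap _]lapM.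
have -> : \sum_i kc (ep i) * (dv i (rsq ^+ l) * dv i (xv top ^+ c)) = 0.
  rewrite big1 // => i _; rewrite !dvX dv_rsq pder_var.
  by case: eqP => _; rewrite ?mulr0 ?mul0r ?mulr0.
rewrite lap_rsq_exp lap_top_exp /radial.
have half : kc (ep j / 2%:R) = kc (ep j) * kc (2%:R^-1) by rewrite rmorphM.
have half' : kc (ep top / 2%:R * (c%:R * c.-1%:R)) =
   kc (ep top) * kc (2%:R^-1) * kc (c%:R * c.-1%:R) by rewrite !rmorphM.
rewrite half half'.
have h2 : kc 2%:R * kc 2%:R^-1 = 1 by rewrite -rmorphM /= mulfV // rmorph1.
case: l => [|l] /=; first by rewrite !mul0r !mulr0; ring.
set A := rsq ^+ l; set B := xv top ^+ c.
have -> : kc (2%:R * l.+1%:R * (m%:R + 2%:R * (l.+1%:R - 1))) =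
   kc 2%:R * kc (l.+1%:R * (m%:R + 2%:R * (l.+1%:R - 1))).
  by rewrite -rmorphM mulrA.
rewrite -natr1.
transitivity (kc (ep j) * xv j * (kc ((l%:R + 1) * 2%:R * (la - 2%:R * l%:R - c%:R - 1)) * (A * B)
  + (kc 2%:R * kc 2%:R^-1) * kc ((l%:R + 1) * (m%:R + 2%:R * l%:R)) * (A * B)
  + kc 2%:R^-1 * kc (ep top) * kc (c%:R * c.-1%:R) * (rsq ^+ l.+1 * xv top ^+ c.-2))).
  by ring.
by rewrite h2; ring.
Qed.

(** Homogeneous of degree b, since [rsq] has degree 2. *)
Definition radial_poly b (c : nat -> K) : V :=
  \sum_(l < (b./2).+1) kc (c l) * radial l (b - l.*2).

Lemma dv_sum j (I : finType) (F : I -> V) : dv j (\sum_i F i) = \sum_i dv j (F i).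
Proof. exact: (big_morph _ (pderD j) (dv0 V j)). Qed.

Lemma radial_poly_rotation_invariant b c : rotation_invariant p (radial_poly b c).
Proof.
move=> i j it jt; rewrite /radial_poly !dv_sum !mulr_sumr; apply: eq_bigr => l _.
have := @radial_rotation_invariant l (b - l.*2) i j it jt; rewrite !dvZ => e.
transitivity (kc (c l) * (kc (ep i) * (xv i * dv j (radial l (b - l.*2))))).
  by ring.
by rewrite e; ring.
Qed.

Lemma half_bound b (l : 'I_(b./2).+1) : (l.*2 <= b)%N.
Proof. by rewrite -geq_half_double -ltnS. Qed.

Lemma eul_radial_poly b c : eul (radial_poly b c) = kc b%:R * radial_poly b c.
Proof.
rewrite /radial_poly (big_morph eul (id1 := 0) (op1 := +%R)) ?eul0 //; last first.
  by move=> f g; have := eulP 1 f g; rewrite rmorph1 !mul1r.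
rewrite mulr_sumr; apply: eq_bigr => l _.
have bE : b%:R = 2%:R * l%:R + (b - l.*2)%:R :> K.
  by rewrite -natrM -natrD mul2n subnKC ?half_bound.
by rewrite eul_scale eul_radial bE; ring.
Qed.

Lemma kop_radial_poly la j b c : j != top ->
  kop la j (radial_poly b c) = kc (ep j) * xv j *
    \sum_(l < b./2) kc
      (c l.+1 * (l.+1%:R * (2%:R * la + m%:R - 2%:R * b%:R + 2%:R * l.+1%:R))
       + c l * (ep top / 2%:R * ((b - l.*2)%:R * (b - l.*2).-1%:R)))
      * radial l (b - l.*2).-2.
Proof.
move=> jt; have kop0 : kop la j 0 = 0.
  rewrite /kop dv0 eul0 [lap 0]big1 ?mulr0 ?subr0 ?addr0 // => i _.
  by rewrite !dv0 mulr0.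
rewrite /radial_poly (big_morph (kop la j) (id1 := 0) (op1 := +%R)) //; last first.
  by move=> f g; have := kopP p la j 1 f g; rewrite rmorph1 !mul1r.
pose s l : V := kc (c l * (l%:R * (2%:R * la + m%:R - 2%:R * b%:R + 2%:R * l%:R)))
   * radial l.-1 (b - l.*2).
pose t l : V := kc (c l * (ep top / 2%:R * ((b - l.*2)%:R * (b - l.*2).-1%:R)))
   * radial l (b - l.*2).-2.
transitivity (kc (ep j) * xv j * \sum_(l < (b./2).+1) (s l + t l)).
  rewrite mulr_sumr; apply: eq_bigr => l _.
  have := kopP p la j (c l) (radial l (b - l.*2)) 0; rewrite kop0 !addr0 => ->.
  rewrite kop_radial // /s /t.
  have -> : 2%:R * la + m%:R - 2%:R * l%:R - 2%:R * (b - l.*2)%:R =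
      2%:R * la + m%:R - 2%:R * b%:R + 2%:R * l%:R :> K.
    by rewrite natrB ?half_bound // -muln2 natrM; ring.
  by rewrite !(rmorphM kc (c l)); ring.
congr (_ * _); rewrite big_split /= big_ord_recl [X in _ + X]big_ord_recr /=.
have -> : s 0%N = 0 by rewrite /s mul0r mulr0 rmorph0 mul0r.
have -> : t b./2 = 0.
  rewrite /t; have -> : (b - b./2.*2 = odd b)%N by rewrite -{1}[b]odd_double_half addnK.
  by case: (odd b); rewrite /= ?mulr0 ?mul0r ?mulr0 rmorph0 mul0r.
rewrite add0r addr0 -big_split /=; apply: eq_bigr => l _.
rewrite /s /t [kc (_ + c l * _)](rmorphD kc) [RHS]mulrDl /bump leq0n add1n.
by rewrite doubleS !subnS.
Qed.

End RadialPolynomials.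

Section SingularVectors.
Context (K : fieldType) (p m : nat).
Local Notation n := m.+1.
Context (V : polyAlg K n).
Hypothesis char0 : forall k, k.+1%:R != 0 :> K.
Local Notation kc := (pconst V).
Local Notation xv := (@pvar K n V).
Local Notation kop := (@kop K p n V).
Local Notation top := (ord_max : 'I_n).
Context (la : K) (J : nat).
Hypothesis laJ : 2%:R * la + m%:R = J%:R.
Implicit Types (b l a i : nat).

Let two_neq0 : 2%:R != 0 :> K := char0 1.

Lemma natr_inj : injective (fun k : nat => k%:R : K).
Proof.
have h a b : (a <= b)%N -> a%:R = b%:R :> K -> a = b.
  move=> ab /eqP; rewrite eq_sym -subr_eq0 -natrB // => h.
  apply/eqP; rewrite eqn_leq ab /= -subn_eq0.
  by case: (b - a)%N h => // k; rewrite (negbTE (char0 k)).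
move=> a b; case: (leqP a b) => [|/ltnW] ab e; first exact: h.
by apply/esym/h.
Qed.

Let fall b l : K := ep K p top / 2%:R * ((b - l.*2)%:R * (b - l.*2).-1%:R).
Let den b l : K := l.+1%:R * (2%:R * la + m%:R - 2%:R * b%:R + 2%:R * l.+1%:R).

(** Coefficients that solve the recurrence [kop_radial_poly] with the right-hand
    side s. A vanishing denominator gives the value 0, so that the recurrence
    still holds there as soon as its other terms cancel. *)
Fixpoint rec_coef b (s : nat -> K) l : K :=
  if l is l'.+1 then (s l' - rec_coef b s l' * fall b l') / den b l' else 1.

(** The divisor at step l of the recurrence vanishes, see [den_eq0]. *)
Definition resonant b l := (J + l.+1.*2 == b.*2)%N.

Lemma den_eq0 b l : (den b l == 0) = resonant b l.
Proof.
rewrite /den mulf_eq0 (negbTE (char0 l)) /= laJ addrAC subr_eq0.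
rewrite -!natrM -natrD /resonant -!mul2n.
by apply/eqP/eqP => [/natr_inj|->].
Qed.

Lemma kop_rec_coef j b s : j != top ->
    (forall l, (l < b./2)%N -> resonant b l -> s l = rec_coef b s l * fall b l) ->
  kop la j (radial_poly p V b (rec_coef b s)) =
    kc (ep K p j) * xv j * \sum_(l < b./2) kc (s l) * radial p V l (b - l.*2).-2.
Proof.
move=> jt hs; rewrite kop_radial_poly //; congr (_ * _); apply: eq_bigr => l _.
congr (kc _ * _); rewrite -/(den b l) -/(fall b l) /=.
have [r|r] := boolP (resonant b l).
  have /eqP -> : den b l == 0 by rewrite den_eq0.
  by rewrite mulr0 add0r -hs.
by rewrite divfK ?den_eq0 // subrK.
Qed.

Definition singular_poly b : V := radial_poly p V b (rec_coef b (fun=> 0)).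

Lemma kop_singular_poly j b : j != top ->
  (forall l, (l < b./2)%N -> ~~ resonant b l) -> kop la j (singular_poly b) = 0.
Proof.
move=> jt hb; rewrite kop_rec_coef // => [|l lb]; last first.
  by rewrite (negbTE (hb l lb)).
by rewrite big1 ?mulr0 // => l _; rewrite rmorph0 mul0r.
Qed.

Lemma rec_coef_neq0 b l : (l <= b./2)%N ->
    (forall i, (i < l)%N -> ~~ resonant b i) -> rec_coef b (fun=> 0) l != 0.
Proof.
elim: l => [|l IHl] lb hb; first by rewrite oner_eq0.
rewrite /= sub0r mulf_neq0 ?oppr_eq0 ?invr_eq0 ?den_eq0 ?hb //.
rewrite mulf_neq0 ?IHl // => [|i il|]; try by rewrite ?hb // ltnW.
have : (1 < b - l.*2)%N by lia.
rewrite /fall; case: (b - l.*2)%N => [|[|k]] // _.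
by rewrite !mulf_neq0 ?ep_neq0 ?invr_eq0 ?char0.
Qed.

(** With J = 2k the recurrence in degree b = 2k - a, for a < k, meets a vanishing
    divisor. Writing k = a + i + 1 gives b = a + 2 (i + 1). *)
Section Resonance.
Variables a i : nat.
Hypothesis aiJ : (J = (a + i.+1).*2)%N.
Local Notation b := (a + i.+1.*2)%N.

Lemma resonantE l : resonant b l = (l == i).
Proof.
by rewrite /resonant aiJ; apply/eqP/eqP; lia.
Qed.

(** What is left of the recurrence at the resonant step. *)
Definition obstruction : K := rec_coef b (fun=> 0) i * fall b i.

(* The remainder obstruction * t^a at the resonant step cannot be cancelled. The
   later terms of the source complete it to a multiple of the singular vector of
   degree a. *)
Let source l : K :=
  if (l < i)%N then 0 else obstruction * rec_coef a (fun=> 0) (l - i).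

Definition linked_poly : V := radial_poly p V b (rec_coef b source).

Lemma obstruction_neq0 : obstruction != 0.
Proof.
rewrite mulf_neq0 ?rec_coef_neq0 //.
- by lia.
- by move=> l li; rewrite resonantE ltn_eqF.
rewrite /fall (_ : a + i.+1.*2 - i.*2 = a.+2)%N; last by lia.
by rewrite !mulf_neq0 ?ep_neq0 ?invr_eq0 ?char0.
Qed.

Let rec_coef_source l : (l <= i)%N -> rec_coef b source l = rec_coef b (fun=> 0) l.
Proof.
elim: l => //= l IHl li; rewrite IHl 1?ltnW //.
by rewrite /source li.
Qed.

(** The raising operators send the linked vector into the submodule generated
    by the singular vector of degree a. *)
Lemma kop_linked_poly j : j != top -> kop la j linked_poly =
  kc obstruction * (kc (ep K p j) * xv j * rsq p V ^+ i) * singular_poly a.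
Proof.
move=> jt; rewrite kop_rec_coef // => [|l _]; last first.
  rewrite resonantE => /eqP ->; rewrite rec_coef_source //.
  by rewrite /source ltnn subnn mulr1.
have -> : (b./2 = i + a./2.+1)%N.
  by lia.
rewrite big_split_ord /= big1 ?add0r => [|l _]; last first.
  by rewrite /source ltn_ord rmorph0 mul0r.
rewrite /singular_poly /radial_poly !mulr_sumr; apply: eq_bigr => l _.
rewrite /source ltnNge leq_addr /= addKn rmorphM /=.
have -> : ((b - (i + l).*2).-2 = a - l.*2)%N.
  by lia.
by rewrite /radial exprD; ring.
Qed.

End Resonance.

End SingularVectors.

(** * Scalar generalized Verma modules as polynomial modules *)

(** The part of the Poincare-Birkhoff-Witt theorem that says that an induced
    module is spanned by products of lowering operators; [Y] spans a complement
    of the subalgebra. *)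
Section InducedSpan.
Context (K : fieldType) (L P : lieAlgType K) (f : {rmorphism U P -> U L}).
Context (V : lmodType (U P)) (k : nat) (Y : 'I_k -> L).
Hypothesis f_alg : forall c : K, f c%:A = c%:A.
Hypothesis LPY : forall x : L, exists (y : U P) (c : 'I_k -> K),
  ugen x = f y + \sum_i c i *: ugen (Y i).

Inductive induced_span : tensor f V -> Prop :=
| InducedBase v : induced_span (tens f 1 v)
| InducedD z w : induced_span z -> induced_span w -> induced_span (z + w)
| InducedY i z : induced_span z -> induced_span (ugen (Y i) *: z).

Let spanZ (c : K) z : induced_span z -> induced_span (c%:A *: z).
Proof.
elim=> {z} [v|z w _ hz _ hw|i z _ hz].
- by rewrite tensZ mulr1 -f_alg -[f _]mul1r tensM; apply: InducedBase.
- by rewrite scalerDr; apply: InducedD.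
- by rewrite scalerA mulr_algl -mulr_algr -scalerA; apply: InducedY.
Qed.

Let span0 : induced_span 0.
Proof.
rewrite -(scale0r (tens f 1 0 : tensor f V)) -(scale0r (1 : U L)).
exact/spanZ/InducedBase.
Qed.

Let span_gen x z : induced_span z -> induced_span (ugen x *: z).
Proof.
move=> hz; elim: hz x => {z} [v|z w _ hz _ hw|i z hz IHz] x.
- have [y [c ->]] := LPY x; rewrite scalerDl; apply: InducedD.
    by rewrite tensZ mulr1 -[f y]mul1r tensM; apply: InducedBase.
  rewrite scaler_suml; elim/big_ind: _ => // [|i _]; first exact: InducedD.
  by rewrite -mulr_algl -scalerA; apply/spanZ/InducedY/InducedBase.
- by rewrite scalerDr; apply: InducedD.
- have -> : ugen x *: (ugen (Y i) *: z) =
     ugen (Y i) *: (ugen x *: z) + ugen (lieb x (Y i)) *: z.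
    by rewrite ugen_lie scalerBl !scalerA addrC subrK.
  by apply: InducedD; [apply: InducedY|].
Qed.

Lemma induced_spanP z : induced_span z.
Proof.
have stable u : forall w, induced_span w -> induced_span (u *: w).
  elim/U_gen_ind: u => [c|x|a b ha hb|a b ha hb] w hw.
  - exact: spanZ.
  - exact: span_gen.
  - by rewrite scalerDl; apply: InducedD; [apply: ha|apply: hb].
  - by rewrite -scalerA; apply/ha/hb.
elim/tensor_indP: z => [a v|//|z w hz hw].
  by rewrite -[a]mulr1 -tensZ; apply/stable/InducedBase.
by apply: InducedD => //; rewrite -scaleN1r; apply: stable.
Qed.

End InducedSpan.

(** Evaluation of polynomials at commuting elements of a noncommutative
    algebra. *)
Section CommutingEvaluation.
Context (K : fieldType) (A : algType K) (k : nat) (Y : 'I_k -> A).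
Hypothesis YC : forall i j, Y i * Y j = Y j * Y i.

Definition ev_comm (f : {mpoly K[k]}) : A := mmap (in_alg A) Y f.

Lemma ev_comm_is_zmod_morphism : zmod_morphism ev_comm.
Proof. by move=> f g; apply: raddfB. Qed.
HB.instance Definition _ :=
  GRing.isZmodMorphism.Build {mpoly K[k]} A ev_comm ev_comm_is_zmod_morphism.

Lemma ev_comm1 : ev_comm 1 = 1.
Proof. by rewrite /ev_comm -mpolyC1 mmapC /= scale1r. Qed.

Lemma ev_commZ c f : ev_comm (c%:MP * f) = c *: ev_comm f.
Proof. by rewrite /ev_comm mul_mpolyC mmapZ /= mulr_algl. Qed.

Let mmap1D d e : mmap1 Y (d + e) = mmap1 Y d * mmap1 Y e.
Proof.
rewrite /mmap1 (eq_bigr (fun i => Y i ^+ d i * Y i ^+ e i)) => [|i _]; last first.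
  by rewrite mnmDE exprD.
have [h _] : \prod_i (Y i ^+ d i * Y i ^+ e i) =
      (\prod_i Y i ^+ d i) * (\prod_i Y i ^+ e i)
    /\ forall j, GRing.comm (Y j) (\prod_i Y i ^+ d i).
  elim/big_rec3: _ => [|i y1 y2 y3 _ [-> hy]].
    by split=> [|j]; [rewrite mulr1|exact: commr1].
  split=> [|j]; last by apply: commrM => //; apply: commrX; apply: YC.
  rewrite -!mulrA; congr (_ * _); rewrite !mulrA; congr (_ * _).
  exact/commr_sym/commrX/commr_sym.
exact: h.
Qed.

Lemma ev_commX i f : ev_comm ('X_i * f) = Y i * ev_comm f.
Proof.
elim/mpolyind: f => [|c d f _ _ IHf]; first by rewrite mulr0 !raddf0 mulr0.
rewrite mulrDr !raddfD /= IHf mulrDr; congr (_ + _).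
rewrite -scalerAr -mpolyXD /ev_comm !mmapZ !mmapX mmap1D mmap1U.
by rewrite /= !mulr_algl -scalerAr.
Qed.

Lemma ev_comm_commr (T : A) : (forall i, Y i * T = T * Y i) ->
  forall f, ev_comm f * T = T * ev_comm f.
Proof.
move=> YT; elim/mpoly_var_ind => [|f g hf hg|c f hf|i f hf].
- by rewrite ev_comm1 mulr1 mul1r.
- by rewrite raddfD /= mulrDl mulrDr hf hg.
- by rewrite ev_commZ -scalerAl -scalerAr hf.
- by rewrite ev_commX -mulrA hf mulrA YT mulrA.
Qed.

End CommutingEvaluation.

Section IteratedEvaluation.
Context (K : fieldType) (A : algType K) (m : nat) (Y : 'I_m.+1 -> A).
Hypothesis YC : forall i j, Y i * Y j = Y j * Y i.
Local Notation V := (iterated_polyAlg K m).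
Local Notation ev := (@ev_comm K A m (fun j : 'I_m => Y (lift ord_max j))).

Definition ev_iter (f : V) : A := (map_poly ev (f : {poly {mpoly K[m]}})).[Y ord_max].

Let ev1 : ev 1 = 1 := ev_comm1 _.
Lemma ev_iter_is_zmod_morphism : zmod_morphism ev_iter.
Proof. by move=> f g; rewrite /ev_iter raddfB hornerD hornerN. Qed.
HB.instance Definition _ :=
  GRing.isZmodMorphism.Build V A ev_iter ev_iter_is_zmod_morphism.

Lemma ev_iter1 : ev_iter 1 = 1.
Proof. by rewrite /ev_iter -polyC1 map_polyC /= hornerC ev1. Qed.

Let map_polyM (f : {mpoly K[m]}) (g : {poly {mpoly K[m]}}) (a : A) :
  (forall h, ev (f * h) = a * ev h) ->
  (map_poly ev (f%:P * g)).[Y ord_max] = a * (map_poly ev g).[Y ord_max].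
Proof.
move=> h; rewrite -hornerCM; congr (_.[_]); apply/polyP => i.
by rewrite coef_map !coefCM coef_map; apply: h.
Qed.

Lemma ev_iterZ c f : ev_iter (pconst V c * f) = c *: ev_iter f.
Proof.
rewrite -mulr_algl; apply: map_polyM => h.
by rewrite ev_commZ mulr_algl.
Qed.

Let map_polyMX (f : {poly {mpoly K[m]}}) :
  (map_poly ev (f * 'X)).[Y ord_max] = Y ord_max * (map_poly ev f).[Y ord_max].
Proof.
have mapX (h : {poly {mpoly K[m]}}) : map_poly ev (h * 'X) = map_poly ev h * 'X.
  by apply/polyP => l; rewrite coef_map !coefMX coef_map; case: ifP; rewrite //= raddf0.
rewrite mapX hornerMX; elim/poly_ind: f => [|g c IHg].
  by rewrite raddf0 horner0 mul0r mulr0.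
rewrite raddfD /= mapX hornerD hornerMX map_polyC hornerC /= mulrDl mulrDr.
rewrite IHg -mulrA IHg; congr (_ + _).
by apply: ev_comm_commr => [i j|i]; apply: YC.
Qed.

Lemma ev_iterX i f : ev_iter (pvar V i * f) = Y i * ev_iter f.
Proof.
rewrite /= /iter_var; case: unliftP => [j|] ->.
  by apply: map_polyM => h; apply: ev_commX => a b; apply: YC.
rewrite -map_polyMX /ev_iter; congr ((map_poly ev _).[_]); exact: mulrC.
Qed.

End IteratedEvaluation.

Section PolynomialModule.
Context (K : fieldType) (p n : nat) (V : polyAlg K n).
Hypothesis two_neq0 : 2%:R != 0 :> K.
Local Notation kc := (pconst V).
Local Notation L := (lie_of (g_lie K p n)).
Variable la : K.

Definition polyK : lmodType K := resmod (pconst V) (V : comNzRingType)^o.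

Let one_neq0 : (1 : V) != 0 :> polyK.
Proof. exact: oner_neq0. Qed.

Let one_vec : {v : polyK | v != 0} := exist _ (1 : V) one_neq0.

Let rho_lin (x : L) : linear (rho p la (lval x) : polyK -> polyK).
Proof. by move=> c f h; apply: (rhoP p la (lval x) c f h). Qed.

Definition rho_end (x : L) : lend one_vec := mklend one_vec (rho_lin x).

Lemma rho_end_linear : linear rho_end.
Proof.
move=> c x y; apply: lendP => f.
by have := rho_mxP p la c (lval x) (lval y) (f : V); rewrite -lvalDZ.
Qed.

Lemma rho_end_lie x y :
  rho_end (lieb x y) = rho_end x * rho_end y - rho_end y * rho_end x.
Proof.
apply: lendP => f; have := rho_lie two_neq0 la (f : V) (lvalP x) (lvalP y).
by rewrite -lval_lieb => /esym.
Qed.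

Definition poly_module : lmodType (U L) := rep_of rho_end_linear rho_end_lie.

Lemma poly_module_genE (x : L) (f : poly_module) :
  ugen x *: f = (rho p la (lval x) (f : V) : V).
Proof. exact: rep_genE. Qed.

Lemma poly_module_algE (c : K) (f : poly_module) :
  (c%:A : U L) *: f = (kc c * (f : V) : V).
Proof. exact: rep_algE. Qed.

Lemma rho_Ymx i (f : V) : rho p la (Ymx K p i) f = pvar V i * f.
Proof.
have Y0 k l : Ymx K p i k l =
  ((k == ix i) && (l == ord0))%:R - ep K p i * ((k == ord_max) && (l == ix i))%:R.
  exact: YmxE.
rewrite rho.unlock !Y0 !ixE /= !mulr0 subr0 rmorph0 mul0r add0r.
rewrite [X in _ + X + _]big1 ?addr0 => [|j _]; last first.
  by rewrite big1 // => l _; rewrite Y0 !ixE andbF /= mulr0 subrr rmorph0 mul0r.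
rewrite [X in _ + X]big1 ?addr0 => [|j _]; last first.
  by rewrite Y0 !ixE /= mulr0 subrr rmorph0 mul0r.
rewrite (bigD1 i) //= big1 ?addr0 => [|j ji].
  by rewrite Y0 !eqxx !ixE /= mulr0 subr0 rmorph1 mul1r.
by rewrite Y0 !ixE (inj_eq (@ix_inj n)) (negbTE ji) /= mulr0 subrr rmorph0 mul0r.
Qed.

End PolynomialModule.

Section VermaModels.
Context (K : fieldType) (p m : nat).
Local Notation n := m.+1.
Local Notation W := {mpoly K[m]}.
Local Notation V := (iterated_polyAlg K m).
Hypothesis two_neq0 : 2%:R != 0 :> K.
Local Notation kc := (pconst V).
Local Notation gl := (lie_of (g_lie K p n)).
Local Notation gl' := (lie_of (g'_lie K p n)).
Local Notation pl := (lie_of (p_lie K p n)).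
Local Notation pl' := (lie_of (p'_lie K p n)).

Let basis0 : basis_vec K n 0 = delta_mx ord0 0.
Proof. by congr delta_mx; apply: val_inj; rewrite /= inordK. Qed.

Let mul_basis0 (X : 'M[K]_n.+2) k : (X *m basis_vec K n 0) k 0 = X k ord0.
Proof.
rewrite basis0 mxE (bigD1 ord0) //= big1 => [|l /negbTE hl].
  by rewrite mxE !eqxx mulr1 addr0.
by rewrite mxE hl mulr0.
Qed.

Lemma eig0E (X : 'M[K]_n.+2) : eig0 X = X ord0 ord0.
Proof.
by rewrite /eig0 mul_basis0; congr (X _ _); apply: val_inj; rewrite /= inordK.
Qed.

Lemma mem_p_entries (X : 'M[K]_n.+2) : X \in lsv (g_lie K p n) ->
  (X \in lsv (p_lie K p n)) <-> (forall i, X (ix i) ord0 = 0).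
Proof.
move=> gX; rewrite mem_p gX /=; split=> [/vlineP[c h] i|h].
  by rewrite -mul_basis0 h basis0 !mxE ixE mulr0.
apply/vlineP; exists (X ord0 ord0); apply/matrixP => k j.
rewrite ord1 mul_basis0 basis0 !mxE eqxx andbT.
case: (ixP k) => [|i|]; rewrite ?eqxx ?mulr1 //.
  by rewrite h ixE mulr0.
by rewrite (g_max0 two_neq0 gX) mulr0.
Qed.

Lemma Ymx_mulC i j :
  Ymx K p i *m Ymx K p j = Ymx K p j *m (Ymx K p i : 'M[K]_n.+2).
Proof.
have E (a b : 'I_n) : Ymx K p a *m Ymx K p b =
    - (ep K p a *: delta_mx ord_max ord0 *+ (a == b)) :> 'M[K]_n.+2.
  rewrite /Ymx mulmxBl !mulmxBr -!scalemxAr -!scalemxAl -?scalemxAr.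
  rewrite !mul_delta_mx_cond !ixE (inj_eq (@ix_inj n)) !mulr0n.
  by rewrite !scaler0 !subr0 sub0r scalerMnr.
by rewrite !E eq_sym; case: eqP => // ->.
Qed.

Lemma ugen_comm (S : lieSub K n.+2) (x y : lie_of S) :
  lval x *m lval y = lval y *m lval x -> ugen x * ugen y = ugen y * ugen x.
Proof.
move=> xy; apply/eqP; rewrite -subr_eq0 -ugen_lie; apply/eqP.
have -> : lieb x y = 0 by apply: lval_inj; rewrite lval_lieb xy subrr raddf0.
exact: raddf0.
Qed.

Section Ambient.
Variable la : K.
Local Notation Q := (poly_module p V two_neq0 la).
Local Notation M := (verma_g p n la).

Lemma Uincl_alg (S T : lieSub K n.+2) (sST : (S <= T)%VS) (c : K) :
  Uincl sST c%:A = c%:A.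
Proof. by rewrite /Uincl UliftZ rmorph1. Qed.

Lemma Cla_charZ c : Cla_char p n la c%:A = c.
Proof. by rewrite /Cla_char /= UliftZ rmorph1 [LHS]mulr1. Qed.

Lemma Cla_char_gen x : Cla_char p n la (ugen x) = la * lval x ord0 ord0.
Proof. by rewrite /Cla_char /= Ulift_gen /= eig0E. Qed.

Let frob (c : Cla p n la) : Q := (kc (c : K) : V).

Let frobB : zmod_morphism frob.
Proof. exact: (rmorphB kc). Qed.

Let frobZ b v : frob (b *: v) = Up_g K p n b *: frob v.
Proof.
suff lin : linear (frob : Cla p n la -> resmod (Up_g K p n) Q).
  have f0 : frob 0 = 0 by apply: (rmorph0 kc).
  by have := lin b v 0; rewrite f0 !addr0.
apply: U_linear => [|c w|x w]; first exact: frobB.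
  rewrite [RHS]resmodZ (_ : Up_g K p n c%:A = c%:A); last exact: Uincl_alg.
  rewrite poly_module_algE.
  rewrite [_ *: w]resmodZ Cla_charZ; exact: (rmorphM kc).
rewrite [RHS]resmodZ.
rewrite (_ : Up_g K p n (ugen x) = ugen (lincl (lieI_subl (g_lie K p n) _) x));
  last exact: Uincl_gen.
rewrite poly_module_genE lval_lincl.
rewrite [_ *: w]resmodZ Cla_char_gen /frob -[kc w]mulr1 rhoZ // rho1.
rewrite big1 ?addr0 => [|i _].
  have -> : (la * lval x ord0 ord0 *: (w : (K^o)^o)) = la * lval x ord0 ord0 * (w : K).
    by [].
  by rewrite -rmorphM /=; congr (kc _); ring.
have px := lvalP x; have gx : lval x \in lsv (g_lie K p n).
  by move: px; rewrite mem_p => /andP[].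
by rewrite ((mem_p_entries gx).1 px) rmorph0 mul0r.
Qed.

Definition verma_to_poly : M -> Q := tensor_lift frob.

Lemma verma_to_poly_linear : linear verma_to_poly.
Proof. exact: tensor_lift_is_linear. Qed.

Local Notation Y := (fun i => ugen (Yg K p i) : U gl).

Let Y_comm i j : Y i * Y j = Y j * Y i.
Proof. by apply: ugen_comm; apply: Ymx_mulC. Qed.

Definition verma_vec : M := tens (Up_g K p n) 1 ((1 : K) : Cla p n la).

(** The inverse of [verma_to_poly]: evaluation at the lowering operators, applied
    to the highest weight vector. *)
Definition verma_of_poly (f : V) : M := ev_iter Y f *: verma_vec.

Lemma verma_of_polyB : zmod_morphism verma_of_poly.
Proof. by move=> f h; rewrite /verma_of_poly raddfB scalerBl. Qed.

Lemma verma_of_polyX i f :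
  verma_of_poly (pvar V i * f) = ugen (Yg K p i) *: verma_of_poly f.
Proof. by rewrite /verma_of_poly (ev_iterX Y_comm) scalerA. Qed.

Let verma_to_polyZ u z : verma_to_poly (u *: z) = u *: verma_to_poly z.
Proof. exact: (scalable_linear verma_to_poly_linear). Qed.

Lemma verma_of_polyK : cancel verma_of_poly verma_to_poly.
Proof.
move=> f; rewrite /verma_of_poly verma_to_polyZ /verma_vec.
have -> : verma_to_poly verma_vec = (1 : V).
  apply: etrans (tensor_lift_tens frobB frobZ _ _) _.
  apply: (etrans (scale1r _)). exact: (rmorph1 kc).
elim/(@pvar_ind _ _ V) : f => [|f h hf hh|c f hf|i f hf].
- by rewrite ev_iter1 scale1r.
- by rewrite raddfD scalerDl hf hh.
- rewrite ev_iterZ -mulr_algl -scalerA hf. exact: (@poly_module_algE _ _ _ _ two_neq0 la c (f : Q)).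
- rewrite (ev_iterX Y_comm) -scalerA hf poly_module_genE; exact: rho_Ymx.
Qed.

Lemma verma_of_poly_surj z : exists f, z = verma_of_poly f.
Proof.
have ofD f h : verma_of_poly f + verma_of_poly h = verma_of_poly (f + h).
  by rewrite /verma_of_poly raddfD scalerDl.
suff : @induced_span _ _ _ (Up_g K p n) (Cla p n la) n (@Yg K p n) z.
  elim=> {z} [v|_ _ _ [f ->] _ [h ->]|i _ _ [f ->]].
  - exists (kc (v : K)); rewrite /verma_of_poly -[kc v]mulr1 ev_iterZ ev_iter1.
    have -> : (v : K)%:A = Up_g K p n (v : K)%:A by rewrite [RHS]Uincl_alg.
    rewrite /verma_vec tensZ mulr1 -[Up_g _ _ _ _]mul1r tensM; congr tens.
    rewrite [RHS]resmodZ Cla_charZ; exact/esym/mulr1.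
  - by exists (f + h); rewrite ofD.
  - by exists (pvar V i * f); rewrite verma_of_polyX.
apply: induced_spanP => [c|x]; first exact: Uincl_alg.
pose xn := \sum_i lval x (ix i) ord0 *: Yg K p i.
have xnE : lval xn = \sum_i lval x (ix i) ord0 *: Ymx K p i.
  rewrite /xn raddf_sum; apply: eq_bigr => i _.
  have lval0 : lval (0 : gl) = 0 by exact: raddf0.
  by have := lvalDZ (lval x (ix i) ord0) (Yg K p i) 0; rewrite lval0 !addr0.
have gx := lvalP x.
have xp : lval x - lval xn \in lsv (p_lie K p n).
  apply/mem_p_entries => [|i]; first by apply: rpredB => //; apply: lvalP.
  rewrite mxE [X in _ + X]mxE xnE summxE (bigD1 i) //= big1 => [|j ji].
    by rewrite addr0 mxE YmxE !eqxx !ixE /= mulr0 subr0 mulr1 subrr.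
  rewrite mxE YmxE !ixE (inj_eq (@ix_inj n)) eq_sym (negbTE ji) /=.
  by rewrite mulr0 subrr mulr0.
exists (ugen (lmk xp)), (fun i => lval x (ix i) ord0).
have -> : Up_g K p n (ugen (lmk xp)) = ugen (x - xn).
  rewrite [LHS]Uincl_gen; congr ugen; apply: lval_inj.
  by rewrite lval_lincl raddfB.
rewrite raddfB /= -[LHS](subrK (ugen xn)); congr (_ + _).
rewrite {1}/xn raddf_sum; apply: eq_bigr => i _.
have := ugen_linear (lval x (ix i) ord0) (Yg K p i) 0.
by rewrite [ugen 0]raddf0 !addr0.
Qed.

Lemma verma_to_polyK : cancel verma_to_poly verma_of_poly.
Proof. by move=> z; have [f ->] := verma_of_poly_surj z; rewrite verma_of_polyK. Qed.

Lemma verma_of_poly_gen (x : gl) f :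
  ugen x *: verma_of_poly f = verma_of_poly (rho p la (lval x) f).
Proof.
rewrite -[LHS]verma_to_polyK; congr verma_of_poly.
rewrite verma_to_polyZ verma_of_polyK.
exact: (@poly_module_genE _ _ _ _ two_neq0 la x (f : Q)).
Qed.

Lemma verma_of_polyZ (c : K) f :
  (c%:A : U gl) *: verma_of_poly f = verma_of_poly (kc c * f).
Proof. by rewrite /verma_of_poly ev_iterZ -[c *: ev_iter _ _]mulr_algl scalerA. Qed.

End Ambient.

Section Restricted.
Variable mu : K.
Local Notation Q := (poly_module p V two_neq0 mu).
Local Notation M := (verma_g' p n mu).

Let Ymx_g' (j : 'I_m) : Ymx K p (lift ord_max j) \in lsv (g'_lie K p n).
Proof.
rewrite mem_g' Ymx_g; apply/eqP/matrixP => k l; rewrite ord1 mxE [RHS]mxE.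
apply: big1 => t _; rewrite YmxE [basis_vec _ _ _ _ _]mxE eqxx andbT.
have [->|_] := eqVneq t (inord n); last by rewrite mulr0.
have -> : inord n = ix (ord_max : 'I_n) by apply: val_inj; rewrite /= inordK.
rewrite ixE andbF (inj_eq (@ix_inj n)) (negbTE (neq_lift _ _)) andbF.
by rewrite mulr0 subrr mul0r.
Qed.

Definition Yg' (j : 'I_m) : gl' := lmk (Ymx_g' j).

Let Y'_comm (i j : 'I_m) : ugen (Yg' i) * ugen (Yg' j) = ugen (Yg' j) * ugen (Yg' i).
Proof. by apply: ugen_comm; apply: Ymx_mulC. Qed.

Let frob (c : Cla' p n mu) : resmod (Ug'_g K p n) Q := (kc (c : K) : V).

Let frobB : zmod_morphism frob.
Proof. exact: (rmorphB kc). Qed.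

Let p'_entries (x : pl') : lval x \in lsv (g_lie K p n) /\
  forall i, lval x (ix i) ord0 = 0.
Proof.
have := lvalP x; rewrite mem_p' => /andP[px _].
have gx : lval x \in lsv (g_lie K p n) by move: px; rewrite mem_p => /andP[].
by split=> //; apply: (mem_p_entries gx).1.
Qed.

Let Cla'E (u : Up' K p n) (w : Cla' p n mu) :
  u *: w = (Cla_char p n mu (Up'_p K p n u) * (w : K) : K).
Proof. by []. Qed.

Let frobZ b v : frob (b *: v) = Up'_g' K p n b *: frob v.
Proof.
suff lin : linear (frob : Cla' p n mu ->
    resmod (Up'_g' K p n) (resmod (Ug'_g K p n) Q)).
  have f0 : frob 0 = 0 by apply: (rmorph0 kc).
  by have := lin b v 0; rewrite f0 !addr0.
apply: U_linear => [|c w|x w]; first exact: frobB.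
  rewrite [RHS]resmodZ (_ : Up'_g' K p n c%:A = c%:A); last exact: Uincl_alg.
  rewrite [RHS]resmodZ (_ : Ug'_g K p n c%:A = c%:A); last exact: Uincl_alg.
  apply: etrans (esym (@poly_module_algE _ _ _ _ two_neq0 mu c (frob w : Q))).
  rewrite Cla'E (_ : Up'_p K p n c%:A = c%:A); last exact: Uincl_alg.
  by rewrite Cla_charZ; exact: (rmorphM kc).
rewrite [RHS]resmodZ (_ : Up'_g' K p n (ugen x) =
  ugen (lincl (lieI_subr (p_lie K p n) _) x)); last exact: Uincl_gen.
rewrite [RHS]resmodZ (_ : Ug'_g K p n (ugen _) =
  ugen (lincl (lieI_subl (g_lie K p n) _) (lincl (lieI_subr (p_lie K p n) _) x)));
  last exact: Uincl_gen.
apply: etrans (esym (@poly_module_genE _ _ _ _ two_neq0 mu _ (frob w : Q))).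
rewrite !lval_lincl Cla'E (_ : Up'_p K p n (ugen x) =
  ugen (lincl (lieI_subl (p_lie K p n) _) x)); last exact: Uincl_gen.
rewrite Cla_char_gen lval_lincl /frob -[kc w]mulr1 rhoZ // rho1.
have [_ x0] := p'_entries x.
rewrite big1 ?addr0 => [|i _]; last by rewrite x0 rmorph0 mul0r.
by rewrite -rmorphM /=; congr (kc _); ring.
Qed.

Let to_poly : M -> resmod (Ug'_g K p n) Q := tensor_lift frob.

Let to_polyZ u z : to_poly (u *: z) = u *: to_poly z.
Proof. exact: (scalable_linear (tensor_lift_is_linear frobB frobZ)). Qed.

Let vec : M := tens (Up'_g' K p n) 1 ((1 : K) : Cla' p n mu).

Definition verma'_of_poly (f : W) : M := ev_comm (fun j => ugen (Yg' j)) f *: vec.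

Lemma verma'_of_polyD f h :
  verma'_of_poly (f + h) = verma'_of_poly f + verma'_of_poly h.
Proof. by rewrite /verma'_of_poly raddfD scalerDl. Qed.

Lemma verma'_of_polyX i f :
  verma'_of_poly ('X_i * f) = ugen (Yg' i) *: verma'_of_poly f.
Proof. by rewrite /verma'_of_poly (ev_commX Y'_comm) scalerA. Qed.

Lemma verma'_of_polyZ (c : K) f :
  (c%:A : U gl') *: verma'_of_poly f = verma'_of_poly (c%:MP * f).
Proof. by rewrite /verma'_of_poly ev_commZ -[c *: ev_comm _ _]mulr_algl scalerA. Qed.

Let to_polyD z w : to_poly (z + w) = to_poly z + to_poly w.
Proof.
have := tensor_lift_is_linear frobB frobZ 1 z w.
by rewrite [1 *: z]scale1r [1 *: tensor_lift _ _]scale1r.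
Qed.

Let to_poly_gen (x : gl') z (f : V) : to_poly z = f ->
  to_poly (ugen x *: z) = rho p mu (lval x) f.
Proof.
move=> zf; rewrite to_polyZ zf [LHS]resmodZ (_ : Ug'_g K p n (ugen x) =
  ugen (lincl (lieI_subl (g_lie K p n) _) x)); last exact: Uincl_gen.
apply: etrans (@poly_module_genE _ _ _ _ two_neq0 mu _ (f : Q)) _.
by rewrite lval_lincl.
Qed.

Let to_poly_of f : to_poly (verma'_of_poly f) = (f%:P : V).
Proof.
elim/mpoly_var_ind: f => [|f h hf hh|c f hf|i f hf].
- rewrite /verma'_of_poly ev_comm1 scale1r.
  apply: etrans (tensor_lift_tens frobB frobZ _ _) _.
  by apply: (etrans (scale1r _)); exact: (rmorph1 kc).
- rewrite verma'_of_polyD; apply: etrans (to_polyD _ _) _.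
  apply: etrans (congr2 (fun a b : V => a + b) hf hh) _.
  exact: (esym (polyCD f h)).
- rewrite -verma'_of_polyZ to_polyZ hf.
  rewrite [LHS]resmodZ (_ : Ug'_g K p n c%:A = c%:A); last exact: Uincl_alg.
  apply: etrans (@poly_module_algE _ _ _ _ two_neq0 mu c (f%:P : Q)) _.
  by rewrite polyCM.
- rewrite verma'_of_polyX (to_poly_gen _ hf).
  by rewrite [LHS](@rho_Ymx K p n V) polyCM -iter_var_lift.
Qed.

(** The Verma module for so(n + 1) maps to the polynomial module for so(n + 2) of
    the same weight, restricted to so(n + 1); there the monomials in the lowering
    operators are visibly independent. *)
Lemma verma'_of_poly_inj : injective verma'_of_poly.
Proof. by move=> f h e; apply: polyC_inj; rewrite -!to_poly_of e. Qed.

Lemma verma'_of_poly_surj z : exists f, z = verma'_of_poly f.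
Proof.
suff : @induced_span _ _ _ (Up'_g' K p n) (Cla' p n mu) m Yg' z.
  elim=> {z} [v|_ _ _ [f ->] _ [h ->]|i _ _ [f ->]].
  - exists (v : K)%:MP; rewrite -[_%:MP]mulr1 -verma'_of_polyZ.
    rewrite /verma'_of_poly ev_comm1 scale1r.
    have -> : (v : K)%:A = Up'_g' K p n (v : K)%:A by rewrite [RHS]Uincl_alg.
    rewrite /vec tensZ mulr1 -[Up'_g' _ _ _ _]mul1r tensM; congr tens.
    rewrite Cla'E (_ : Up'_p K p n _ = (v : K)%:A); last exact: Uincl_alg.
    by rewrite Cla_charZ; exact/esym/mulr1.
  - by exists (f + h); rewrite verma'_of_polyD.
  - by exists ('X_i * f); rewrite verma'_of_polyX.
apply: induced_spanP => [c|x]; first exact: Uincl_alg.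
pose xn := \sum_j lval x (ix (lift ord_max j)) ord0 *: Yg' j.
have xnE : lval xn =
    \sum_j lval x (ix (lift ord_max j)) ord0 *: Ymx K p (lift ord_max j).
  rewrite /xn raddf_sum; apply: eq_bigr => j _.
  have lval0 : lval (0 : gl') = 0 by exact: raddf0.
  have := lvalDZ (lval x (ix (lift ord_max j)) ord0) (Yg' j) 0.
  by rewrite lval0 !addr0.
have [gx x0 _ _ _] := g'_entries (lvalP x).
have gxn : lval xn \in lsv (g'_lie K p n) by apply: lvalP.
have xp : lval x - lval xn \in lsv (p'_lie K p n).
  rewrite mem_p'; apply/andP; split; last by apply: rpredB => //; apply: lvalP.
  apply/mem_p_entries => [|i].
    by apply: rpredB => //; move: gxn; rewrite mem_g' => /andP[].
  rewrite mxE [X in _ + X]mxE xnE summxE.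
  case: (unliftP ord_max i) => [i'|] ->; last first.
    rewrite x0 big1 ?subr0 // => j _.
    by rewrite mxE YmxE !ixE (inj_eq (@ix_inj n)) (negbTE (neq_lift _ _)) /= mulr0 subrr mulr0.
  rewrite (bigD1 i') //= big1 => [|j ji].
    by rewrite addr0 mxE YmxE !eqxx !ixE /= mulr0 subr0 mulr1 subrr.
  rewrite mxE YmxE !ixE (inj_eq (@ix_inj n)) (inj_eq lift_inj) eq_sym (negbTE ji) /=.
  by rewrite mulr0 subrr mulr0.
exists (ugen (lmk xp)), (fun j => lval x (ix (lift ord_max j)) ord0).
have -> : Up'_g' K p n (ugen (lmk xp)) = ugen (x - xn).
  rewrite [LHS]Uincl_gen; congr ugen; apply: lval_inj.
  by rewrite lval_lincl raddfB.
rewrite raddfB /= -[LHS](subrK (ugen xn)); congr (_ + _).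
rewrite {1}/xn raddf_sum; apply: eq_bigr => j _.
have := ugen_linear (lval x (ix (lift ord_max j)) ord0) (Yg' j) 0.
by rewrite [ugen 0]raddf0 !addr0.
Qed.

(** The subalgebra so(n + 1) preserves the polynomials without the last variable,
    see [verma'_of_poly_gen_rho'], so that the constant coefficient is the whole
    value. *)
Definition rho' (X : 'M[K]_n.+2) (f : W) : W := (rho p mu X (f%:P : V) : {poly W})`_0.

Lemma verma'_of_poly_gen_rho' (x : gl') f :
  ugen x *: verma'_of_poly f = verma'_of_poly (rho' (lval x) f)
  /\ rho p mu (lval x) (f%:P : V) = (rho' (lval x) f)%:P.
Proof.
have [h e] := verma'_of_poly_surj (ugen x *: verma'_of_poly f).
have E : rho p mu (lval x) (f%:P : V) = h%:P.
  have E := to_poly_gen x (to_poly_of f).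
  exact: (etrans (esym E) (etrans (congr1 to_poly e) (to_poly_of h))).
have rE : rho' (lval x) f = h by rewrite /rho' E coefC.
by rewrite rE; split.
Qed.

End Restricted.

End VermaModels.

(** * The restriction in a basis of singular and linked vectors *)

(** A family of polynomials u b, monic of degree b, is a basis over the
    coefficients. *)
Section UnitriangularBasis.
Context (R : comNzRingType) (u : nat -> {poly R}).
Hypothesis u_size : forall b, (size (u b) <= b.+1)%N.
Hypothesis u_lead : forall b, (u b)`_b = 1.
Implicit Types f g : {poly R}.

Definition basis_sum f : {poly R} := \sum_(b < size f) (f`_b)%:P * u b.

Lemma basis_sumE f N : (size f <= N)%N ->
  basis_sum f = \sum_(b < N) (f`_b)%:P * u b.
Proof.
move=> fN; rewrite /basis_sum (big_ord_widen N (fun b => (f`_b)%:P * u b) fN).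
rewrite big_mkcond /=; apply: eq_bigr => b _; case: ltnP => // fb.
by rewrite nth_default // polyC0 mul0r.
Qed.

Lemma basis_sum_is_zmod_morphism : zmod_morphism basis_sum.
Proof.
move=> f g; pose N := maxn (size (f - g)) (maxn (size f) (size g)).
rewrite !(@basis_sumE _ N) ?leq_max ?leqnn ?orbT // -sumrB.
by apply: eq_bigr => b _; rewrite coefB polyCB mulrBl.
Qed.
HB.instance Definition _ :=
  GRing.isZmodMorphism.Build {poly R} {poly R} basis_sum basis_sum_is_zmod_morphism.

Lemma basis_sumD f g : basis_sum (f + g) = basis_sum f + basis_sum g.
Proof. exact: raddfD. Qed.

Lemma basis_sumZ a f : basis_sum (a *: f) = a%:P * basis_sum f.
Proof.
rewrite (@basis_sumE _ (size f)) ?size_scale_leq // mulr_sumr.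
by apply: eq_bigr => b _; rewrite coefZ polyCM mulrA.
Qed.

Lemma basis_sumXn b : basis_sum 'X^b = u b.
Proof.
rewrite /basis_sum size_polyXn big_ord_recr /= coefXn eqxx mul1r.
rewrite big1 ?add0r // => l _; rewrite coefXn ltn_eqF ?mul0r //=.
Qed.

Lemma basis_sum_inj : injective basis_sum.
Proof.
move=> f g /eqP; rewrite -subr_eq0 -raddfB => /eqP h; apply/eqP.
rewrite -subr_eq0 -size_poly_eq0; move: (f - g) h => {g}f h.
case sf: (size f) => [//|d]; have : lead_coef f != 0.
  by rewrite lead_coef_eq0 -size_poly_eq0 sf.
have := congr1 (fun p : {poly R} => p`_d) h.
rewrite coef0 /basis_sum coef_sum lead_coefE sf big_ord_recr /= coefCM u_lead mulr1.
rewrite big1 ?add0r => [->|b _]; first by rewrite eqxx.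
rewrite coefCM [(u b)`_d]nth_default ?mulr0 //.
by apply: (leq_trans (u_size b)); apply: ltn_ord.
Qed.

Lemma basis_sum_surj p : exists f, basis_sum f = p.
Proof.
have [s] := ubnP (size p); elim: s p => // s IHs p ps.
case sp: (size p) => [|d].
  by exists 0; move/eqP: sp; rewrite size_poly_eq0 => /eqP ->; rewrite raddf0.
have [|f fE] := IHs (p - (p`_d)%:P * u d).
  apply: (@leq_ltn_trans d); last by rewrite -ltnS -sp.
  apply/leq_sizeP => j dj; rewrite coefB coefCM.
  move: dj; rewrite leq_eqVlt => /predU1P[<-|dj].
    by rewrite u_lead mulr1 subrr.
  rewrite [p`_j]nth_default ?sp // [(u d)`_j]nth_default ?mulr0 ?subrr //.
  exact: leq_trans (u_size d) _.
exists (f + (p`_d) *: 'X^d).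
by rewrite basis_sumD basis_sumZ basis_sumXn fE subrK.
Qed.

End UnitriangularBasis.

Section BranchingBasis.
Context (K : fieldType) (p m : nat).
Local Notation n := m.+1.
Local Notation W := {mpoly K[m]}.
Local Notation V := (iterated_polyAlg K m).
Hypothesis char0 : forall k, k.+1%:R != 0 :> K.
Local Notation kc := (pconst V).
Local Notation ep := (ep K p (n := n)).
Local Notation top := (ord_max : 'I_n).
Context (la : K) (J : nat).
Hypothesis laJ : 2%:R * la + m%:R = J%:R.
Let two_neq0 : 2%:R != 0 :> K := char0 1.

Definition rsqW : W := \sum_(j : 'I_m) (ep (lift top j))%:MP * ('X_j * 'X_j).

Lemma rsqE : rsq p V = rsqW%:P.
Proof.
rewrite /rsq big_mkcond /= (bigD1_ord top) //= eqxx add0r rmorph_sum /=.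
apply: eq_bigr => j _; rewrite eq_sym neq_lift !polyCM; congr (_ * (_ * _));
  exact: iter_var_lift.
Qed.

Lemma radial_polyE b c : radial_poly p V b c =
  \sum_(l < (b./2).+1) (((c l)%:MP * rsqW ^+ l) *: 'X^(b - l.*2)) :> {poly W}.
Proof.
apply: eq_bigr => l _; rewrite /radial rsqE -mul_polyC polyCM polyC_exp -mulrA.
by congr (_ * (_ * _ ^+ _)); apply: iter_var_max.
Qed.

Lemma radial_poly_size b c : (size (radial_poly p V b c : {poly W}) <= b.+1)%N.
Proof.
apply/leq_sizeP => e be; rewrite radial_polyE coef_sum big1 // => l _.
rewrite coefZ coefXn gtn_eqF ?mulr0 //.
by rewrite (leq_trans _ be) // ltnS leq_subr.
Qed.

Lemma radial_poly_lead b c : c 0 = 1 -> (radial_poly p V b c : {poly W})`_b = 1.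
Proof.
move=> c0; rewrite radial_polyE coef_sum big_ord_recl /= subn0 coefZ coefXn eqxx.
rewrite c0 mpolyC1 expr0 !mulr1 big1 ?addr0 // => l _.
rewrite coefZ coefXn gtn_eqF ?mulr0 //.
by have := ltn_ord l; rewrite /bump; lia.
Qed.

(** In these degrees no singular vector is monic in the last variable: with
    J = 2k they are b = 2k - a for a < k. *)
Definition linked b := ~~ odd J && (J./2 < b <= J)%N.

(** The generators of the decomposition. A linked degree b = J - a is written as
    a + 2 (i + 1) with i = b - J/2 - 1. *)
Definition branch_vec b : V :=
  if linked b then linked_poly p V la (J - b) (b - J./2).-1
  else singular_poly p V la b.

Lemma branch_vec_size b : (size (branch_vec b : {poly W}) <= b.+1)%N.
Proof.
rewrite /branch_vec; case: ifP => h; last exact: radial_poly_size.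
have e : (J - b + (b - J./2).-1.+1.*2 = b)%N by move: h; rewrite /linked; lia.
by rewrite /linked_poly e; apply: radial_poly_size.
Qed.

Lemma branch_vec_lead b : (branch_vec b : {poly W})`_b = 1.
Proof.
rewrite /branch_vec; case: ifP => h; last exact: radial_poly_lead.
have e : (J - b + (b - J./2).-1.+1.*2 = b)%N by move: h; rewrite /linked; lia.
by rewrite /linked_poly e; apply: radial_poly_lead.
Qed.

Lemma branch_vec_rotation_invariant b : rotation_invariant p (branch_vec b).
Proof.
by rewrite /branch_vec; case: ifP => _; apply: radial_poly_rotation_invariant.
Qed.

Lemma eul_branch_vec b : eul (branch_vec b) = kc b%:R * branch_vec b.
Proof.
rewrite /branch_vec; case: ifP => h; last exact: eul_radial_poly.
have e : (J - b + (b - J./2).-1.+1.*2 = b)%N by move: h; rewrite /linked; lia.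
by rewrite /linked_poly e; apply: eul_radial_poly.
Qed.

(** The component along the singular vector of degree c of X applied to the
    linked vector of degree J - c. *)
Definition link_term (X : 'M[K]_n.+2) c : W :=
  (obstruction p m la c (J./2 - c).-1)%:MP
  * (\sum_j (X ord0 (ix (lift top j)) * ep (lift top j))%:MP * 'X_j)
  * rsqW ^+ (J./2 - c).-1.

Lemma kop_branch_vec (X : 'M[K]_n.+2) b : X ord0 (ix top) = 0 ->
  \sum_j kc (X ord0 (ix j)) * kop p la j (branch_vec b) =
  if linked b then (link_term X (J - b))%:P * branch_vec (J - b) else 0 :> V.
Proof.
move=> X0; have := erefl (branch_vec b); rewrite {2}/branch_vec.
case: ifP => lb bE.
  have nl : linked (J - b) = false by move: lb; rewrite /linked; lia.
  rewrite {2}/branch_vec nl /link_term.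
  have iE : (J./2 - (J - b)).-1 = (b - J./2).-1 by move: lb; rewrite /linked; lia.
  rewrite iE; set a := (J - b)%N; set i := (b - J./2).-1.
  have aiJ : J = (a + i.+1).*2 by move: lb; rewrite /linked /a /i; lia.
  rewrite !polyCM polyC_exp -rsqE [(\sum_j _)%:P]rmorph_sum /=.
  rewrite (bigD1_ord top) //= X0 rmorph0 mul0r add0r bE.
  transitivity (\sum_(j < m) kc (X ord0 (ix (lift top j)))
      * (kc (obstruction p m la a i) * (kc (ep (lift top j)) * pvar V (lift top j)
         * rsq p V ^+ i) * singular_poly p V la a)).
    apply: eq_bigr => j _; congr (_ * _).
    by rewrite (kop_linked_poly p V char0 laJ aiJ) ?mulrA // eq_sym neq_lift.
  move: (singular_poly p V la a) (rsq p V ^+ i) => S r.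
  rewrite mulr_sumr !mulr_suml; apply: eq_bigr => j _.
  have -> : ((X ord0 (ix (lift top j)) * ep (lift top j))%:MP * 'X_j)%:P =
      kc (X ord0 (ix (lift top j))) * kc (ep (lift top j)) * pvar V (lift top j).
    by rewrite polyCM mpolyCM polyCM -iter_var_lift.
  by rewrite -[((_)%:MP)%:P]/(kc _); ring.
rewrite big1 // => j _; have [->|jt] := eqVneq j top; first by rewrite X0 rmorph0 mul0r.
rewrite bE (kop_singular_poly p V char0 laJ) ?mulr0 // => l lb2.
by move: lb; rewrite /linked /resonant; lia.
Qed.

Local Notation gl' := (lie_of (g'_lie K p n)).
Local Notation T := (basis_sum (branch_vec : nat -> {poly W})).

Lemma rho'D mu X (f h : W) : rho' p mu X (f + h) = rho' p mu X f + rho' p mu X h.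
Proof. by rewrite /rho' polyCD rhoD coefD. Qed.

Lemma rho'0 mu X : rho' p mu X (0 : W) = 0.
Proof. by rewrite /rho' polyC0 rho0 coef0. Qed.

Let rho_branch_vec (x : gl') (a : W) b :
  rho p la (lval x) (a%:P * branch_vec b : V) =
  (rho' p (la - b%:R) (lval x) a)%:P * branch_vec b
  + (if linked b then (a * link_term (lval x) (J - b))%:P * branch_vec (J - b)
     else 0).
Proof.
have [_ _ b0 _ _] := g'_entries (lvalP x).
rewrite (@rhoM K p m V two_neq0 la b%:R (lval x) a%:P _ (lvalP x) (iter_der_max_polyC a)
  (branch_vec_rotation_invariant b) (eul_branch_vec b)).
rewrite (verma'_of_poly_gen_rho' two_neq0 (la - b%:R) x a).2.
congr (_ + _); apply: etrans (congr1 (fun f => a%:P * f) (kop_branch_vec b b0)) _.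
move: (linked b) (link_term (lval x) (J - b)) (branch_vec (J - b)) => l w u.
case: l; last exact: (@mulr0 V).
exact: (etrans (@mulrA V _ _ u) (congr1 (fun f : V => f * u) (esym (polyCM a w)))).
Qed.

(** The action of so(n + 1) in the coordinates given by [branch_vec]. *)
Definition branch_coef X (f : {poly W}) c : W :=
  rho' p (la - c%:R) X f`_c
  + (if ~~ odd J && (c < J./2)%N then f`_(J - c) * link_term X c else 0).

Lemma rho_basis_sum (x : gl') (f : {poly W}) : exists g : {poly W},
  (forall c, g`_c = branch_coef (lval x) f c) /\ rho p la (lval x) (T f : V) = T g.
Proof.
pose P f := exists g : {poly W},
  (forall c, g`_c = branch_coef (lval x) f c) /\ rho p la (lval x) (T f : V) = T g.
have PD f1 f2 : P f1 -> P f2 -> P (f1 + f2).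
  move=> [g1 [c1 e1]] [g2 [c2 e2]]; exists (g1 + g2); split=> [c|].
    rewrite coefD c1 c2 /branch_coef !coefD rho'D.
    by case: ifP => _; rewrite ?mulrDl ?addr0 // addrACA.
  by rewrite !basis_sumD rhoD e1 e2.
have P0 : P 0.
  exists 0; split=> [c|]; last by rewrite raddf0 rho0.
  by rewrite /branch_coef !coef0 rho'0 mul0r if_same addr0.
have PX a b : P (a *: 'X^b).
  exists (rho' p (la - b%:R) (lval x) a *: 'X^b +
    (if linked b then (a * link_term (lval x) (J - b)) *: 'X^(J - b) else 0)).
  split=> [c|]; last first.
    rewrite basis_sumZ basis_sumXn (rho_branch_vec x a b) basis_sumD basis_sumZ.
    rewrite basis_sumXn; congr (_ + _).
    by case: ifP => _; rewrite ?raddf0 // basis_sumZ basis_sumXn.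
  rewrite /branch_coef coefD !coefZ !coefXn; congr (_ + _).
    by have [->|_] := eqVneq c b; rewrite ?mulr1 ?mulr0 ?rho'0.
  rewrite (fun_if (fun q : {poly W} => q`_c)) coef0 coefZ coefXn /linked.
  have [oJ|eJ] := boolP (odd J); first by rewrite /=.
  have [eb|nb] := eqVneq (J - c)%N b; rewrite ?mulr0 ?mul0r ?mulr1.
    have -> : (J./2 < b <= J)%N = (c < J./2)%N by lia.
    case: ltnP => // cJ; rewrite (_ : J - b = c)%N ?eqxx ?mulr1 //; last by lia.
  case: ifP => lb; last by rewrite if_same.
  rewrite (_ : (c == J - b)%N = false) ?mulr0 ?if_same //.
  by apply/eqP => cE; move/eqP: nb; apply; lia.
suff: P f by [].
rewrite -[f]coefK poly_def; elim/big_rec: _ => // i h _; exact: PD.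
Qed.

End BranchingBasis.

(** * The linked pairs do not split *)

Section NonSplitting.
Context (K : fieldType) (p m : nat).
Local Notation n := m.+1.
Context (V : polyAlg K n).
Hypothesis char0 : forall k, k.+1%:R != 0 :> K.
Local Notation kc := (pconst V).
Local Notation xv := (@pvar K n V).
Local Notation dv := (@pder K n V).
Local Notation ep := (ep K p (n := n)).
Local Notation top := (ord_max : 'I_n).
Implicit Types (f h : V) (i j : 'I_n).

Let two_neq0 : 2%:R != 0 :> K := char0 1.

Lemma pderC i j f : dv i (dv j f) = dv j (dv i f).
Proof.
elim/(@pvar_ind _ _ V) : f => [|f h hf hh|c f hf|l f hf].
- by rewrite !dv1 !dv0.
- by rewrite !pderD hf hh.
- by rewrite !dvZ hf.
- have d0 (b : bool) u g : dv u (b%:R * g) = b%:R * dv u g.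
    by rewrite -(rmorph_nat kc) dvZ.
  by rewrite !dv_x !pderD !d0 !dv_x hf; ring.
Qed.

Lemma eul_pder j f : eul (dv j f) = dv j (eul f) - dv j f.
Proof.
rewrite /eul dv_sum -[X in _ - X](sum_delta j (fun i => dv i f)) -sumrB.
apply: eq_bigr => i _; rewrite dv_x pderC.
by case: eqVneq => [->|_]; rewrite /= ?mul1r ?mul0r; ring.
Qed.

Lemma eulD f h : eul (f + h) = eul f + eul h.
Proof. by have := eulP 1 f h; rewrite rmorph1 !mul1r. Qed.

Lemma eul_sum (I : finType) (F : I -> V) : eul (\sum_i F i) = \sum_i eul (F i).
Proof. exact: (big_morph _ eulD (@eul0 _ _ V)). Qed.

Lemma eul_pder_eigen j d f : eul f = kc d * f ->
  eul (dv j f) = kc (d - 1) * dv j f.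
Proof. by move=> fd; rewrite eul_pder fd dvZ; ring. Qed.

Lemma eul_lap_eigen d f : eul f = kc d * f ->
  eul (lap p f) = kc (d - 2%:R) * lap p f.
Proof.
move=> fd; rewrite /lap eul_sum mulr_sumr; apply: eq_bigr => i _.
rewrite eul_scale (eul_pder_eigen i (eul_pder_eigen i fd)).
by rewrite (_ : d - 1 - 1 = d - 2%:R); ring.
Qed.

Lemma divergence d f : dv top f = 0 -> eul f = kc d * f ->
  \sum_(j | j != top) dv j (xv j * f) = kc (m%:R + d) * f.
Proof.
move=> f0 fd; under eq_bigr do rewrite dv_x eqxx mul1r.
rewrite big_split /= sumr_const cardC1 card_ord /= -mulr_natl.
have -> : \sum_(j | j != top) xv j * dv j f = eul f.
  by rewrite /eul [RHS](bigD1 top) //= f0 mulr0 add0r.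
by rewrite fd; ring.
Qed.

(** Taking divergences in the equations of a splitting h kills its Laplacian
    exactly at the resonant weight, so that only the obstruction is left. *)
Lemma splitting_obstruction mu kappa e h :
  2%:R * mu + m%:R = (e.+1.*2)%:R -> dv top h = 0 ->
  eul h = kc (e.+1.*2)%:R * h ->
  (forall j, j != top -> kop p mu j h =
     - (kc kappa * (kc (ep j) * xv j * rsq p V ^+ e))) ->
  kc (kappa * (m + e.*2)%:R) * rsq p V ^+ e = 0.
Proof.
move=> muE h0 hd hK; set d : K := (e.+1.*2)%:R in muE hd.
have r0 : dv top (rsq p V ^+ e) = 0 by rewrite dvX dv_rsq eqxx !mulr0.
have D0 : dv top (lap p h) = 0.
  rewrite /lap dv_sum big1 // => i _.
  by rewrite dvZ pderC [dv top (dv i h)]pderC h0 !dv0 mulr0.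
have lapE : lap p h = \sum_(j | j != top) kc (ep j) * dv j (dv j h).
  by rewrite /lap (bigD1 top) //= h0 dv0 mulr0 add0r.
have er : eul (rsq p V ^+ e) = kc (e%:R * 2%:R) * rsq p V ^+ e.
  exact: eulX (eul_rsq p V).
have eq_j j : j != top ->
    kc (mu - d + 1) * (kc (ep j) * dv j (dv j h))
      + kc 2%:R^-1 * dv j (xv j * lap p h)
    = - (kc kappa * dv j (xv j * rsq p V ^+ e)).
  move=> jt; have := congr1 (fun f => kc (ep j) * dv j f) (hK j jt).
  rewrite /kop (eul_pder_eigen j hd) => e1.
  have e2 := kc_ep_sqr p V j.
  have dN f : dv j (- f) = - dv j f.
    by rewrite -mulN1r -(rmorphN1 kc) dvZ rmorphN1 mulN1r.
  move: e1; rewrite !pderD dN -!mulrA !dvZ dN !dvZ (rmorphM kc (ep j)) => e1.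
  transitivity (kc (ep j) * (kc mu * dv j (dv j h)
     - kc (d - 1) * dv j (dv j h)
     + kc (ep j) * kc 2%:R^-1 * dv j (xv j * lap p h))).
    transitivity (kc (mu - d + 1) * (kc (ep j) * dv j (dv j h))
      + (kc (ep j) * kc (ep j)) * kc 2%:R^-1 * dv j (xv j * lap p h)).
      by rewrite e2 mul1r.
    by ring.
  rewrite e1.
  transitivity (- ((kc (ep j) * kc (ep j)) * (kc kappa * dv j (xv j * rsq p V ^+ e)))).
    by ring.
  by rewrite e2 mul1r.
have : \sum_(j | j != top) (kc (mu - d + 1) * (kc (ep j) * dv j (dv j h))
      + kc 2%:R^-1 * dv j (xv j * lap p h)) =
    \sum_(j | j != top) - (kc kappa * dv j (xv j * rsq p V ^+ e)).
  exact: eq_bigr.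
rewrite big_split /= -!mulr_sumr sumrN -mulr_sumr.
rewrite -lapE (divergence D0 (eul_lap_eigen hd)) (divergence r0 er).
rewrite mulrA -rmorphM -mulrDl -rmorphD.
have -> : mu - d + 1 + 2%:R^-1 * (m%:R + (d - 2%:R)) = 0.
  apply: (mulfI two_neq0); rewrite mulr0.
  have -> : 2%:R * (mu - d + 1 + 2%:R^-1 * (m%:R + (d - 2%:R))) =
     (2%:R * mu + m%:R) - d by field.
  by rewrite muE subrr.
rewrite rmorph0 mul0r => /esym/eqP; rewrite oppr_eq0 => /eqP <-.
by rewrite mulrA -rmorphM -muln2 natrD natrM.
Qed.

End NonSplitting.

(** * Assembling direct sums *)

Lemma inj_surj_bijective (A B : Type) (f : A -> B) :
  injective f -> (forall y, exists x, f x = y) -> bijective f.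
Proof.
move=> fi fs; exists (fun y => sval (cid (fs y))) => [x|y].
  by apply: fi; case: cid.
by case: cid.
Qed.

Definition linear_map (R : nzRingType) (V1 V2 : lmodType R) (f : V1 -> V2)
    (hf : linear f) : {linear V1 -> V2} :=
  HB.pack f (GRing.isLinear.Build R V1 V2 *:%R f hf).

Lemma finite_support_bound (P : nat -> Prop) :
  finite_set [set i | P i]%classic -> exists N, forall i, P i -> (i < N)%N.
Proof.
move=> /finite_seqP[s sE]; exists (\max_(i <- s) i).+1 => i Pi.
rewrite ltnS; apply: leq_bigmax_seq => //.
by have : [set i | P i]%classic i by []; rewrite sE.
Qed.

(** The module E has coordinates in {poly W}. The coefficient of index b
    transforms like an element of M b, up to a term [mix] that involves the other
    coefficients. *)
Section Assembly.
Context (K : fieldType) (L : lieAlgType K) (W : comNzRingType).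
Context (sc : {rmorphism K -> W}).
Context (E : lmodType (U L)) (Psi : {poly W} -> E) (co : E -> {poly W}).
Hypothesis PsiB : zmod_morphism Psi.
Hypothesis PsiK : cancel Psi co.
Hypothesis coK : cancel co Psi.
Hypothesis Psi_alg : forall (c : K) f, c%:A *: Psi f = Psi ((sc c)%:P * f).
Context (M : nat -> lmodType (U L)) (psi : forall b, W -> M b).
Context (pinv : forall b, M b -> W).
Hypothesis psiB : forall b, zmod_morphism (psi b).
Hypothesis psiK : forall b, cancel (psi b) (@pinv b).
Hypothesis pinvK : forall b, cancel (@pinv b) (psi b).
Hypothesis psi_alg : forall b (c : K) f, c%:A *: psi b f = psi b (sc c * f).
Context (act : L -> nat -> W -> W) (mix : L -> {poly W} -> nat -> W).
Hypothesis psi_gen : forall b x f, ugen x *: psi b f = psi b (act x b f).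
Hypothesis Psi_gen : forall x (f : {poly W}), exists g : {poly W},
  (forall c, g`_c = act x c f`_c + mix x f c) /\ ugen x *: Psi f = Psi g.

Let coB z w : co (z - w) = co z - co w.
Proof. by apply: (can_inj PsiK); rewrite PsiB !coK. Qed.

Let co0 : co 0 = 0.
Proof. by rewrite -(subrr 0) coB subrr. Qed.

Let psi0 b : psi b 0 = 0.
Proof. by rewrite -(subrr 0) psiB subrr. Qed.

Let co_alg (c : K) z : co (c%:A *: z) = (sc c)%:P * co z.
Proof. by rewrite -{1}(coK z) Psi_alg PsiK. Qed.

Let co_gen x z d : (co (ugen x *: z))`_d = act x d (co z)`_d + mix x (co z) d.
Proof. by rewrite -{1}(coK z); have [g [gE ->]] := Psi_gen x (co z); rewrite PsiK. Qed.

Let act0 x b : act x b 0 = 0.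
Proof. by apply: (can_inj (psiK b)); rewrite -psi_gen psi0 scaler0. Qed.

Let pinvB b z w : @pinv b (z - w) = pinv z - pinv w.
Proof. by apply: (can_inj (psiK b)); rewrite psiB !pinvK. Qed.

Let psi_inj b : injective (psi b). Proof. exact: can_inj (psiK b). Qed.

Let supp_fin z b : psi b (co z)`_b != 0 -> (b < size (co z))%N.
Proof. by apply: contraNltn => h; rewrite nth_default ?psi0. Qed.

Section Split.
Hypothesis mix0 : forall x f c, mix x f c = 0.

Let comp_fin z : finite_set [set b | psi b (co z)`_b != 0]%classic.
Proof.
by apply: sub_finite_set (finite_II (size (co z))) => b /= /supp_fin.
Qed.

Let to_dsum z : dsum M := DSum (comp_fin z).

Let to_dsum_linear : linear to_dsum.
Proof.
apply: U_linear => [z w|c z|x z]; apply/dsumP => b /=.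
- by rewrite coB coefB psiB.
- by rewrite co_alg coefCM psi_alg.
- by rewrite co_gen mix0 addr0 psi_gen.
Qed.

Lemma assembly_split : mod_iso E (dsum M).
Proof.
exists (linear_map to_dsum_linear); apply: inj_surj_bijective => [z w|y].
  move/dsumP => h; rewrite -(coK z) -(coK w); congr Psi; apply/polyP => b.
  exact: psi_inj (h b).
have [N hN] := finite_support_bound (dsum_fin y).
exists (Psi (\poly_(b < N) pinv (dsum_val y b))).
apply/dsumP => b /=; rewrite PsiK coef_poly; case: ltnP => [_|Nb].
  exact: pinvK.
rewrite psi0; apply/esym/eqP/negP => /negP /hN.
by rewrite ltnNge Nb.
Qed.

End Split.

(** The coefficient of index 2k - a contributes to that of index a, for a < k, and
    there is no other mixing. The equation excluded by [no_splitting] is the one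
    satisfied by the coefficient h of index a of a singular vector with
    coefficient 1 in index 2k - a. *)
Section Linked.
Context (k : nat) (link : L -> nat -> W).
Hypothesis mixE : forall x (f : {poly W}) c,
  mix x f c = if (c < k)%N then f`_(2 * k - c) * link x c else 0.
Hypothesis no_splitting : forall a, (a < k)%N -> forall h : W,
  ~ forall x c, act x (2 * k - a) 1 = sc c -> act x a h + link x a = sc c * h.

Let in_pair (a : nat) z :=
  forall c, c != a -> c != (2 * k - a)%N -> (co z)`_c = 0.

Definition linked_pred a : {pred E} := fun z => `[< in_pair a z >].

Let in_pairB a z w : in_pair a z -> in_pair a w -> in_pair a (z - w).
Proof. by move=> hz hw c ca cb; rewrite coB coefB hz // hw // subrr. Qed.

Let in_pair_U a (ak : (a < k)%N) u z : in_pair a z -> in_pair a (u *: z).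
Proof.
elim/U_gen_ind: u z => [c z hz|x z hz|u v hu hv z hz|u v hu hv z hz].
- by move=> d da db; rewrite co_alg coefCM hz ?mulr0.
- move=> d da db; rewrite co_gen mixE hz // act0 add0r.
  case: ifP => // dk; rewrite hz ?mul0r //.
    by apply/eqP => e; lia.
  by apply/eqP => e; move/eqP: da; apply; lia.
- have h0 : in_pair a 0 by move=> d _ _; rewrite co0 coef0.
  rewrite scalerDl -[v *: z]opprK; apply: in_pairB; first exact: hu.
  by rewrite -sub0r; apply: in_pairB => //; apply: hv.
- by rewrite -scalerA; apply/hu/hv.
Qed.

Let linked_closed (a : 'I_k) : submod_closed (linked_pred a).
Proof.
split; first by apply/asboolP => c _ _; rewrite co0 coef0.
move=> u z w /asboolP hz /asboolP hw; apply/asboolP.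
rewrite -[w]opprK; apply: in_pairB; first exact: in_pair_U.
have h0 : in_pair a 0 by move=> d _ _; rewrite co0 coef0.
by rewrite -sub0r; apply: in_pairB.
Qed.

Definition linked_submod (a : 'I_k) : submodClosed E :=
  HB.pack (linked_pred a)
    (GRing.isSubmodClosed.Build (U L) E (linked_pred a)
      (GRing.submod_closed_semi (linked_closed a))).

Local Notation N := (fun a : 'I_k => submod (linked_submod a)).

Let mk (a : 'I_k) z (hz : z \in linked_submod a) : N a := exist _ z hz.

Let val_mk (a : 'I_k) z (hz : z \in linked_submod a) : val (mk hz) = z.
Proof. by []. Qed.

Let mem_linked (a : 'I_k) z : in_pair a z -> z \in linked_submod a.
Proof. by move=> h; apply/asboolP. Qed.

Let linked_mem (a : 'I_k) (y : N a) : in_pair a (val y).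
Proof. by case: y => z /= /asboolP. Qed.

Let neq_dual (a : 'I_k) : (2 * k - a)%N != a :> nat.
Proof. by apply/eqP; have := ltn_ord a; lia. Qed.

Let pair_poly (a : nat) (f : {poly W}) : {poly W} :=
  f`_a *: 'X^a + f`_(2 * k - a) *: 'X^(2 * k - a).

Let pair_polyE (a : 'I_k) f c : (pair_poly a f)`_c =
  if (c == a) || (c == 2 * k - a)%N then f`_c else 0.
Proof.
rewrite coefD !coefZ !coefXn; have := neq_dual a.
have [->|ca] := eqVneq c (a : nat); first by rewrite eq_sym => /negbTE ->; rewrite mulr1 mulr0 addr0.
by move=> _; case: eqVneq => [->|_]; rewrite ?mulr1 ?mulr0 add0r.
Qed.

Let pair_part_in (a : 'I_k) z : Psi (pair_poly a (co z)) \in linked_submod a.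
Proof.
apply: mem_linked => c /negbTE ca /negbTE cb.
by rewrite PsiK pair_polyE ca cb.
Qed.

Let pair_part (a : 'I_k) z : N a := mk (pair_part_in a z).

Let co_pair_part (a : 'I_k) z c : (co (val (pair_part a z)))`_c =
  if (c == a) || (c == 2 * k - a)%N then (co z)`_c else 0.
Proof. by rewrite val_mk PsiK pair_polyE. Qed.

Let linked_eq (a : 'I_k) (y y' : N a) :
  (forall c : nat, (c == a) || (c == 2 * k - a)%N ->
     (co (val y))`_c = (co (val y'))`_c) -> y = y'.
Proof.
move=> h; apply: val_inj; rewrite -[val y]coK -[val y']coK; congr Psi.
apply/polyP => c; have := h c.
have [_|ca] := eqVneq c (a : nat); first exact.
have [_|cb] := eqVneq c (2 * k - a)%N; first exact.
by rewrite !linked_mem.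
Qed.

Let pair_fin z : finite_set [set a : 'I_k | pair_part a z != 0]%classic.
Proof.
apply/finite_seqP; exists [seq a <- enum 'I_k | pair_part a z != 0].
by apply/seteqP; split=> a /=; rewrite mem_filter mem_enum andbT.
Qed.

Local Notation tail := {b : nat | (2 * k + 1 <= b)%N}.

Let tail_fin z :
  finite_set [set b : tail | psi (sval b) (co z)`_(sval b) != 0]%classic.
Proof.
apply: (@finite_preimage _ _ [set b | psi b (co z)`_b != 0]%classic sval).
  move=> [b hb] [c hc] _ _ /= bc; subst c; congr exist; exact: bool_irrelevance.
by apply: sub_finite_set (finite_II (size (co z))) => b /= /supp_fin.
Qed.

Let to_sum z : (dsum N * M k * dsum (fun b : tail => M (sval b)))%type :=
  (DSum (pair_fin z), psi k (co z)`_k, DSum (tail_fin z)).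

Let high_gen x z c : (k <= c)%N -> (co (ugen x *: z))`_c = act x c (co z)`_c.
Proof. by move=> kc; rewrite co_gen mixE ltnNge kc addr0. Qed.

Let to_sum_linear : linear to_sum.
Proof.
apply: U_linear => [z w|c z|x z]; apply: (congr2 pair (congr2 pair _ _) _);
  try (apply/dsumP => b /=).
- apply: linked_eq => c cab; rewrite co_pair_part cab raddfB /= !coB !coefB.
  by rewrite !co_pair_part cab.
- by rewrite coB coefB psiB.
- by rewrite coB coefB psiB.
- apply: linked_eq => d dab; rewrite co_pair_part dab.
  by rewrite linearZ /= !co_alg !coefCM co_pair_part dab.
- by rewrite co_alg coefCM psi_alg.
- by rewrite co_alg coefCM psi_alg.
- apply: linked_eq => d dab; rewrite co_pair_part dab.
  rewrite linearZ /= !co_gen !mixE !co_pair_part dab; congr (_ + _).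
  case: ifP => // dk; congr (_ * _).
  case: ifP => // /negbT; rewrite negb_or => /andP[_ /eqP h].
  by case/orP: dab => /eqP e; exfalso; apply: h; have := ltn_ord b; lia.
- by rewrite high_gen // psi_gen.
- by rewrite high_gen ?psi_gen //; have := svalP b; lia.
Qed.

Lemma assembly_linked : mod_iso E
  (dsum N * M k * dsum (fun b : tail => M (sval b)))%type.
Proof.
exists (linear_map to_sum_linear); apply: inj_surj_bijective => [z w|[[y1 y2] y3]].
  move=> h; have h1 : DSum (pair_fin z) = DSum (pair_fin w) := congr1 (fun t => t.1.1) h.
  have h2 : psi k (co z)`_k = psi k (co w)`_k := congr1 (fun t => t.1.2) h.
  have h3 : DSum (tail_fin z) = DSum (tail_fin w) := congr1 (fun t => t.2) h.
  rewrite -(coK z) -(coK w); congr Psi; apply/polyP => c.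
  have pairE (a : 'I_k) (d : nat) : (d == a) || (d == 2 * k - a)%N ->
      (co z)`_d = (co w)`_d.
    move=> dab; have := (dsumP _ _).2 h1 a => /= /(congr1 (fun y => (co (val y))`_d)).
    by rewrite !co_pair_part dab.
  have [ck|kc|->] := ltngtP c k; last exact: psi_inj h2.
    by apply: (pairE (Ordinal ck)); rewrite eqxx.
  have [c2k|c2k] := leqP c (2 * k).
    have dk : (2 * k - c < k)%N by lia.
    by apply: (pairE (Ordinal dk)); rewrite /= subKn ?eqxx ?orbT.
  have hc : (2 * k + 1 <= c)%N by lia.
  exact: psi_inj ((dsumP _ _).2 h3 (exist _ c hc)).
(* Indices c < k and their partners 2k - c are read off from the linked
   components, the others from the remaining summands. *)
pose F c : W :=
  if (c < k)%N then oapp (fun a : 'I_k => (co (val (dsum_val y1 a)))`_c) 0 (insub c)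
  else if c == k then pinv y2
  else if (c <= 2 * k)%N then
    oapp (fun a : 'I_k => (co (val (dsum_val y1 a)))`_c) 0 (insub (2 * k - c)%N)
  else oapp (fun b : tail => pinv (dsum_val y3 b)) 0 (insub c).
have [B hB] : exists B, forall b : tail, dsum_val y3 b != 0 -> (sval b < B)%N.
  have [B hB] := finite_support_bound (finite_image sval (dsum_fin y3)).
  by exists B => b yb; apply: hB; exists b.
pose f : {poly W} := \poly_(c < maxn B (2 * k).+1) F c.
have fE c : (c <= 2 * k)%N -> f`_c = F c.
  by move=> ck; rewrite coef_poly leq_max ltnS ck orbT.
have Fa (a : 'I_k) : F a = (co (val (dsum_val y1 a)))`_a.
  by rewrite /F ltn_ord valK.
have Fb (a : 'I_k) : F (2 * k - a)%N = (co (val (dsum_val y1 a)))`_(2 * k - a).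
  have ak := ltn_ord a.
  rewrite /F ifF; last by lia.
  rewrite ifF; last by apply/eqP; lia.
  rewrite ifT ?leq_subr // subKn ?valK //; lia.
exists (Psi f); apply: (congr2 pair (congr2 pair _ _) _); rewrite ?PsiK.
- apply/dsumP => a /=; apply: linked_eq => c cab; rewrite co_pair_part cab PsiK.
  case/orP: cab => /eqP ->; rewrite fE ?Fa ?Fb ?leq_subr //.
  by have := ltn_ord a; lia.
- by rewrite fE ?leq_pmull // /F ltnn eqxx pinvK.
- apply/dsumP => -[b hb] /=; rewrite PsiK coef_poly.
  have FE : F b = pinv (dsum_val y3 (exist _ b hb)).
    rewrite /F ifF; last by lia.
    rewrite ifF; last by apply/eqP; lia.
    rewrite ifF; last by lia.
    by rewrite (insubT (fun b => (2 * k + 1 <= b)%N) hb).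
  case: ltnP => [_|Bb]; first by rewrite FE pinvK.
  rewrite psi0; apply/esym/eqP/negP => /negP /hB /=.
  by rewrite ltnNge (leq_trans (leq_maxl _ _) Bb).
Qed.

Lemma assembly_nonsplit (a : 'I_k) :
  has_nonsplit_ses (M a) (N a) (M (2 * k - a)).
Proof.
have ak := ltn_ord a; have /negbTE nab := neq_dual a.
have in_part (b : nat) (w : W) : (b == a) || (b == 2 * k - a)%N ->
    Psi (w *: 'X^b) \in linked_submod a.
  move=> bab; apply: mem_linked => c ca cb; rewrite PsiK coefZ coefXn.
  have [cE|_] := eqVneq c b; last by rewrite mulr0.
  by case/orP: bab => /eqP bE; move: ca cb; rewrite cE bE eqxx.
have ina : (a == a :> nat) || (a == 2 * k - a :> nat)%N by rewrite eqxx.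
have inb : (2 * k - a == a)%N || (2 * k - a == 2 * k - a)%N by rewrite eqxx orbT.
pose i (z : M a) : N a := mk (in_part a (pinv z) ina).
pose q (y : N a) : M (2 * k - a)%N := psi _ (co (val y))`_(2 * k - a).
have coi z (c : nat) : (co (val (i z)))`_c = pinv z * (c == a)%:R.
  by rewrite val_mk PsiK coefZ coefXn.
have i_lin : linear i.
  apply: U_linear => [z w|c z|x z]; apply: linked_eq => d dab.
  - by rewrite raddfB /= coB coefB !coi pinvB mulrBl.
  - rewrite linearZ /= co_alg coefCM !coi mulrA; congr (_ * _).
    by apply: (can_inj (psiK a)); rewrite pinvK -psi_alg pinvK.
  - rewrite linearZ /= co_gen mixE !coi.
    have -> : pinv (ugen x *: z) = act x a (pinv z).
      by apply: (can_inj (psiK a)); rewrite pinvK -psi_gen pinvK.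
    have -> : (if (d < k)%N then pinv z * (2 * k - d == a)%N%:R * link x d else 0) = 0.
      case: ifP => // dk; rewrite (_ : (2 * k - d == a)%N = false) ?mulr0 ?mul0r //.
      by apply/eqP; lia.
    by rewrite addr0; case: eqVneq => [->|_]; rewrite ?mulr1 ?mulr0 ?act0.
have q_lin : linear q.
  apply: U_linear => [y w|c y|x y]; rewrite /q.
  - by rewrite raddfB /= coB coefB psiB.
  - by rewrite linearZ /= co_alg coefCM psi_alg.
  - by rewrite linearZ /= high_gen ?psi_gen //; lia.
exists (linear_map i_lin), (linear_map q_lin); split.
- move=> z w /(congr1 (fun y => (co (val y))`_a)); rewrite !coi eqxx !mulr1.
  exact: (can_inj (@pinvK a)).
- move=> y; split=> [/eqP|[z ->]]; last first.
    by rewrite /= /q coi nab mulr0 psi0.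
  rewrite /= /q -(psi0 (2 * k - a)) => /eqP /psi_inj y0.
  exists (psi a (co (val y))`_a); apply: linked_eq => c cab; rewrite coi psiK.
  by case/orP: cab => /eqP ->; rewrite ?eqxx ?mulr1 // nab mulr0.
- move=> z; exists (mk (in_part _ (pinv z) inb)).
  by rewrite /= /q val_mk PsiK coefZ coefXn eqxx mulr1 pinvK.
move=> [s qs]; pose y := s (psi (2 * k - a)%N 1).
have yb : (co (val y))`_(2 * k - a) = 1 by apply: psi_inj; apply: (qs (psi _ 1)).
apply: (no_splitting ak (h := (co (val y))`_a)) => x c xc.
have xy : ugen x *: y = c%:A *: y.
  by rewrite /y -!linearZ /= psi_gen xc psi_alg mulr1.
have := congr1 (fun y : N a => (co (val y))`_a) xy.
by rewrite !linearZ /= co_gen mixE ak yb mul1r co_alg coefCM.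
Qed.

End Linked.
End Assembly.

(** * The branching law *)

Section TestElements.
Context (K : fieldType) (p n : nat) (V : polyAlg K n).

(** Together with the raising operators, the grading element is enough to rule out
    a splitting. *)
Lemma rho_Emx mu (f : V) : rho p mu (Emx K n) f = pconst V mu * f - eul f.
Proof.
have E0 k l : Emx K n k l =
  ((k == ord0) && (l == ord0))%:R - ((k == ord_max) && (l == ord_max))%:R.
  exact: EmxE.
rewrite rho.unlock E0 !eqxx /= subr0 rmorph1 mul1r.
rewrite [X in _ + X + _ + _]big1 ?addr0 => [|i _]; last first.
  by rewrite E0 !ixE subrr rmorph0 mul0r.
rewrite [X in _ + X + _]big1 ?addr0 => [|i _]; last first.
  by rewrite big1 // => j _; rewrite E0 !ixE subrr rmorph0 mul0r.
rewrite big1 ?addr0 // => j _.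
by rewrite E0 !ixE andbF andFb subrr rmorph0 mul0r.
Qed.

Lemma rho_Kmx mu i (f : V) : rho p mu (Kmx K p i) f = kop p mu i f.
Proof.
have E0 k l : Kmx K p i k l =
  ((k == ord0) && (l == ix i))%:R - ep K p i * ((k == ix i) && (l == ord_max))%:R.
  exact: KmxE.
rewrite rho.unlock E0 !eqxx !ixE /= mulr0 subr0 rmorph0 mul0r add0r.
rewrite [X in X + _ + _]big1 ?add0r => [|j _]; last first.
  by rewrite E0 !ixE /= !andbF mulr0 subrr rmorph0 mul0r.
rewrite [X in X + _]big1 ?add0r => [|j _]; last first.
  by rewrite big1 // => l _; rewrite E0 !ixE /= !andbF mulr0 subrr rmorph0 mul0r.
rewrite (bigD1 i) //= big1 ?addr0 => [|j ji].
  by rewrite E0 !eqxx !ixE /= mulr0 subr0 rmorph1 mul1r.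
by rewrite E0 !ixE (inj_eq (@ix_inj n)) (negbTE ji) /= mulr0 subrr rmorph0 mul0r.
Qed.

End TestElements.

Section Branching.
Context (K : fieldType) (p m : nat).
Local Notation n := m.+1.
Local Notation W := {mpoly K[m]}.
Local Notation V := (iterated_polyAlg K m).
Hypothesis char0 : forall k, k.+1%:R != 0 :> K.
Hypothesis m_gt0 : (0 < m)%N.
Let two_neq0 : 2%:R != 0 :> K := char0 1.
Local Notation gl' := (lie_of (g'_lie K p n)).

Let basis_top : basis_vec K n n = delta_mx (ix ord_max) 0.
Proof. by congr delta_mx; apply: val_inj; rewrite /= inordK. Qed.

Lemma mem_g'_col (X : 'M[K]_n.+2) : X \in lsv (g_lie K p n) ->
  (forall k, X k (ix ord_max) = 0) -> X \in lsv (g'_lie K p n).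
Proof.
move=> gX X0; rewrite mem_g' gX; apply/eqP/matrixP => k l.
rewrite basis_top ord1 [LHS]mxE [RHS]mxE big1 // => t _; rewrite [_ t 0]mxE.
by case: eqP => [->|_]; rewrite ?X0 ?mul0r // mulr0.
Qed.

Lemma Emx_g' : Emx K n \in lsv (g'_lie K p n).
Proof.
by apply: mem_g'_col (Emx_g K p n) _ => k; rewrite EmxE !ixE !andbF subrr.
Qed.

Lemma Kmx_g' (j : 'I_m) : Kmx K p (lift ord_max j) \in lsv (g'_lie K p n).
Proof.
apply: mem_g'_col (Kmx_g K p _) _ => k.
by rewrite KmxE !ixE (inj_eq (@ix_inj n)) (negbTE (neq_lift _ _)) !andbF mulr0 subrr.
Qed.

Variable J : nat.
Let la : K := lambda K n J.

Let laJ : 2%:R * la + m%:R = J%:R.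
Proof. by rewrite /la /lambda -(natr1 m); field. Qed.

Local Notation E := (verma_res p n la).
Local Notation bvec := (branch_vec p m la J : nat -> {poly W}).
Local Notation M := (fun b => verma_g' p n (la - b%:R)).

Let T (f : {poly W}) : {poly W} := basis_sum bvec f.
Let T_inj : injective T.
Proof.
apply: basis_sum_inj => b; [exact: branch_vec_size|exact: branch_vec_lead].
Qed.
Let T_surj f : exists g, T g = f.
Proof.
apply: basis_sum_surj => b; [exact: branch_vec_size|exact: branch_vec_lead].
Qed.

Let Psi (f : {poly W}) : E := verma_of_poly p la (T f : V).

Let PsiB : zmod_morphism Psi.
Proof.
move=> f h; rewrite /Psi -[RHS](verma_of_polyB p la (T f : V) (T h : V)).
by congr verma_of_poly; apply: raddfB.
Qed.

Let Psi_inj : injective Psi.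
Proof.
move=> f h e; apply: T_inj.
exact: (can_inj (@verma_of_polyK K p m two_neq0 la) e).
Qed.

Let Psi_surj z : exists f, Psi f = z.
Proof.
have [g ->] := @verma_of_poly_surj K p m two_neq0 la z.
by have [f <-] := T_surj (g : {poly W}); exists f.
Qed.

Let co (z : E) : {poly W} := sval (cid (Psi_surj z)).
Let coK : cancel co Psi.
Proof. by move=> z; rewrite /co; case: cid. Qed.
Let PsiK : cancel Psi co.
Proof. by move=> f; apply: Psi_inj; rewrite coK. Qed.

Let sc : {rmorphism K -> W} := @mpolyC m K.

Let Psi_alg (c : K) f : c%:A *: Psi f = Psi ((sc c)%:P * f).
Proof.
rewrite [LHS]resmodZ (_ : Ug'_g K p n c%:A = c%:A); last exact: Uincl_alg.
apply: etrans (verma_of_polyZ p la c (T f : V)) _; congr verma_of_poly.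
by rewrite mul_polyC /T basis_sumZ.
Qed.

Let psi b (f : W) : M b := verma'_of_poly p (la - b%:R) f.

Let psi_inj b : injective (psi b).
Proof. exact: verma'_of_poly_inj. Qed.

Let psi_surj b z : exists f, psi b f = z.
Proof.
have [f ->] := @verma'_of_poly_surj K p m two_neq0 (la - b%:R) z.
by exists f.
Qed.

Let pinv b (z : M b) : W := sval (cid (psi_surj z)).
Let pinvK b : cancel (@pinv b) (psi b).
Proof. by move=> z; rewrite /pinv; case: cid. Qed.
Let psiK b : cancel (psi b) (@pinv b).
Proof. by move=> f; apply: (@psi_inj b); rewrite pinvK. Qed.

Let psiB b : zmod_morphism (psi b).
Proof.
move=> f h; apply/eqP; rewrite eq_sym subr_eq; apply/eqP.
by rewrite -[RHS](verma'_of_polyD p (la - b%:R)) subrK.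
Qed.

Let psi_alg b (c : K) f : c%:A *: psi b f = psi b (sc c * f).
Proof. exact: verma'_of_polyZ. Qed.

Let act (x : gl') b (f : W) : W := rho' p (la - b%:R) (lval x) f.

Let psi_gen b x f : ugen x *: psi b f = psi b (act x b f).
Proof. exact: (verma'_of_poly_gen_rho' two_neq0 (la - b%:R) x f).1. Qed.

Let mix (x : gl') (f : {poly W}) c : W :=
  if ~~ odd J && (c < J./2)%N then f`_(J - c) * link_term p la J (lval x) c else 0.

Let Psi_gen x (f : {poly W}) : exists g : {poly W},
  (forall c, g`_c = act x c f`_c + mix x f c) /\ ugen x *: Psi f = Psi g.
Proof.
have [g [gE e]] := rho_basis_sum char0 laJ x f; exists g; split; first exact: gE.
rewrite [LHS]resmodZ (_ : Ug'_g K p n (ugen x) =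
  ugen (lincl (lieI_subl (g_lie K p n) _) x)); last exact: Uincl_gen.
apply: etrans (verma_of_poly_gen two_neq0 la _ (T f : V)) _.
by congr verma_of_poly; rewrite lval_lincl.
Qed.

Lemma branching_odd : odd J -> mod_iso E (dsum M).
Proof.
move=> oJ; apply: (assembly_split PsiB PsiK coK Psi_alg psiB psiK pinvK psi_alg
  psi_gen Psi_gen) => x f c.
by rewrite /mix oJ.
Qed.

Section Even.
Variable k : nat.
Hypothesis Jk : J = (2 * k)%N.

Let mixE x (f : {poly W}) c :
  mix x f c = if (c < k)%N then f`_(2 * k - c) * link_term p la J (lval x) c else 0.
Proof. by rewrite /mix Jk mul2n odd_double doubleK. Qed.

Let rsqW_neq0 : rsqW K p m != 0.
Proof.
apply/eqP => r0; have := dv_rsq p V (lift ord_max (Ordinal m_gt0)).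
rewrite rsqE r0 polyC0 eq_sym (negbTE (neq_lift _ _)).
move/(congr1 (pder (lift ord_max (Ordinal m_gt0)))); rewrite !dv0 dvZ pder_var eqxx.
rewrite mulr1 => /esym/eqP; rewrite fmorph_eq0 mulf_eq0 (negbTE two_neq0).
by rewrite (negbTE (ep_neq0 _ _ _)).
Qed.

Let no_splitting a : (a < k)%N -> forall h : W,
  ~ forall x c, act x (2 * k - a) 1 = sc c ->
    act x a h + link_term p la J (lval x) a = sc c * h.
Proof.
move=> ak h H; set b := (2 * k - a)%N in H.
have Jhalf : J./2 = k by rewrite Jk mul2n doubleK.
pose e := (k - a).-1.
have actE (x : gl') mu (f : W) : rho p mu (lval x) (f%:P : V) = (rho' p mu (lval x) f)%:P.
  exact: (verma'_of_poly_gen_rho' two_neq0 mu x f).2.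
have hd : eul (h%:P : V) = pconst V (e.+1.*2)%:R * h%:P.
  pose x : gl' := lmk Emx_g'.
  have x1 : act x b 1 = sc (la - b%:R).
    apply: polyC_inj; rewrite -actE rho_Emx.
    by rewrite [eul _]eul1 subr0 mulr1.
  have := H x _ x1; rewrite /link_term big1 => [|j _]; last first.
    by rewrite EmxE !ixE andbF subrr mul0r mul0r.
  rewrite mulr0 mul0r addr0 => /(congr1 (fun f : W => f%:P : V)).
  rewrite -actE rho_Emx polyCM => e1.
  have -> : (e.+1.*2)%:R = (la - a%:R) - (la - b%:R) :> K.
    by rewrite opprB addrC addrA subrK -natrB; [congr _%:R|]; rewrite /b /e; lia.
  by rewrite rmorphB mulrBl -[X in _ - X]e1 subKr.
have hK (j : 'I_m.+1) : j != ord_max -> kop p (la - a%:R) j (h%:P : V) =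
    - (pconst V (obstruction p m la a e)
       * (pconst V (ep K p j) * pvar V j * rsq p V ^+ e)).
  move=> jt; case: (unliftP ord_max j) jt => [j' ->|->]; last by rewrite eqxx.
  move=> _; pose x : gl' := lmk (Kmx_g' j').
  have x1 : act x b 1 = sc 0.
    apply: polyC_inj; rewrite -actE rho_Kmx [kop _ _ _ _]kop1.
    by rewrite rmorph0 polyC0.
  have := H x _ x1; rewrite rmorph0 mul0r => /eqP; rewrite addr_eq0 => /eqP.
  move=> /(congr1 (fun f : W => f%:P : V)); rewrite -actE rho_Kmx => ->.
  rewrite /link_term Jhalf -/e (bigD1 j') //= big1 ?addr0 => [|i ij]; last first.
    rewrite KmxE !ixE (inj_eq (@ix_inj n)) (inj_eq lift_inj) (negbTE ij).
    by rewrite andbF mulr0 subrr !mul0r.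
  rewrite KmxE !eqxx !ixE mulr0 subr0 mul1r.
  rewrite polyCN !polyCM polyC_exp -rsqE -[('X_j')%:P]iter_var_lift -!mulrA.
  by [].
have muE : 2%:R * (la - a%:R) + m%:R = (e.+1.*2)%:R :> K.
  have -> : 2%:R * (la - a%:R) + m%:R = (2%:R * la + m%:R) - 2%:R * a%:R by ring.
  by rewrite laJ -natrM -natrB; [congr _%:R|]; rewrite /e; lia.
have S0 := @splitting_obstruction K p m V char0 _ _ _ (h%:P) muE (iter_der_max_polyC h) hd hK.
have : ((obstruction p m la a e * (m + e.*2)%:R)%:MP * rsqW K p m ^+ e)%:P
    = 0 :> {poly W}.
  by rewrite polyCM polyC_exp -rsqE; exact: S0.
apply/eqP.
rewrite polyC_eq0 mulf_neq0 ?expf_neq0 //.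
rewrite mpolyC_eq0 mulf_neq0 //.
  by apply: (obstruction_neq0 p char0 laJ); rewrite /e; lia.
by case: m m_gt0 => // m' _; rewrite addSn char0.
Qed.

Lemma branching_even : exists N : 'I_k -> submodClosed E,
  mod_iso E (dsum (fun a : 'I_k => submod (N a)) * M k
    * dsum (fun b : {b : nat | (2 * k + 1 <= b)%N} => M (sval b)))%type
  /\ forall a : 'I_k, has_nonsplit_ses (M a) (submod (N a)) (M (2 * k - a)%N).
Proof.
eexists; split.
  exact: (assembly_linked PsiB PsiK coK Psi_alg psiB psiK pinvK psi_alg
    psi_gen Psi_gen mixE).
move=> a; exact: (assembly_nonsplit PsiB PsiK coK Psi_alg psiB psiK pinvK psi_alg
    psi_gen Psi_gen mixE no_splitting).
Qed.

End Even.

End Branching.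

Theorem theorem4p10 (R : realType) (p q n : nat) (hp : (1 <= p)%N)
    (hq : (2 <= q)%N) (hpq : (4 < p + q)%N) (hn : n = (p + q - 2)%N) :
  (forall k : nat, (0 < k)%N ->
    let la : R[i] := lambda R[i] n (2 * k + 1) in
    mod_iso (verma_res p n la) (dsum (fun b : nat => verma_g' p n (la - b%:R))))
  /\
  (forall k : nat, (0 < k)%N ->
    let la : R[i] := lambda R[i] n (2 * k) in
    exists M : 'I_k -> submodClosed (verma_res p n la),
      mod_iso (verma_res p n la)
        (dsum (fun a : 'I_k => submod (M a))
         * verma_g' p n (la - k%:R)
         * dsum (fun b : {b : nat | (2 * k + 1 <= b)%N} =>
                   verma_g' p n (la - (sval b)%:R)))%type
      /\ forall a : 'I_k,
          has_nonsplit_ses (verma_g' p n (la - a%:R))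
                           (submod (M a))
                           (verma_g' p n (la - (2 * k - a)%N%:R))).
Proof.
have char0 k : k.+1%:R != 0 :> R[i] by rewrite Num.Theory.pnatr_eq0.
case: n hn => [|m] hn; first by lia.
have m_gt0 : (0 < m)%N by lia.
split=> k _ la.
  by apply: branching_odd => //; rewrite oddD oddM.
exact (@branching_even R[i] p m char0 m_gt0 (2 * k)%N k erefl).
Qed.
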